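(* Let $\psi:\mathbb{D}\to\mathbb{D}$ be an analytic function. Then \[\limsup_{|w|\rightarrow 1^{-}}\frac{N_{\psi}(w)}{1 - |w|} = \limsup_{|a|\rightarrow 1^{-}}\int_{\mathbb{T}}\frac{1 - |a|^2}{|1 - \bar{a}\psi(\zeta)|^2}\,dm(\zeta),\] where $w$ and $a$ range over $\mathbb{D}$.
   Context: $\mathbb{D}=\{z\in\mathbb{C}:|z|<1\}$ and $\mathbb{T}=\{z\in\mathbb{C}:|z|=1\}$; $m$ is normalized Lebesgue measure on $\mathbb{T}$ (so $m(\mathbb{T})=1$). An analytic $\psi:\mathbb{D}\to\mathbb{D}$ has nontangential boundary values at $m$-almost every point of $\mathbb{T}$; this boundary function is also denoted $\psi$. The Nevanlinna counting function of $\psi$ is defined for $w\in\mathbb{D}$ by \[N_{\psi}(w) := -\sum_{z\in\psi^{-1}(\{w\})}\log|z|,\] where each $z\in\mathbb{D}$ with $\psi(z)=w$ is counted according to its multiplicity as a zero of $\psi-w$, and $N_\psi(w)=0$ if $\psi^{-1}(\{w\})=\emptyset$. Values lie in $[0,\infty]$, with $-\log 0=\infty$. *)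

(* Defs.v *)
(* The complex plane is R[i] for R : realType.  Its topology is that of the
   normed space R[i]^o (the field R[i] seen over itself), so that derivability
   below is complex differentiability. *)
From HB Require Import structures.
From mathcomp Require Import all_boot all_order all_algebra complex.
From mathcomp Require Import all_classical all_reals all_analysis.
Set Implicit Arguments.
Unset Strict Implicit.
Unset Printing Implicit Defensive.
Import Order.TTheory GRing.Theory Num.Theory numFieldNormedType.Exports.
Local Open Scope classical_set_scope.
Local Open Scope ring_scope.

(* The modulus as an element of R; the generic norm `|z| takes values in R[i]. *)
Notation cabs z := (Normc.normc z).

Section Nevanlinna.
Variable R : realType.
Implicit Types (psi : R[i] -> R[i]) (z w zeta : R[i]).

Definition disc : set R[i] := [set z | cabs z < 1].

Definition analytic_on (D : set R[i]) (f : R[i] -> R[i]) : Prop :=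
  forall z, D z -> derivable (f : R[i]^o -> R[i]^o) z 1.

(* Multiplicity of z as a zero of psi - w in the disc: the largest n such that
   (u - z)^n divides psi(u) - w in the ring of analytic functions on the disc;
   it is +oo when psi is constantly w there. *)
Definition zero_mult psi w z : \bar R :=
  ereal_sup [set (n%:R)%:E | n in [set n : nat |
    exists2 g : R[i] -> R[i], analytic_on disc g &
      forall u, disc u -> psi u - w = (u - z) ^+ n * g u]].

(* A sum over a possibly infinite set of points, with values in [0, +oo];
   lne 0 = -oo, so a zero at the origin contributes +oo. *)
Definition nevanlinna psi w : \bar R :=
  \esum_(z in [set z | disc z /\ psi z = w])
    (zero_mult psi w z * - lne (cabs z)%:E)%E.

Definition stolz (alpha : R) zeta : set R[i] :=
  [set z | disc z /\ cabs (z - zeta) < alpha * (1 - cabs z)].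

(* Convergence along this filter is convergence in every Stolz region at zeta. *)
Definition nontangential zeta : set_system R[i]^o :=
  [set V | forall alpha : R, 1 < alpha ->
     within (stolz alpha zeta) (nbhs (zeta : R[i]^o)) V].

(* lim takes a default value at the points without a nontangential limit, which
   form a null set of the unit circle when psi is analytic and bounded. *)
Definition boundary psi zeta : R[i] :=
  lim ((psi : R[i]^o -> R[i]^o) @ nontangential zeta).

(* Normalized Lebesgue measure on the unit circle is the image of dt / (2 pi) on
   [0, 2 pi] under t |-> exp(it). *)
Definition circle_integral (f : R[i] -> \bar R) : \bar R :=
  (((2 * pi)^-1)%:E *
   \int[lebesgue_measure]_(t in `[0%R, (2 * pi)%R]) f (Complex (cos t) (sin t)))%E.

(* The filter |z| -> 1^-; it contains the annuli r < |z| < 1, hence the disc. *)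
Definition to_circle : set_system R[i]^o :=
  [set V | \forall r \near (1 : R)^'-, forall z, cabs z = r -> V z].

End Nevanlinna.

Arguments to_circle {R}.
Arguments disc {R}.

(* Main.v *)
Require Import Defs.
From HB Require Import structures.
From mathcomp Require Import all_boot all_order all_algebra complex finmap.
From mathcomp Require Import all_classical all_reals all_analysis.
From mathcomp Require Import measurable_realfun ring lra.
Import Order.TTheory GRing.Theory Num.Theory numFieldNormedType.Exports.
Import HBNNSimple.
Local Open Scope classical_set_scope.
Local Open Scope ring_scope.
Set Implicit Arguments.
Unset Strict Implicit.
Unset Printing Implicit Defensive.

(** Write phi_w(v) = (v - w) / (1 - conjc w v), and I(w) for the circle integral
    on the right-hand side. Both inequalities between the limits superior rest on
    one identity and on a form of Jensen's inequality.

    The identity ([pker_sker_mean]) is the mean value property of the real part of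
    (1 + conjc w psi) / (1 - conjc w psi). As
    1 - |phi_w(v)|^2 = (1 - |w|^2) (1 - |v|^2) / |1 - conjc w v|^2, it says that
    large circles give the square mean of phi_w(psi) in terms of I(w), up to
    explicit terms in psi(0) that are negligible when |w| tends to 1.

    The counting function is at most the integral ([counting_le]): finitely many
    zeros of psi - w can be divided out of phi_w(psi) as a Blaschke product, whose
    modulus tends to 1 at the circle, so the square of the value of the quotient at
    0 is at most the mean of |phi_w(psi)|^2 over large circles. That value is |phi_w(psi(0))|
    divided by the product of the moduli of the zeros. Taking logarithms bounds
    the sum of -log|z| over the zeros, divided by 1 - |w|, by I(w) / |w|^2 plus a
    term that tends to 0 with 1 - |w|.

    The integral is at most the counting function ([integral_le]): suppose
    N(w) <= L (1 - |w|) for r0 < |w| < 1, and let g = phi_a(psi) with |a| close to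
    1. Jensen's inequality for g - v, averaged over a circle |v| = q, gives by
    Cartan's formula a lower bound for ln|g(0)| in terms of the mean of
    ln (max q |g|), in which the zeros of g - v contribute at most N(w) for the
    preimage w of v under phi_a ([cartan_jensen]). As q tends to 1, ln (max q |g|)
    is at least -(1 - |g|^2) / 2 in the limit, and the identity turns the mean of
    1 - |g|^2 into I(a).

    The integral over the circle itself is reached from inside. Fatou's theorem
    ([fatou]) follows from the almost everywhere differentiability of Lipschitz
    functions: a primitive of psi is Lipschitz, and where its boundary function is
    differentiable the maximum principle carries the first-order expansion into
    the Stolz regions ([fatou_point]). Dominated convergence along the radii then
    gives I(a) as the limit of means over smaller circles
    ([circle_integral_lim]).

    The complex analysis needed is built from Goursat's theorem for the cone over
    a segment, through Cauchy's formula, the maximum principle and the inequality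
    between the mean of log|h| and log|h(0)| for h without zeros. *)

(** * Complex moduli and limits *)

Section ComplexBasics.
Variable R : realType.
Local Notation C := R[i].
Implicit Types z w u : C.

Lemma cabsE z : cabs z = Num.sqrt (complex.Re z ^+ 2 + complex.Im z ^+ 2).
Proof. by case: z. Qed.

Lemma sqr_cabs z : cabs z ^+ 2 = complex.Re z ^+ 2 + complex.Im z ^+ 2.
Proof. by rewrite cabsE sqr_sqrtr// addr_ge0// sqr_ge0. Qed.

Lemma cabs_ge0 z : 0 <= cabs z.
Proof. by rewrite cabsE sqrtr_ge0. Qed.

Lemma cabs0 : cabs (0 : C) = 0.
Proof. by rewrite cabsE /= expr0n addr0 sqrtr0. Qed.

Lemma cabs1 : cabs (1 : C) = 1.
Proof. exact: Normc.normc1. Qed.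

Lemma cabs_eq0 z : (cabs z == 0) = (z == 0).
Proof.
by apply/eqP/eqP => [/Normc.eq0_normc //|->]; exact: cabs0.
Qed.

Lemma cabs_gt0 z : (0 < cabs z) = (z != 0).
Proof. by rewrite lt_neqAle cabs_ge0 andbT eq_sym cabs_eq0. Qed.

Lemma cabsM z w : cabs (z * w) = cabs z * cabs w.
Proof. exact: Normc.normcM. Qed.

Lemma cabsV z : cabs z^-1 = (cabs z)^-1.
Proof. exact: Normc.normcV. Qed.

Lemma cabsN z : cabs (- z) = cabs z.
Proof. exact: normcN. Qed.

Lemma cabsD z w : cabs (z + w) <= cabs z + cabs w.
Proof. exact: le_normcD. Qed.

Lemma cabsC z w : cabs (z - w) = cabs (w - z).
Proof. by rewrite -cabsN opprB. Qed.

Lemma cabsB_ge z w : cabs z - cabs w <= cabs (z - w).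
Proof. by rewrite lerBlDr -{1}(subrK w z) cabsD. Qed.

Lemma cabsB_le z w u : cabs (z - w) <= cabs (z - u) + cabs (u - w).
Proof. by rewrite -{1}(subrK u z) -addrA cabsD. Qed.

Lemma cabs_real (x : R) : cabs x%:C%C = `|x|.
Proof. by rewrite cabsE /= expr0n addr0 sqrtr_sqr. Qed.

Lemma cabsX z n : cabs (z ^+ n) = cabs z ^+ n.
Proof. by elim: n => [|n IH]; rewrite ?expr0 ?cabs1// !exprS cabsM IH. Qed.

Lemma cabs_conj z : cabs (conjc z) = cabs z.
Proof. by case: z => a b /=; rewrite sqrrN. Qed.

Lemma cabs_Re z : `|complex.Re z| <= cabs z.
Proof. by rewrite -sqrtr_sqr cabsE ler_wsqrtr// lerDl sqr_ge0. Qed.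

Lemma cabs_Im z : `|complex.Im z| <= cabs z.
Proof. by rewrite -sqrtr_sqr cabsE ler_wsqrtr// lerDr sqr_ge0. Qed.

Lemma cabs_ReIm z : cabs z <= `|complex.Re z| + `|complex.Im z|.
Proof.
rewrite cabsE -(ger0_norm (addr_ge0 (normr_ge0 _) (normr_ge0 _))) -sqrtr_sqr.
rewrite ler_wsqrtr// sqrrD !real_normK ?num_real// -addrA lerD2l lerDr.
by rewrite mulrn_wge0// mulr_ge0.
Qed.

Lemma mul_conjc z : z * conjc z = (cabs z ^+ 2)%:C%C.
Proof.
rewrite sqr_cabs; case: z => a b; apply/eqP; rewrite eq_complex /=.
by apply/andP; split; apply/eqP; ring.
Qed.

Lemma cReD z w : complex.Re (z + w) = complex.Re z + complex.Re w.
Proof. by case: z w => a b []. Qed.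
Lemma cImD z w : complex.Im (z + w) = complex.Im z + complex.Im w.
Proof. by case: z w => a b []. Qed.
Lemma cReB z w : complex.Re (z - w) = complex.Re z - complex.Re w.
Proof. by case: z w => a b []. Qed.
Lemma cImB z w : complex.Im (z - w) = complex.Im z - complex.Im w.
Proof. by case: z w => a b []. Qed.
Lemma cReM z w : complex.Re (z * w) =
  complex.Re z * complex.Re w - complex.Im z * complex.Im w.
Proof. by case: z w => a b []. Qed.
Lemma cImM z w : complex.Im (z * w) =
  complex.Re z * complex.Im w + complex.Im z * complex.Re w.
Proof. by case: z w => a b []. Qed.

Lemma complex_eqP z w :
  complex.Re z = complex.Re w -> complex.Im z = complex.Im w -> z = w.
Proof. by case: z w => a b [c d] /= -> ->. Qed.

(** The norm of R[i]^o takes values in R[i]; its balls are exchanged here for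
    balls of the real modulus. *)
Lemma cnbhsP z (P : set C) : nbhs (z : C^o) P <->
  exists2 e : R, 0 < e & forall u, cabs (u - z) < e -> P u.
Proof.
split.
  move=> /nbhs_ballP[e /= e0 H].
  have : 0 <= e by exact: ltW.
  rewrite lecE /= => /andP[/eqP Im0 _].
  have eE : e = (complex.Re e)%:C%C by case: e e0 H Im0 => a b /= _ _ ->.
  exists (complex.Re e).
    by move: e0; rewrite eE ltcR.
  move=> u uz; apply: H; rewrite /ball /= eE.
  by rewrite -opprB normrN [ `|_|](_ : _ = (cabs (u - z))%:C%C)// ltcR.
move=> [e e0 H]; apply/nbhs_ballP; exists e%:C%C => /=; first by rewrite ltcR.
move=> u; rewrite /ball /= => zu; apply: H; rewrite -ltcR.
by rewrite (_ : (cabs (u - z))%:C%C = `|u - z|)// -opprB normrN.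
Qed.

Lemma ccvgP T (F : set_system T) {FF : Filter F} (f : T -> C) (l : C) :
  (f : T -> C^o) @ F --> (l : C^o) <->
  forall e : R, 0 < e -> \forall x \near F, cabs (f x - l) < e.
Proof.
split.
  move=> fl e e0; apply: (fl [set u | cabs (u - l) < e]).
  by apply/cnbhsP; exists e.
move=> H P /cnbhsP[e e0 eP]; rewrite /nbhs /=.
by near=> x; apply: eP; near: x; exact: H.
Unshelve. all: by end_near. Qed.

Lemma continuous_Re : continuous (@complex.Re R : C^o -> R).
Proof.
move=> z; apply/(@cvgrPdist_lt _ _ _ (nbhs (z : C^o))) => e e0; apply/cnbhsP; exists e => // u uz.
by rewrite -normrN opprB -cReB (le_lt_trans (cabs_Re _)).
Qed.

Lemma continuous_Im : continuous (@complex.Im R : C^o -> R).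
Proof.
move=> z; apply/(@cvgrPdist_lt _ _ _ (nbhs (z : C^o))) => e e0; apply/cnbhsP; exists e => // u uz.
by rewrite -normrN opprB -cImB (le_lt_trans (cabs_Im _)).
Qed.

Lemma continuous_cabs : continuous ((fun z => cabs z) : C^o -> R).
Proof.
move=> z; apply/(@cvgrPdist_lt _ _ _ (nbhs (z : C^o))) => e e0; apply/cnbhsP; exists e => // u uz.
rewrite (le_lt_trans _ uz)// ler_norml; apply/andP; split.
  by rewrite lerNl opprB cabsB_ge.
by rewrite cabsC cabsB_ge.
Qed.

Lemma cvg_complex T (F : set_system T) {FF : Filter F} (f g : T -> R) (a b : R) :
  f @ F --> a -> g @ F --> b ->
  ((fun x => Complex (f x) (g x)) : T -> C^o) @ F --> (Complex a b : C^o).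
Proof.
move=> fa gb; apply/ccvgP => e e0.
have e20 : 0 < e / 2 by rewrite divr_gt0.
near=> x.
apply: (le_lt_trans (cabs_ReIm _)); rewrite /= (splitr e) ltrD//.
  rewrite -normrN opprB; near: x.
  by move/cvgrPdist_lt : fa; exact.
rewrite -normrN opprB; near: x.
by move/cvgrPdist_lt : gb; exact.
Unshelve. all: by end_near. Qed.

End ComplexBasics.

(** * Integrals and derivatives along real segments *)

Section RealIntegral.
Variable R : realType.
Local Notation mu := (@lebesgue_measure R).
Implicit Types (a b c : R) (f g F : R -> R).

Definition rint a b f : R := \int[mu]_(t in `[a, b]) f t.

Lemma ctsW a b f : {in `[a, b], continuous f} -> {within `[a, b], continuous f}.
Proof. by move=> cf; apply: continuous_in_subspaceT => x; rewrite inE => /cf. Qed.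

Lemma cts_integrable a b f :
  {in `[a, b], continuous f} -> mu.-integrable `[a, b] (EFin \o f).
Proof.
move=> cf; apply: continuous_compact_integrable; last exact: ctsW.
exact: segment_compact.
Qed.

Lemma rintD a b f g : {in `[a, b], continuous f} -> {in `[a, b], continuous g} ->
  rint a b (fun t => f t + g t) = rint a b f + rint a b g.
Proof. by move=> cf cg; rewrite /rint RintegralD//; exact: cts_integrable. Qed.

Lemma rintB a b f g : {in `[a, b], continuous f} -> {in `[a, b], continuous g} ->
  rint a b (fun t => f t - g t) = rint a b f - rint a b g.
Proof. by move=> cf cg; rewrite /rint RintegralB//; exact: cts_integrable. Qed.

Lemma rintZ a b k f : {in `[a, b], continuous f} ->
  rint a b (fun t => k * f t) = k * rint a b f.
Proof. by move=> cf; rewrite /rint RintegralZl//; exact: cts_integrable. Qed.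

Lemma rint_le a b f g : {in `[a, b], continuous f} -> {in `[a, b], continuous g} ->
  (forall t, a <= t <= b -> f t <= g t) -> rint a b f <= rint a b g.
Proof.
by move=> cf cg fg; apply: le_Rintegral => //; exact: cts_integrable.
Qed.

Lemma eq_rint a b f g : (forall t, a <= t <= b -> f t = g t) ->
  rint a b f = rint a b g.
Proof. by move=> fg; apply: eq_Rintegral => t; rewrite inE/= in_itv/= => /fg. Qed.

Lemma rint_cst a b k : a <= b -> rint a b (fun=> k) = k * (b - a).
Proof.
move=> ab; rewrite /rint Rintegral_cst//= lebesgue_measure_itv/= lte_fin.
case: ltP => // ba; have -> : b = a by apply/eqP; rewrite eq_le ab ba.
by rewrite subrr.
Qed.

Lemma is_derive_continuous f (t d : R) : is_derive t (1 : R) f d -> {for t, continuous f}.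
Proof. by move=> H; apply/differentiable_continuous/derivable1_diffP. Qed.

Lemma rint_FTC a b f F : a <= b -> {in `[a, b], continuous f} ->
  (forall t, a <= t <= b -> is_derive t 1 F (f t)) -> rint a b f = F b - F a.
Proof.
move=> ab cf dF; have [{}ab|ba] := ltP a b; last first.
  have -> : b = a by apply/eqP; rewrite eq_le ab ba.
  by rewrite subrr /rint set_itv1 Rintegral_set1.
rewrite /rint /Rintegral (@continuous_FTC2 _ _ F)//; first exact: ctsW.
  split.
  - by move=> x /andP[ax xb]; apply: ex_derive; apply: dF; rewrite !ltW.
  - apply: cvg_at_right_filter; apply: is_derive_continuous; apply: dF.
    by rewrite lexx ltW.
  - apply: cvg_at_left_filter; apply: is_derive_continuous; apply: dF.
    by rewrite lexx ltW.
move=> x; rewrite in_itv/= => /andP[ax xb].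
by rewrite derive1E; apply: derive_val; apply: dF; rewrite !ltW.
Qed.

Lemma continuous_clamp a b : continuous (fun t : R => Num.min b (Num.max a t)).
Proof.
move=> t; apply: (@continuous_min _ _ (fun=> b) (fun t => Num.max a t) t).
  exact: cvg_cst.
by apply: (@continuous_max _ _ (fun=> a) id t); [exact: cvg_cst|exact: cvg_id].
Qed.

(** The integrand is extended by constants outside the interval, so that its
    integral is differentiable at the end points too. *)
Lemma ex_primitive a b f : a <= b -> {in `[a, b], continuous f} ->
  exists F, forall t, a <= t <= b -> is_derive t 1 F (f t).
Proof.
move=> ab cf; pose cl t := Num.min b (Num.max a t).
have clab t : cl t \in `[a, b].
  by rewrite in_itv/= /cl le_min ab le_max lexx /= ge_min lexx.
have cfc : continuous (f \o cl).
  move=> t; apply: continuous_comp; first exact: continuous_clamp.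
  exact: cf.
exists (fun x => \int[mu]_(t in `[a - 1, x]) (f \o cl) t) => t /andP[at_ tb].
have [] := @continuous_FTC1_closed R (f \o cl) (a - 1) t (t + 1).
- by rewrite ltrDl.
- by apply: cts_integrable => ? _; exact: cfc.
- lra.
- exact: cfc.
move=> dF F'; have -> : f t = (f \o cl) t.
  by rewrite /= /cl (max_idPr _)// (min_idPr _).
rewrite -F'; apply: DeriveDef; first exact: dF.
rewrite derive1E; reflexivity.
Qed.

End RealIntegral.

Section ComplexIntegral.
Variable R : realType.
Local Notation C := R[i].
Local Notation Re := (@complex.Re R).
Local Notation Im := (@complex.Im R).
Implicit Types (a b t : R) (f g c : R -> C) (G : C -> C) (z w d k : C).

Definition cint a b f : C :=
  Complex (rint a b (fun t => Re (f t))) (rint a b (fun t => Im (f t))).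

Definition ccts a b f := {in `[a, b], continuous (f : R -> C^o)}.

Lemma ccts_Re a b f : ccts a b f -> {in `[a, b], continuous (fun t => Re (f t))}.
Proof.
move=> cf t tab; apply: (@continuous_comp _ _ _ (f : R -> C^o) Re t).
  exact: cf.
exact: continuous_Re.
Qed.

Lemma ccts_Im a b f : ccts a b f -> {in `[a, b], continuous (fun t => Im (f t))}.
Proof.
move=> cf t tab; apply: (@continuous_comp _ _ _ (f : R -> C^o) Im t).
  exact: cf.
exact: continuous_Im.
Qed.

Lemma ccts_cabs a b f : ccts a b f -> {in `[a, b], continuous (fun t => cabs (f t))}.
Proof.
move=> cf t tab; apply: (@continuous_comp _ _ _ (f : R -> C^o) (fun z => cabs z) t).
  exact: cf.
exact: continuous_cabs.
Qed.

Lemma ccts_cst a b k : ccts a b (fun=> k).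
Proof. by move=> t _; exact: cvg_cst. Qed.

Lemma cctsM a b f g : ccts a b f -> ccts a b g -> ccts a b (fun t => f t * g t).
Proof. by move=> cf cg t tab; apply: cvgM; [exact: cf|exact: cg]. Qed.

Lemma cctsB a b f g : ccts a b f -> ccts a b g -> ccts a b (fun t => f t - g t).
Proof. by move=> cf cg t tab; apply: cvgB; [exact: cf|exact: cg]. Qed.

Lemma eq_cint a b f g : (forall t, a <= t <= b -> f t = g t) ->
  cint a b f = cint a b g.
Proof. by move=> fg; congr Complex; apply: eq_rint => t /fg ->. Qed.

Lemma cintD a b f g : ccts a b f -> ccts a b g ->
  cint a b (fun t => f t + g t) = cint a b f + cint a b g.
Proof.
move=> cf cg; apply: complex_eqP; rewrite /cint ?cReD ?cImD /= -rintD.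
- by apply: eq_rint => t _; rewrite cReD.
- exact: ccts_Re.
- exact: ccts_Re.
- by apply: eq_rint => t _; rewrite cImD.
- exact: ccts_Im.
- exact: ccts_Im.
Qed.

Lemma cintZ a b k f : ccts a b f -> cint a b (fun t => k * f t) = k * cint a b f.
Proof.
move=> cf; have cR := ccts_Re cf; have cI := ccts_Im cf.
have cZ (r : R) (h : R -> R) : {in `[a, b], continuous h} ->
    {in `[a, b], continuous (fun t => r * h t)}.
  by move=> ch t tab; apply: cvgM; [exact: cvg_cst|exact: ch].
apply: complex_eqP; rewrite /cint.
- rewrite [RHS]cReM /= -!rintZ// -rintB; [|exact: cZ|exact: cZ].
  by apply: eq_rint => t _; rewrite cReM.
- rewrite [RHS]cImM /= -!rintZ// -rintD; [|exact: cZ|exact: cZ].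
  by apply: eq_rint => t _; rewrite cImM.
Qed.

Lemma cintN a b f : ccts a b f -> cint a b (fun t => - f t) = - cint a b f.
Proof.
move=> cf; rewrite -mulN1r -cintZ//; apply: eq_cint => t _; by rewrite mulN1r.
Qed.

Lemma cintB a b f g : ccts a b f -> ccts a b g ->
  cint a b (fun t => f t - g t) = cint a b f - cint a b g.
Proof.
move=> cf cg; have cn : ccts a b (fun t => - g t) by move=> t tab; apply: cvgN; exact: cg.
rewrite (cintD cf cn) (cintN cg); reflexivity.
Qed.

Lemma cint_cst a b k : a <= b -> cint a b (fun=> k) = k * (b - a)%:C%C.
Proof.
move=> ab; rewrite /cint !rint_cst//; by apply: complex_eqP; rewrite [RHS](cReM, cImM) /=; ring.
Qed.

(** The integral I is rotated to the positive real axis: |I|^2 is the integral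
    of the real part of conjc I times f. *)
Lemma cabs_cint_le a b f : ccts a b f ->
  cabs (cint a b f) <= rint a b (fun t => cabs (f t)).
Proof.
move=> cf; set I := cint a b f.
have [->|I0] := eqVneq I 0.
  rewrite cabs0; apply: Rintegral_ge0 => t _; exact: cabs_ge0.
have := @cintZ a b (conjc I) f cf; rewrite -/I mulrC mul_conjc.
move=> /(congr1 Re) /= E.
rewrite -(ler_pM2l (_ : 0 < cabs I)) ?cabs_gt0// -expr2 -E.
rewrite -rintZ; last exact: ccts_cabs.
apply: rint_le.
- by apply: (@ccts_Re a b (fun t => conjc I * f t)); exact: (cctsM (@ccts_cst a b (conjc I)) cf).
- move=> t tab; apply: cvgM; [exact: cvg_cst|exact: (ccts_cabs cf tab)].
- move=> t _; rewrite -(cabs_conj I) -cabsM; apply: le_trans (cabs_Re _).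
  exact: ler_norm.
Qed.

Lemma cabs_cint_bound a b f (M : R) : a <= b -> ccts a b f ->
  (forall t, a <= t <= b -> cabs (f t) <= M) -> cabs (cint a b f) <= M * (b - a).
Proof.
move=> ab cf fM; apply: (le_trans (cabs_cint_le cf)).
rewrite -rint_cst//; apply: rint_le => //; first exact: ccts_cabs.
by move=> t _; exact: cvg_cst.
Qed.

(** Componentwise, so that the real fundamental theorem of calculus applies. *)
Definition path_derive c t d := is_derive t (1:R) (fun s => Re (c s)) (Re d) /\
  is_derive t (1:R) (fun s => Im (c s)) (Im d).

Lemma cvg_complexP T (F : set_system T) {FF : Filter F} (f : T -> C) (l : C) :
  (f : T -> C^o) @ F --> (l : C^o) <->
  ((fun x => Re (f x)) @ F --> Re l /\ (fun x => Im (f x)) @ F --> Im l).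
Proof.
split=> [fl|[f1 f2]].
  split.
    by apply: (@cvg_comp _ _ _ (f : T -> C^o) Re _ (nbhs (l : C^o))) => //; exact: continuous_Re.
  by apply: (@cvg_comp _ _ _ (f : T -> C^o) Im _ (nbhs (l : C^o))) => //; exact: continuous_Im.
rewrite (_ : f = (fun x => Complex (Re (f x)) (Im (f x)))); last first.
  by apply/funext => x; case: (f x).
by case: l f1 f2 => x y f1 f2; exact: cvg_complex.
Qed.

Lemma path_deriveP c t d : path_derive c t d <->
  ((fun h : R => (h^-1)%:C%C * (c (h + t) - c t)) : R -> C^o) @ 0^' --> (d : C^o).
Proof.
have E1 h : Re ((h^-1)%:C%C * (c (h + t) - c t)) =
    h^-1 *: ((fun s => Re (c s)) (h *: (1:R) + t) - Re (c t)).
  by rewrite cReM /= mul0r subr0 cReB /GRing.scale /= mulr1.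
have E2 h : Im ((h^-1)%:C%C * (c (h + t) - c t)) =
    h^-1 *: ((fun s => Im (c s)) (h *: (1:R) + t) - Im (c t)).
  by rewrite cImM /= mul0r addr0 cImB /GRing.scale /= mulr1.
rewrite cvg_complexP; split=> [[[D1 V1] [D2 V2]]|[H1 H2]].
  split.
    under eq_fun do rewrite E1; rewrite -V1; exact: D1.
  under eq_fun do rewrite E2; rewrite -V2; exact: D2.
split; apply: DeriveDef.
- by apply/cvg_ex; exists (Re d); under eq_fun do rewrite -E1.
- by apply/cvg_lim => //; under eq_fun do rewrite -E1.
- by apply/cvg_ex; exists (Im d); under eq_fun do rewrite -E2.
- by apply/cvg_lim => //; under eq_fun do rewrite -E2.
Qed.

Lemma cint_FTC a b f F : a <= b -> ccts a b f ->
  (forall t, a <= t <= b -> path_derive F t (f t)) -> cint a b f = F b - F a.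
Proof.
move=> ab cf dF; apply: complex_eqP; rewrite /cint ?cReB ?cImB /=.
- exact: (rint_FTC (F := fun s => Re (F s)) ab (ccts_Re cf) (fun t h => (dF t h).1)).
- exact: (rint_FTC (F := fun s => Im (F s)) ab (ccts_Im cf) (fun t h => (dF t h).2)).
Qed.

Lemma ex_cprimitive a b f : a <= b -> ccts a b f ->
  exists F : R -> C, forall t, a <= t <= b -> path_derive F t (f t).
Proof.
move=> ab cf; have [F HF] := ex_primitive ab (ccts_Re cf).
have [G HG] := ex_primitive ab (ccts_Im cf).
by exists (fun t => Complex (F t) (G t)) => t tab; split; [exact: HF|exact: HG].
Qed.

Lemma path_derive_continuous c t d : path_derive c t d ->
  {for t, continuous (c : R -> C^o)}.
Proof.
by move=> [/is_derive_continuous H1 /is_derive_continuous H2]; apply/(@cvg_complexP _ (nbhs t)).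
Qed.

Lemma path_derive_affine p d t : path_derive (fun s => p + s%:C%C * d) t d.
Proof.
apply/path_deriveP; apply/ccvgP => e e0; near=> h.
have h0 : h != 0 by near: h; exact: nbhs_dnbhs_neq.
suff -> : (h^-1)%:C%C * (p + (h + t)%:C%C * d - (p + t%:C%C * d)) = d.
  by rewrite subrr cabs0.
rewrite (_ : p + _ - _ = h%:C%C * d); last by rewrite rmorphD /=; ring.
by rewrite mulrA -rmorphM /= mulVf// mul1r.
Unshelve. all: by end_near. Qed.

End ComplexIntegral.

(** * Complex derivatives and integrals along segments *)

Section ComplexDerivative.
Variable R : realType.
Local Notation C := R[i].
Local Notation Re := (@complex.Re R).
Local Notation Im := (@complex.Im R).
Implicit Types (a b t : R) (f g G : C -> C) (c : R -> C) (z w u d k : C).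

Definition cderivable f z := derivable (f : C^o -> C^o) z 1.
Definition ccontinuous f z := {for z, continuous (f : C^o -> C^o)}.
Definition cderive f z : C := 'D_1 (f : C^o -> C^o) z.

(** Caratheodory's difference quotient, completed by the derivative. *)
Definition dquo f z u : C :=
  if u == z then cderive f z else (f u - f z) / (u - z).

Lemma dquoE f z u : f u = f z + dquo f z u * (u - z).
Proof.
rewrite /dquo; case: eqVneq => [->|uz]; first by rewrite subrr mulr0 addr0.
by rewrite mulfVK ?subr_eq0// addrC subrK.
Qed.

Lemma dquo_self f z : dquo f z z = cderive f z.
Proof. by rewrite /dquo eqxx. Qed.

Lemma dquo_neq f z u : u != z -> dquo f z u = (f u - f z) / (u - z).
Proof. by rewrite /dquo => /negPf ->. Qed.

Lemma dquo_continuous f z : cderivable f z -> ccontinuous (dquo f z) z.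
Proof.
move=> df; apply/(@ccvgP _ _ (nbhs (z : C^o))) => e e0.
have /cvg_ex[l fl] := df.
have lE : l = cderive f z by apply/esym/cvg_lim.
move/(@ccvgP _ _ (dnbhs (0 : C^o))) : fl => /(_ e e0) /cnbhsP[r r0 H].
apply/cnbhsP; exists r => // u ur; rewrite dquo_self.
have [->|uz] := eqVneq u z; first by rewrite dquo_self subrr cabs0.
rewrite dquo_neq// -lE.
have := H (u - z); rewrite subr0 => /(_ ur).
rewrite /= subr_eq0 => /(_ uz).
have -> : ((u - z) *: (1 : C^o) : C^o) = u - z by exact: mulr1.
by rewrite subrK -[_ *: _]/(_ * _) mulrC.
Qed.

Lemma dquo_derivable f g z : ccontinuous g z ->
  (\forall u \near (z : C^o), f u = f z + g u * (u - z)) ->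
  cderivable f z /\ cderive f z = g z.
Proof.
move=> cg fg.
suff fl : (fun h : C^o => h^-1 *: (f (h *: (1 : C^o) + z) - f z) : C^o) @ 0^' --> (g z : C^o).
  by split; [apply/cvg_ex; exists (g z)|exact: (cvg_lim (@norm_hausdorff _ C^o) fl)].
apply/(@ccvgP _ _ (dnbhs (0 : C^o))) => e e0.
move/(@ccvgP _ _ (nbhs (z : C^o))) : cg => /(_ e e0) /cnbhsP[r r0 H].
have /cnbhsP[r' r0' H'] := fg.
apply/cnbhsP; exists (Num.min r r'); first by rewrite lt_min r0.
move=> h; rewrite subr0 lt_min => /andP[hr hr'] /= h0.
have -> : (h *: (1 : C^o) : C^o) = h by exact: mulr1.
rewrite H' ?addrK// addrAC subrr add0r.
rewrite -[_ *: _]/(_ * _) mulrC mulfK//.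
by apply: H; rewrite addrK.
Qed.

Lemma cderivable_continuous f z : cderivable f z -> ccontinuous f z.
Proof. by move=> df; apply/differentiable_continuous/derivable1_diffP. Qed.

Lemma ccontinuousP f z : ccontinuous f z <->
  forall e : R, 0 < e -> exists2 r : R, 0 < r &
    forall u, cabs (u - z) < r -> cabs (f u - f z) < e.
Proof.
rewrite /ccontinuous; split.
  move=> /(@ccvgP _ _ (nbhs (z : C^o))) H e e0.
  by have /cnbhsP := H e e0.
move=> H; apply/(@ccvgP _ _ (nbhs (z : C^o))) => e e0.
by apply/cnbhsP; exact: H.
Qed.

Lemma ccontinuous_cst k z : ccontinuous (fun=> k) z.
Proof. exact: (@cvg_cst C^o k C^o (nbhs (z : C^o))). Qed.

Lemma ccontinuous_id z : ccontinuous id z.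
Proof. exact: (@cvg_id _ (nbhs (z : C^o))). Qed.

Lemma ccontinuousD f g z : ccontinuous f z -> ccontinuous g z ->
  ccontinuous (fun u => f u + g u) z.
Proof. by move=> cf cg; exact: (@continuousD _ _ _ (f : C^o -> C^o) g z cf cg). Qed.

Lemma ccontinuousB f g z : ccontinuous f z -> ccontinuous g z ->
  ccontinuous (fun u => f u - g u) z.
Proof. by move=> cf cg; exact: (@continuousB _ _ _ (f : C^o -> C^o) g z cf cg). Qed.

Lemma ccontinuousM f g z : ccontinuous f z -> ccontinuous g z ->
  ccontinuous (fun u => f u * g u) z.
Proof. by move=> cf cg; exact: (@continuousM _ _ (f : C^o -> C^o) g z cf cg). Qed.

Lemma cderivable_expand f z : cderivable f z ->
  forall e : R, 0 < e -> exists2 r : R, 0 < r &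
    forall u, cabs (u - z) < r ->
      cabs (f u - (f z + cderive f z * (u - z))) <= e * cabs (u - z).
Proof.
move=> df e e0; have /ccontinuousP/(_ e e0)[r r0 H] := dquo_continuous df.
exists r => // u ur.
rewrite (_ : f u - _ = (dquo f z u - cderive f z) * (u - z)); last first.
  by rewrite {1}(dquoE f z u); ring.
rewrite cabsM.
by rewrite ler_wpM2r ?cabs_ge0//ltW// -dquo_self; exact: H.
Qed.

Lemma path_derive_comp G c t k : cderivable G (c t) -> path_derive c t k ->
  path_derive (fun s => G (c s)) t (cderive G (c t) * k).
Proof.
move=> dG dc; have /path_deriveP ck := dc; apply/path_deriveP.
have -> : (fun h : R => (h^-1)%:C%C * (G (c (h + t)) - G (c t))) =
    (fun h : R => dquo G (c t) (c (h + t)) * ((h^-1)%:C%C * (c (h + t) - c t))).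
  by apply/funext => h; rewrite {1}(dquoE G (c t)); ring.
apply: cvgM; last exact: ck.
rewrite -dquo_self.
apply: (@cvg_comp _ _ _ (fun h => c (h + t) : C^o) (dquo G (c t) : C^o -> C^o) _
  (nbhs (c t : C^o))); last exact: dquo_continuous.
have cc := path_derive_continuous dc.
apply: (@cvg_comp _ _ _ (fun h => h + t) (c : R -> C^o) _ (nbhs t)) => //.
have : (fun h : R => h + t) @ 0^' --> 0 + t.
  by apply: cvgD; [exact: nbhs_dnbhs|exact: cvg_cst].
by rewrite add0r.
Qed.

Definition seg (p q : C) (s : R) : C := p + s%:C%C * (q - p).
Definition segint f p q : C := (q - p) * cint 0 1 (fun s => f (seg p q s)).

Lemma seg0 p q : seg p q 0 = p.
Proof. by rewrite /seg mul0r addr0. Qed.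

Lemma seg1 p q : seg p q 1 = q.
Proof. by rewrite /seg mul1r addrC subrK. Qed.

Lemma seg_path_derive p q t : path_derive (seg p q) t (q - p).
Proof. exact: path_derive_affine. Qed.

Lemma seg_continuous p q : continuous (seg p q : R -> C^o).
Proof. by move=> t; apply: path_derive_continuous (seg_path_derive p q t). Qed.

Definition segcts f p q := forall s, 0 <= s <= 1 -> ccontinuous f (seg p q s).

Lemma segcts_ccts f p q : segcts f p q -> ccts 0 1 (fun s => f (seg p q s)).
Proof.
move=> cf t; rewrite in_itv/= => t01.
apply: (@continuous_comp _ _ _ (seg p q : R -> C^o) (f : C^o -> C^o) t).
  exact: seg_continuous.
exact: cf.
Qed.

Lemma segint_bound f p q (M : R) : segcts f p q ->
  (forall s, 0 <= s <= 1 -> cabs (f (seg p q s)) <= M) ->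
  cabs (segint f p q) <= M * cabs (q - p).
Proof.
move=> cf fM; rewrite /segint cabsM mulrC ler_wpM2r ?cabs_ge0//.
apply: le_trans (cabs_cint_bound ler01 (segcts_ccts cf) fM) _.
by rewrite subr0 mulr1.
Qed.

End ComplexDerivative.

(** * Goursat's theorem *)

Section Goursat.
Variable R : realType.
Local Notation C := R[i].
Local Notation Re := (@complex.Re R).
Local Notation Im := (@complex.Im R).
Implicit Types (a b t : R) (f g G : C -> C) (c : R -> C) (z w u d k p q : C).

Lemma path_derive_scomp (F : R -> C) (s : R -> R) t (r : R) d :
  path_derive F (s t) d -> is_derive t (1:R) s r ->
  path_derive (fun x => F (s x)) t (r%:C%C * d).
Proof.
move=> [H1 H2] Hs; split.
  rewrite (_ : Re _ = r * Re d); last by case: d {H1 H2} => ? ? /=; ring.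
  rewrite mulrC; exact: (@is_derive1_comp _ (fun s => Re (F s)) s t (Re d) r).
rewrite (_ : Im _ = r * Im d); last by case: d {H1 H2} => ? ? /=; ring.
rewrite mulrC; exact: (@is_derive1_comp _ (fun s => Im (F s)) s t (Im d) r).
Qed.

Lemma is_derive_affine a b t : is_derive t (1:R) (fun s => a + s * b) b.
Proof.
have [H _] := path_derive_affine a%:C%C b%:C%C t; move: H => /=.
rewrite (_ : (fun s => _) = (fun s => a + s * b))//.
by apply/funext => s; rewrite mulr0 subr0.
Qed.

Lemma segint_FTC f F p q : segcts f p q ->
  (forall s, 0 <= s <= 1 -> cderivable F (seg p q s) /\
     cderive F (seg p q s) = f (seg p q s)) ->
  segint f p q = F q - F p.
Proof.
move=> cf dF; rewrite /segint -cintZ; last exact: segcts_ccts.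
have cg : ccts 0 1 (fun s => (q - p) * f (seg p q s)).
  by apply: cctsM; [exact: ccts_cst|exact: segcts_ccts].
apply: etrans (cint_FTC (F := fun s => F (seg p q s)) ler01 cg _) _.
  move=> t /dF[d1 d2]; rewrite mulrC -d2.
  by apply: path_derive_comp => //; exact: seg_path_derive.
by rewrite seg0 seg1.
Qed.

Lemma seg_seg p q a b s : seg (seg p q a) (seg p q b) s = seg p q (a + s * (b - a)).
Proof. by rewrite /seg !rmorphD !rmorphM rmorphB /=; ring. Qed.

Lemma itv01_affine a b s : 0 <= a <= 1 -> 0 <= b <= 1 -> 0 <= s <= 1 ->
  0 <= a + s * (b - a) <= 1.
Proof. by move=> /andP[a0 a1] /andP[b0 b1] /andP[s0 s1]; apply/andP; split; nra. Qed.

(** Integrals over sub-segments of one segment are increments of one primitive,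
    and hence add up. *)
Lemma segint_sub f p q : segcts f p q -> exists F : R -> C,
  forall a b, 0 <= a <= 1 -> 0 <= b <= 1 ->
    segint f (seg p q a) (seg p q b) = F b - F a.
Proof.
move=> cf.
have cf' : ccts 0 1 (fun s => (q - p) * f (seg p q s)).
  by apply: cctsM; [exact: ccts_cst|exact: segcts_ccts].
have [F HF] := ex_cprimitive ler01 cf'.
exists F => a b a01 b01.
have cfab : segcts f (seg p q a) (seg p q b).
  by move=> s s01; rewrite seg_seg; apply: cf; exact: itv01_affine.
rewrite /segint -cintZ; last exact: segcts_ccts.
have cg : ccts 0 1 (fun s => (seg p q b - seg p q a) * f (seg (seg p q a) (seg p q b) s)).
  by apply: cctsM; [exact: ccts_cst|exact: segcts_ccts].
apply: etrans (cint_FTC (F := fun s => F (a + s * (b - a))) ler01 cg _) _.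
  move=> t t01.
  rewrite seg_seg (_ : _ * _ = (b - a)%:C%C * ((q - p) * f (seg p q (a + t * (b - a)))));
    last by rewrite /seg rmorphB /=; ring.
  apply: (path_derive_scomp (s := fun t => a + t * (b - a))).
    by apply: HF; exact: itv01_affine.
  exact: is_derive_affine.
by rewrite mul0r mul1r addr0 (addrC a) subrK.
Qed.

Lemma segint_cat f p q a b (d : R) : segcts f p q ->
  0 <= a <= 1 -> 0 <= b <= 1 -> 0 <= d <= 1 ->
  segint f (seg p q a) (seg p q d) =
  segint f (seg p q a) (seg p q b) + segint f (seg p q b) (seg p q d).
Proof. by move=> /segint_sub[F HF] *; rewrite !HF//; ring. Qed.

Lemma nested_itv (v : nat -> R) (L : R) :
  (forall n, v n <= v n.+1) ->
  (forall n, v n.+1 + L / 2 ^+ n.+1 <= v n + L / 2 ^+ n) -> 0 <= L ->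
  exists x, forall n, v n <= x <= v n + L / 2 ^+ n.
Proof.
move=> v1 v2 L0.
have mono m n : (m <= n)%N -> v m <= v n.
  elim: n => [|n IH]; first by rewrite leqn0 => /eqP->.
  by rewrite leq_eqVlt ltnS => /orP[/eqP->//|/IH/le_trans]; apply.
have mono' m n : (m <= n)%N -> v n + L / 2 ^+ n <= v m + L / 2 ^+ m.
  elim: n => [|n IH]; first by rewrite leqn0 => /eqP->.
  by rewrite leq_eqVlt ltnS => /orP[/eqP->//|/IH]; apply: le_trans.
have ub m n : v n <= v m + L / 2 ^+ m.
  have /orP[mn|nm] := leq_total m n.
    by apply: le_trans (mono' _ _ mn); rewrite lerDl divr_ge0// exprn_ge0.
  by apply: (le_trans (mono _ _ nm)); rewrite lerDl divr_ge0// exprn_ge0.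
have hs : has_sup (range v).
  by split; [exists (v 0%N); exists 0%N|exists (v 0%N + L / 2 ^+ 0) => _ [n _ <-]].
exists (sup (range v)) => n; apply/andP; split.
  by apply: ub_le_sup; [exact: hs.2|exists n].
by apply: ge_sup; [exact: hs.1|move=> _ [m _ <-]].
Qed.

Section Quad.
Variables (A P Q : C) (f : C -> C).

(** Bisection takes place in the parameter square of the cone with vertex A over
    the segment from P to Q: quadrilaterals are halved by halving parameters, and
    triangles with vertex A are the degenerate case s = 0. *)
Definition cone (s t : R) : C := seg A (seg P Q t) s.

Definition quad (s0 s1 t0 t1 : R) : C :=
  segint f (cone s0 t0) (cone s0 t1) + segint f (cone s0 t1) (cone s1 t1)
  - segint f (cone s1 t0) (cone s1 t1) - segint f (cone s0 t0) (cone s1 t0).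

Lemma coneE s t : cone s t = seg (cone s 0) (cone s 1) t.
Proof. by rewrite /cone /seg rmorph0 rmorph1; ring. Qed.

Let M := cabs (P - A) + cabs (Q - P).

Lemma cone_dist s s' t t' : 0 <= s' <= 1 -> 0 <= t <= 1 ->
  cabs (cone s t - cone s' t') <= (`|s - s'| + `|t - t'|) * M.
Proof.
move=> /andP[s0 s1] /andP[t0 t1].
have -> : cone s t - cone s' t' = (s - s')%:C%C * (P - A) + (s - s')%:C%C * (t%:C%C * (Q - P))
   + s'%:C%C * ((t - t')%:C%C * (Q - P)).
  by rewrite /cone /seg !rmorphB /=; ring.
apply: (le_trans (cabsD _ _)); apply: (le_trans (lerD (cabsD _ _) (lexx _))).
rewrite !cabsM !cabs_real (ger0_norm s0) (ger0_norm t0) /M.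
have x0 := cabs_ge0 (Q - P); have y0 := cabs_ge0 (P - A).
have x'0 := normr_ge0 (t - t'); have y'0 := normr_ge0 (s - s').
set x := cabs (Q - P) in x0 *; set y := cabs (P - A) in y0 *.
set x' := `|t - t'| in x'0 *; set y' := `|s - s'| in y'0 *.
have H1 : y' * (t * x) <= y' * x by rewrite ler_wpM2l// ler_piMl.
have H2 : s' * (x' * x) <= x' * x by rewrite ler_piMl// mulr_ge0.
have H3 : 0 <= x' * y by rewrite mulr_ge0.
lra.
Qed.

Variables (S0 S1 : R).
Hypotheses (S00 : 0 <= S0) (S01 : S0 <= S1) (S11 : S1 <= 1).
Hypothesis df : forall s t, S0 <= s <= S1 -> 0 <= t <= 1 -> cderivable f (cone s t).

Lemma cone_segcts_t s t0 t1 : S0 <= s <= S1 -> 0 <= t0 <= 1 -> 0 <= t1 <= 1 ->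
  segcts f (cone s t0) (cone s t1).
Proof.
move=> hs h0 h1 x x01; rewrite (coneE s t0) (coneE s t1) seg_seg -coneE.
by apply/cderivable_continuous/df => //; exact: itv01_affine.
Qed.

Lemma cone_segcts_s t s0 s1 : S0 <= s0 <= S1 -> S0 <= s1 <= S1 -> 0 <= t <= 1 ->
  segcts f (cone s0 t) (cone s1 t).
Proof.
move=> /andP[h1 h2] /andP[h3 h4] ht x /andP[x0 x1]; rewrite seg_seg.
apply/cderivable_continuous/df => //; apply/andP; split; nra.
Qed.

Lemma hsplit s t0 tm t1 : S0 <= s <= S1 -> 0 <= t0 <= 1 -> 0 <= tm <= 1 -> 0 <= t1 <= 1 ->
  segint f (cone s t0) (cone s t1) =
  segint f (cone s t0) (cone s tm) + segint f (cone s tm) (cone s t1).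
Proof.
move=> hs h0 hm h1; rewrite (coneE s t0) (coneE s t1) (coneE s tm).
by apply: segint_cat => //; apply: cone_segcts_t; rewrite ?lexx ?ler01.
Qed.

Lemma vsplit t s0 sm s1 : S0 <= s0 -> s0 <= sm -> sm <= s1 -> s1 <= S1 -> 0 <= t <= 1 ->
  segint f (cone s0 t) (cone s1 t) =
  segint f (cone s0 t) (cone sm t) + segint f (cone sm t) (cone s1 t).
Proof.
move=> h0 h1 h2 h3 ht.
have [e|e] := eqVneq s0 s1.
  have -> : sm = s0 by apply/eqP; rewrite eq_le h1 e h2.
  rewrite -e; have -> : segint f (cone s0 t) (cone s0 t) = 0 by rewrite /segint subrr mul0r.
  by rewrite addr0.
have cs : segcts f (cone s0 t) (cone s1 t).
  by apply: cone_segcts_s => //; apply/andP; split; lra.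
have d0 : 0 < s1 - s0 by rewrite subr_gt0 lt_neqAle e; lra.
pose x := (sm - s0) / (s1 - s0).
have x01 : 0 <= x <= 1.
  apply/andP; split; first by apply: divr_ge0; lra.
  by rewrite ler_pdivrMr// mul1r; lra.
have xE : cone sm t = seg (cone s0 t) (cone s1 t) x.
  rewrite seg_seg /cone; congr (seg _ _ _); rewrite /x mulfVK ?gt_eqF//.
  by rewrite addrC subrK.
have /= := @segint_cat f _ _ 0 x 1 cs; rewrite seg0 seg1 -xE => -> //.
  by rewrite lexx ler01.
by rewrite lexx ler01.
Qed.

Lemma quad_split s0 sm s1 t0 tm t1 :
  S0 <= s0 -> s0 <= sm -> sm <= s1 -> s1 <= S1 ->
  0 <= t0 -> t0 <= tm -> tm <= t1 -> t1 <= 1 ->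
  quad s0 s1 t0 t1 = quad s0 sm t0 tm + quad sm s1 t0 tm
    + quad s0 sm tm t1 + quad sm s1 tm t1.
Proof.
move=> a1 a2 a3 a4 b1 b2 b3 b4; rewrite /quad.
rewrite (@hsplit s0 t0 tm t1)//; try (by apply/andP; split; lra).
rewrite (@hsplit s1 t0 tm t1)//; try (by apply/andP; split; lra).
rewrite (@vsplit t0 s0 sm s1)//; try (by apply/andP; split; lra).
rewrite (@vsplit t1 s0 sm s1)//; try (by apply/andP; split; lra).
have alg (x1 x2 y1 y2 z1 z2 w1 w2 m1 m2 v1 v2 : C) :
    x1 + x2 + (y1 + y2) - (z1 + z2) - (w1 + w2) =
    x1 + v1 - m1 - w1 + (m1 + v2 - z1 - w2) + (x2 + y1 - m2 - v1)
      + (m2 + y2 - z2 - v2) by ring.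
exact: alg.
Qed.

End Quad.
End Goursat.

Section Goursat2.
Variable R : realType.
Local Notation C := R[i].
Implicit Types (a b t : R) (f g G : C -> C) (c : R -> C) (z w u d : C).

Lemma segintB f g (p q : C) : segcts f p q -> segcts g p q ->
  segint (fun u => f u - g u) p q = segint f p q - segint g p q.
Proof.
by move=> cf cg; rewrite /segint -mulrBr -cintB; [|exact: segcts_ccts|exact: segcts_ccts].
Qed.

Lemma affine_continuous (x y z0 z : C) : ccontinuous (fun u => x + y * (u - z0)) z.
Proof.
apply: ccontinuousD; first exact: ccontinuous_cst.
apply: ccontinuousM; first exact: ccontinuous_cst.
by apply: ccontinuousB; [exact: ccontinuous_id|exact: ccontinuous_cst].
Qed.

Lemma affine_primitive (x y z0 z : C) :
  cderivable (fun u => x * (u - z0) + y / 2 * (u - z0) ^+ 2) z /\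
  cderive (fun u => x * (u - z0) + y / 2 * (u - z0) ^+ 2) z = x + y * (z - z0).
Proof.
rewrite (_ : x + y * (z - z0) = x + y / 2 * (z - (z0 + z0 - z))); last by field.
apply: (@dquo_derivable _ _ (fun u => x + y / 2 * (u - (z0 + z0 - z)))).
  exact: affine_continuous.
by apply: (@filterE _ (nbhs (z : C^o))) => u; field.
Qed.

Lemma segint_affine (x y z0 p q : C) :
  segint (fun u => x + y * (u - z0)) p q =
  (x * (q - z0) + y / 2 * (q - z0) ^+ 2) - (x * (p - z0) + y / 2 * (p - z0) ^+ 2).
Proof.
apply: (@segint_FTC _ _ (fun u => x * (u - z0) + y / 2 * (u - z0) ^+ 2)) => s _.
  exact: affine_continuous.
exact: affine_primitive.
Qed.

Lemma pick_quarter (x y z w v : R) : v <= x + y + z + w ->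
  [\/ v <= 4 * x, v <= 4 * y, v <= 4 * z | v <= 4 * w].
Proof.
move=> h; have [?|?] := lerP v (4 * x); first exact: Or41.
have [?|?] := lerP v (4 * y); first exact: Or42.
have [?|?] := lerP v (4 * z); first exact: Or43.
apply: Or44; lra.
Qed.

Lemma small_le0 (K B : R) : (forall e, 0 < e -> K <= e * B) -> K <= 0.
Proof.
move=> H; rewrite leNgt; apply/negP => K0.
have B0 : 0 < B.
  by have := H 1 ltr01; rewrite mul1r; apply: lt_le_trans.
have := H (K / (2 * B)); rewrite (_ : K / (2 * B) * B = K / 2); last by field; rewrite gt_eqF.
by rewrite divr_gt0// ?mulr_gt0// => /(_ isT); lra.
Qed.

Lemma cabs_sum4 (x1 x2 x3 x4 y1 y2 y3 y4 : C) (B : R) : cabs (x1 - y1) <= B ->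
  cabs (x2 - y2) <= B -> cabs (x3 - y3) <= B -> cabs (x4 - y4) <= B ->
  cabs (x1 + x2 - x3 - x4 - (y1 + y2 - y3 - y4)) <= 4 * B.
Proof.
move=> b1 b2 b3 b4.
have -> : x1 + x2 - x3 - x4 - (y1 + y2 - y3 - y4) =
  (x1 - y1) + (x2 - y2) + - (x3 - y3) + - (x4 - y4) by ring.
have c1 := cabsD (x1 - y1 + (x2 - y2) + - (x3 - y3)) (- (x4 - y4)).
have c2 := cabsD (x1 - y1 + (x2 - y2)) (- (x3 - y3)).
have c3 := cabsD (x1 - y1) (x2 - y2).
by rewrite !cabsN in c1 c2; lra.
Qed.

Section Nested.
Variables (A P Q : C) (f : C -> C) (S0 S1 : R).
Hypotheses (S00 : 0 <= S0) (S01 : S0 <= S1) (S11 : S1 <= 1).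
Hypothesis df : forall s t, S0 <= s <= S1 -> 0 <= t <= 1 -> cderivable f (cone A P Q s t).

Let L := S1 - S0.
Let h n : R := L / 2 ^+ n.
Let k n : R := 1 / 2 ^+ n.
Let sq n (p : R * R) := quad A P Q f p.1 (p.1 + h n) p.2 (p.2 + k n).
Let valid n (p : R * R) := [/\ S0 <= p.1, p.1 + h n <= S1, 0 <= p.2 & p.2 + k n <= 1].

Let halfS (x : R) n : x / 2 ^+ n = x / 2 ^+ n.+1 + x / 2 ^+ n.+1.
Proof.
have n0 : (2 : R) ^+ n != 0 by rewrite expf_neq0.
by rewrite exprS; field.
Qed.

Let h0 n : 0 <= h n. Proof. by rewrite divr_ge0 ?exprn_ge0// subr_ge0. Qed.
Let k0 n : 0 <= k n. Proof. by rewrite divr_ge0 ?exprn_ge0. Qed.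

Let step : forall np : nat * (R * R), exists p', valid np.1 np.2 ->
  [/\ valid np.1.+1 p',
      np.2.1 <= p'.1 /\ p'.1 + h np.1.+1 <= np.2.1 + h np.1,
      np.2.2 <= p'.2 /\ p'.2 + k np.1.+1 <= np.2.2 + k np.1
    & cabs (sq np.1 np.2) <= 4 * cabs (sq np.1.+1 p')].
Proof.
move=> [n [s t]] /=.
have [v|nv] := pselect (valid n (s, t)); last by exists (s, t).
have hS : h n = h n.+1 + h n.+1 by exact: halfS.
have kS : k n = k n.+1 + k n.+1 by exact: halfS.
have hp := h0 n.+1; have kp := k0 n.+1.
have [/= v1 v2 v3 v4] := v.
have [f1 f2 f3] : [/\ s <= s + h n.+1, s + h n.+1 <= s + h n & s + h n.+1 + h n.+1 <= s + h n].
  by split; lra.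
have [g1 g2 g3] : [/\ t <= t + k n.+1, t + k n.+1 <= t + k n & t + k n.+1 + k n.+1 <= t + k n].
  by split; lra.
have [a2 a3] : s + h n <= S1 /\ t + k n <= 1 by [].
have E : sq n (s, t) = sq n.+1 (s, t) + sq n.+1 (s + h n.+1, t)
   + sq n.+1 (s, t + k n.+1) + sq n.+1 (s + h n.+1, t + k n.+1).
  have -> : sq n.+1 (s + h n.+1, t) = quad A P Q f (s + h n.+1) (s + h n) t (t + k n.+1).
    by rewrite /sq /= -addrA -hS.
  have -> : sq n.+1 (s, t + k n.+1) = quad A P Q f s (s + h n.+1) (t + k n.+1) (t + k n).
    by rewrite /sq /= -addrA -kS.
  have -> : sq n.+1 (s + h n.+1, t + k n.+1) =
      quad A P Q f (s + h n.+1) (s + h n) (t + k n.+1) (t + k n).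
    by rewrite /sq /= -!addrA -kS -hS.
  exact: (quad_split df v1 f1 f2 v2 v3 g1 g2 v4).
have : cabs (sq n (s, t)) <= cabs (sq n.+1 (s, t)) + cabs (sq n.+1 (s + h n.+1, t))
   + cabs (sq n.+1 (s, t + k n.+1)) + cabs (sq n.+1 (s + h n.+1, t + k n.+1)).
  rewrite E; apply: le_trans (cabsD _ _) _; rewrite lerD2r.
  by apply: le_trans (cabsD _ _) _; rewrite lerD2r cabsD.
have fin s' t' : s <= s' -> s' + h n.+1 <= s + h n -> t <= t' -> t' + k n.+1 <= t + k n ->
    cabs (sq n (s, t)) <= 4 * cabs (sq n.+1 (s', t')) ->
    exists p', valid n (s, t) ->
    [/\ valid n.+1 p', s <= p'.1 /\ p'.1 + h n.+1 <= s + h n,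
      t <= p'.2 /\ p'.2 + k n.+1 <= t + k n & cabs (sq n (s, t)) <= 4 * cabs (sq n.+1 p')].
  move=> e1 e2 e3 e4 H; exists (s', t') => _; split; [|by split|by split|exact: H].
  split; [exact: le_trans v1 e1|exact: le_trans e2 v2|exact: le_trans v3 e3|].
  exact: le_trans e4 v4.
by case/pick_quarter => H; apply: (fin _ _ _ _ _ _ H).
Qed.

(** Goursat: bisecting a quadrilateral with non-zero integral produces nested
    quadrilaterals whose integrals decay no faster than their areas, against
    the first-order expansion at their common point. *)
Lemma goursat_quad : quad A P Q f S0 S1 0 1 = 0.
Proof.
have [next Hnext] := choice step.
pose fix v n : R * R := if n is n'.+1 then next (n', v n') else (S0, 0).
have v0 : valid 0 (v 0%N) by split => /=; rewrite /h /k ?expr0 ?divr1 /L; lra.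
have vv n : valid n (v n).
  by elim: n => // n IH; have [] := Hnext (n, v n) IH.
have Hv n := Hnext (n, v n) (vv n).
have [s Hs] : exists s, forall n, (v n).1 <= s <= (v n).1 + L / 2 ^+ n.
  apply: nested_itv => [n|n|]; last by rewrite subr_ge0.
    by have [_ []] := Hv n.
  by have [_ []] := Hv n.
have [t Ht] : exists t, forall n, (v n).2 <= t <= (v n).2 + 1 / 2 ^+ n.
  apply: nested_itv => [n|n|//].
    by have [_ _ []] := Hv n.
  by have [_ _ []] := Hv n.
have E0 : quad A P Q f S0 S1 0 1 = sq 0 (v 0%N).
  by rewrite /sq /= /h /k expr0 !divr1 /L add0r addrC subrK.
have hK n : cabs (sq 0 (v 0%N)) <= 4 ^+ n * cabs (sq n (v n)).
  elim: n => [|n IH]; first by rewrite expr0 mul1r.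
  apply: (le_trans IH); rewrite exprSr -mulrA; apply: ler_wpM2l.
    exact: exprn_ge0.
  by have [] := Hv n.
have hs0 : S0 <= s <= S1.
  have /andP[] := Hs 0%N; rewrite /= ?expr0 ?divr1 /L => *; apply/andP; split; lra.
have ht0 : 0 <= t <= 1.
  by have := Ht 0%N; rewrite /= ?expr0 ?divr1 add0r.
pose z0 := cone A P Q s t.
pose M := cabs (P - A) + cabs (Q - P).
have M0 : 0 <= M by rewrite addr_ge0 ?cabs_ge0.
suff H e : 0 < e -> cabs (sq 0 (v 0%N)) <= e * (32 * M ^+ 2 + 1).
  rewrite E0; apply/eqP; rewrite -cabs_eq0 eq_le cabs_ge0 andbT.
  exact: (small_le0 H).
move=> e0.
have [r r0 Hr] := cderivable_expand (df hs0 ht0) e0.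
have [n Hn] : exists n, 2 * M / 2 ^+ n < r.
  have : (fun n => 2 * M * (2^-1) ^+ n) @ \oo --> (0 : R).
    rewrite -[X in _ --> X](mulr0 (2 * M)); apply: cvgM; first exact: cvg_cst.
    by apply: cvg_expr; rewrite ger0_norm; lra.
  move/cvgrPdist_lt => /(_ _ r0)[n _ /(_ n (leqnn n))].
  rewrite sub0r normrN => /(le_lt_trans (ler_norm _)); rewrite exprVn => ?.
  by exists n.
pose D := 2 * M / 2 ^+ n.
pose aff u := f z0 + cderive f z0 * (u - z0).
have pw0 : 0 < (2 : R) ^+ n by rewrite exprn_gt0.
have near_ s' t' : (v n).1 <= s' <= (v n).1 + h n -> (v n).2 <= t' <= (v n).2 + k n ->
    0 <= t' <= 1 /\ cabs (cone A P Q s' t' - z0) <= D.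
  move=> hs ht; have [u1 u2 u3 u4] := vv n.
  have /andP[s1 s2] := Hs n; have /andP[t1 t2] := Ht n.
  move: hs ht => /andP[s3 s4] /andP[t3 t4].
  split; first by rewrite (le_trans u3 t3) (le_trans t4 u4).
  apply: le_trans (cone_dist _ _ _ _ _ _ _) _.
  - by move: hs0 => /andP[k1 k2]; rewrite (le_trans S00 k1) (le_trans k2 S11).
  - by rewrite (le_trans u3 t3) (le_trans t4 u4).
  - rewrite -/M /D mulrAC; apply: ler_wpM2r => //.
    rewrite (_ : 2 / 2 ^+ n = 1 / 2 ^+ n + 1 / 2 ^+ n); last by rewrite -mulrDl.
    have hk : h n <= 1 / 2 ^+ n.
      rewrite /h; apply: ler_wpM2r; first by rewrite invr_ge0 exprn_ge0.
      by have := S00; have := S11; rewrite /L; lra.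
    have dist x y y' (l : R) : x <= y <= x + l -> x <= y' <= x + l -> `|y - y'| <= l.
      by move=> /andP[? ?] /andP[? ?]; rewrite ler_norml; apply/andP; split; lra.
    apply: lerD.
      apply: le_trans hk; apply: (dist (v n).1); first by rewrite s3 s4.
      exact: Hs.
    by apply: (dist (v n).2); [rewrite t3; exact: t4|exact: Ht].
have edge (p q : C) : segcts f p q -> (forall x, 0 <= x <= 1 -> cabs (seg p q x - z0) <= D) ->
   cabs (segint f p q - segint aff p q) <= e * D * (D + D).
  move=> cf hD; have ca : segcts aff p q by move=> x _; exact: affine_continuous.
  rewrite -segintB//.
  have D0 : 0 <= D by apply: (le_trans (cabs_ge0 _) (hD 0 _)); rewrite lexx ler01.
  apply: (le_trans (segint_bound (M := e * D) _ _)).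
  - by move=> x x01; apply: ccontinuousB; [exact: cf|exact: ca].
  - move=> x x01; apply: (le_trans (Hr _ _)); first exact: le_lt_trans (hD _ x01) Hn.
    by apply: ler_wpM2l; [exact: ltW|exact: hD].
  - apply: ler_wpM2l; first by apply: mulr_ge0; [exact: ltW|exact: D0].
    apply: (le_trans (cabsB_le _ _ z0)).
    rewrite (cabsC z0); apply: lerD.
      by rewrite -(seg1 p q); apply: hD; rewrite ler01 lexx.
    by rewrite -(seg0 p q); apply: hD; rewrite ler01 lexx.
have [u1 u2 u3 u4] := vv n.
have hn := h0 n; have kn := k0 n.
set s0 := (v n).1 in near_ u1 u2; set t0 := (v n).2 in near_ u3 u4.
have hn' : s0 <= s0 + h n by rewrite lerDl.
have kn' : t0 <= t0 + k n by rewrite lerDl.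
have mid (x y l : R) : 0 <= l -> 0 <= y <= 1 -> x <= x + y * (x + l - x) <= x + l.
  move=> l0 /andP[y0 y1]; rewrite addrAC subrr add0r lerDl mulr_ge0//= lerD2l.
  exact: ler_piMl.
have V1 tt : t0 <= tt <= t0 + k n ->
    cabs (segint f (cone A P Q s0 tt) (cone A P Q (s0 + h n) tt) -
      segint aff (cone A P Q s0 tt) (cone A P Q (s0 + h n) tt)) <= e * D * (D + D).
  move=> tt01; apply: edge.
    move/andP : tt01 => [b1 b2]; apply: (cone_segcts_s df).
    - by rewrite u1 (le_trans hn' u2).
    - by rewrite u2 (le_trans u1 hn').
    - by rewrite (le_trans u3 b1) (le_trans b2 u4).
  by move=> x x01; rewrite seg_seg; apply: (proj2 (near_ _ _ (mid _ _ _ hn x01) tt01)).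
have V2 ss : s0 <= ss <= s0 + h n ->
    cabs (segint f (cone A P Q ss t0) (cone A P Q ss (t0 + k n)) -
      segint aff (cone A P Q ss t0) (cone A P Q ss (t0 + k n))) <= e * D * (D + D).
  move=> ss01; apply: edge.
    move/andP : ss01 => [b1 b2]; apply: (cone_segcts_t df).
    - by rewrite (le_trans u1 b1) (le_trans b2 u2).
    - by rewrite u3 (le_trans kn' u4).
    - by rewrite u4 (le_trans u3 kn').
  move=> x x01; rewrite (coneE _ _ _ ss t0) (coneE _ _ _ ss (t0 + _)) seg_seg -coneE.
  by apply: (proj2 (near_ _ _ ss01 (mid _ _ _ kn x01))).
have qa : quad A P Q aff s0 (s0 + h n) t0 (t0 + k n) = 0.
  rewrite /quad !segint_affine.
  move: (_ * (cone A P Q s0 t0 - z0) + _) (_ * (cone A P Q s0 (t0 + _) - z0) + _)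
    (_ * (cone A P Q (s0 + _) t0 - z0) + _) (_ * (cone A P Q (s0 + _) (t0 + _) - z0) + _).
  by move=> *; ring.
apply: (le_trans (hK n)); rewrite -(subr0 (sq n (v n))) -qa /sq -/s0 -/t0 /quad.
have s00 : s0 <= s0 <= s0 + h n by rewrite lexx.
have s01 : s0 <= s0 + h n <= s0 + h n by rewrite lexx hn'.
have t00 : t0 <= t0 <= t0 + k n by rewrite lexx.
have t01 : t0 <= t0 + k n <= t0 + k n by rewrite lexx kn'.
have S4 := cabs_sum4 (V2 _ s00) (V1 _ t01) (V2 _ s01) (V1 _ t00).
apply: (le_trans (ler_wpM2l _ S4)); first by rewrite exprn_ge0.
have -> : 4 ^+ n * (4 * (e * D * (D + D))) = e * (32 * M ^+ 2).
  rewrite /D (_ : (4 : R) = 2 * 2); last by ring.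
  rewrite exprMn; field; by rewrite gt_eqF.
by rewrite ler_wpM2l ?(ltW e0)// lerDl.
Qed.

End Nested.
End Goursat2.

(** * Cauchy's theorem in the disc *)

Section Primitive.
Variable R : realType.
Local Notation C := R[i].
Implicit Types (f g F : C -> C) (z w u p q A : C).

Lemma discE z : disc z = (cabs z < 1) :> Prop. Proof. by []. Qed.

Lemma seg_disc p q s : disc p -> disc q -> 0 <= s <= 1 -> disc (seg p q s).
Proof.
rewrite !discE => hp hq /andP[s0 s1].
have -> : seg p q s = (1 - s)%:C%C * p + s%:C%C * q.
  by rewrite /seg rmorphB /= rmorph1; ring.
apply: (le_lt_trans (cabsD _ _)); rewrite !cabsM !cabs_real !ger0_norm//; last lra.
have := cabs_ge0 p; have := cabs_ge0 q.
move=> _ _; have := le_max (cabs p) (cabs p) (cabs q); rewrite lexx /= => hpm.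
have := le_max (cabs q) (cabs p) (cabs q); rewrite lexx orbT => hqm.
have : Num.max (cabs p) (cabs q) < 1 by rewrite gt_max hp hq.
by apply: le_lt_trans; move: hpm hqm; move: (Num.max _ _) => m ? ?; nra.
Qed.

Lemma disc_open z : disc z -> \forall u \near (z : C^o), disc u.
Proof.
move=> hz; apply/cnbhsP; exists (1 - cabs z); first by rewrite subr_gt0.
move=> u uz; rewrite discE; have := cabsD (u - z) z; rewrite subrK; lra.
Qed.

Lemma small_le0_near (e0 K B : R) : 0 < e0 -> 0 <= B ->
  (forall e, 0 < e -> e < e0 -> K <= e * B) -> K <= 0.
Proof.
move=> e00 B0 H; apply: (@small_le0 _ K B) => e ep.
have [ee0|e0e] := ltP e e0; first exact: H.
apply: (le_trans (H (e0 / 2) _ _)); [by rewrite divr_gt0|lra|].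
by apply: ler_wpM2r => //; lra.
Qed.

Section Star.
Variables (f : C -> C) (A : C).
Hypotheses (dA : disc A) (cf : forall z, disc z -> ccontinuous f z).
Hypothesis df : forall z, disc z -> z != A -> cderivable f z.

Let disc_segcts p q : disc p -> disc q -> segcts f p q.
Proof. by move=> hp hq s s01; apply: cf; exact: seg_disc. Qed.

Let disc2 p q : disc p -> disc q -> cabs (q - p) <= 2.
Proof.
rewrite !discE => hp hq; have := cabsD q (- p); rewrite cabsN.
by move=> /le_trans; apply; lra.
Qed.

Lemma segint_small p q (M : R) : disc p -> disc q ->
  (forall s, 0 <= s <= 1 -> cabs (f (seg p q s)) <= M) ->
  cabs (segint f p q) <= M * cabs (q - p).
Proof. by move=> hp hq; apply: segint_bound; exact: disc_segcts. Qed.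

(** The triangle with vertices A, z, u is split near A: the quadrilateral that
    remains has integral 0 by Goursat, and the small triangle at A is negligible
    because f is bounded near A. Hence f may fail to be differentiable at A. *)
Lemma star_increment z u : disc z -> disc u -> cabs (u - z) < cabs (z - A) ->
  segint f A u - segint f A z = segint f z u.
Proof.
move=> hz hu huz; apply/eqP; rewrite -subr_eq0 -cabs_eq0 eq_le cabs_ge0 andbT.
have /ccontinuousP/(_ 1 ltr01)[r r0 Hr] := cf dA.
pose M := cabs (f A) + 1.
have M0 : 0 <= M by rewrite addr_ge0 ?cabs_ge0.
have hM v : cabs (v - A) < r -> cabs (f v) <= M.
  move=> /Hr hv; rewrite /M; have := cabsD (f v - f A) (f A).
  by rewrite subrK => /le_trans; apply; lra.
pose e0 := Num.min 1 (r / 2).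
have e00 : 0 < e0 by rewrite lt_min ltr01 divr_gt0.
apply: (@small_le0_near e0 _ (6 * M)) => //; first by rewrite mulr_ge0.
move=> e ep; rewrite lt_min => /andP[e1 er].
have e01 : 0 <= e <= 1 by rewrite !ltW.
have hcone s t : e <= s <= 1 -> 0 <= t <= 1 -> cderivable f (cone A z u s t).
  move=> /andP[h1 h2] t01.
  have hd : disc (seg z u t) by exact: seg_disc.
  apply: df; first by apply: seg_disc => //; rewrite (le_trans (ltW ep) h1) h2.
  rewrite -subr_eq0 /cone {1}/seg addrAC subrr add0r -cabs_eq0 cabsM cabs_real.
  rewrite mulf_eq0 negb_or normr_eq0 gt_eqF ?(lt_le_trans ep h1)//=.
  rewrite gt_eqF//; have := cabsB_ge (z - A) (z - seg z u t).
  rewrite (_ : z - A - _ = seg z u t - A); last by ring.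
  have -> : z - seg z u t = - (t%:C%C * (u - z)) by rewrite /seg; ring.
  rewrite cabsN cabsM cabs_real; move/andP : t01 => [t0 t1].
  rewrite ger0_norm//; have := cabs_ge0 (u - z).
  move: (cabs (u - z)) (cabs (z - A)) (cabs _) huz => a b c *; nra.
have := goursat_quad (ltW ep) (ltW e1) (lexx 1) hcone.
rewrite /quad /cone seg0 seg1 !seg1 => G.
have catA v : disc v -> segint f A v = segint f A (seg A v e) + segint f (seg A v e) v.
  move=> hv; have /= := @segint_cat _ f A v 0 e 1 (disc_segcts dA hv).
  by rewrite seg0 seg1; apply => //; rewrite lexx ler01.
have hs v : disc v -> disc (seg A v e) by move=> hv; exact: seg_disc.
have hd v s : disc v -> 0 <= s <= e -> cabs (seg A v s - A) < r.
  move=> hv /andP[s0 se]; rewrite /seg addrAC subrr add0r cabsM cabs_real ger0_norm//.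
  have := disc2 dA hv; have := cabs_ge0 (v - A).
  move: (cabs _) er ep => a *; nra.
have b1 v : disc v -> cabs (segint f A (seg A v e)) <= M * (2 * e).
  move=> hv; apply: le_trans (segint_small dA (hs _ hv) (M := M) _) _.
    move=> s /andP[s0 s1]; apply: hM.
    have -> : seg A (seg A v e) s = seg A v (s * e) by rewrite /seg rmorphM /=; ring.
    apply: hd => //; rewrite mulr_ge0 ?(ltW ep)//=; exact/ler_piMl/s1/ltW.
  apply: ler_wpM2l => //; rewrite /seg addrAC subrr add0r cabsM cabs_real gtr0_norm// mulrC.
  by apply: ler_wpM2r; [exact: ltW|exact: disc2].
have b2 : cabs (segint f (seg A z e) (seg A u e)) <= M * (2 * e).
  apply: le_trans (segint_small (hs _ hz) (hs _ hu) (M := M) _) _.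
    move=> s s01; apply: hM.
    have -> : seg (seg A z e) (seg A u e) s = seg A (seg z u s) e by rewrite /seg; ring.
    by apply: hd; [exact: seg_disc|rewrite ltW//= lexx].
  apply: ler_wpM2l => //.
  have -> : seg A u e - seg A z e = e%:C%C * (u - z) by rewrite /seg; ring.
  rewrite cabsM cabs_real gtr0_norm// mulrC.
  by apply: ler_wpM2r; [exact: ltW|exact: disc2].
rewrite (catA z hz) (catA u hu).
move: G b2 (b1 _ hz) (b1 _ hu).
move: (segint f (seg A z e) (seg A u e)) (segint f (seg A u e) u) (segint f z u)
  (segint f (seg A z e) z) (segint f A (seg A z e)) (segint f A (seg A u e)).
move=> a b c d x y G ha hx hy.
have -> : y + b - (x + d) - c = y + - x + - a by rewrite -[RHS]addr0 -G; ring.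
have c1 := cabsD (y + - x) (- a); have c2 := cabsD y (- x).
rewrite !cabsN in c1 c2.
have -> : e * (6 * M) = M * (2 * e) + M * (2 * e) + M * (2 * e) by ring.
lra.
Qed.

(** The exceptional point A makes the result apply to difference quotients, whose
    differentiability at their centre is not known yet. *)
Lemma star_primitive : exists F : C -> C, forall z, disc z ->
  cderivable F z /\ cderive F z = f z.
Proof.
exists (segint f A) => z hz.
pose g u := cint 0 1 (fun s => f (seg z u s)).
have gz : g z = f z.
  rewrite /g (@eq_cint _ _ _ _ (fun=> f z)); last by move=> t _; rewrite /seg subrr mulr0 addr0.
  by rewrite cint_cst// subr0 mulr1.
rewrite -gz; apply: dquo_derivable.
  apply/ccontinuousP => e e0; rewrite gz.
  have e20 : 0 < e / 2 by rewrite divr_gt0.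
  have /ccontinuousP/(_ _ e20)[r r0 Hr] := cf hz.
  have /cnbhsP[r' r'0 Hr'] := disc_open hz.
  exists (Num.min r r'); first by rewrite lt_min r0.
  move=> u; rewrite lt_min => /andP[ur ur'].
  have hu := Hr' _ ur'.
  have cg : ccts 0 1 (fun s => f (seg z u s)) by apply: segcts_ccts; exact: disc_segcts.
  have -> : g u - f z = cint 0 1 (fun s => f (seg z u s) - f z).
    rewrite (cintB cg (@ccts_cst _ 0 1 (f z))).
    by rewrite (cint_cst _ ler01) subr0 mulr1.
  apply: (@le_lt_trans _ _ (e / 2)); last lra.
  rewrite -[X in _ <= X]mulr1 -[X in _ * X](subr0 1).
  apply: (cabs_cint_bound ler01 (cctsB cg (@ccts_cst _ 0 1 (f z)))).
  move=> s /andP[s0 s1]; apply/ltW/Hr.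
  rewrite /seg addrAC subrr add0r cabsM cabs_real ger0_norm//.
  by apply: le_lt_trans ur; apply: ler_piMl; [exact: cabs_ge0|].
have [zA|zA] := eqVneq z A.
  rewrite zA; have := disc_open dA; apply: filterS => u hu.
  by rewrite {2}/segint subrr mul0r add0r /segint mulrC -/(g u) /g zA.
have za0 : 0 < cabs (z - A) by rewrite cabs_gt0 subr_eq0.
have /cnbhsP[r' r'0 Hr'] := disc_open hz.
apply/cnbhsP; exists (Num.min (cabs (z - A)) r'); first by rewrite lt_min za0.
move=> u; rewrite lt_min => /andP[ur /Hr' hu].
apply/eqP; rewrite addrC -subr_eq star_increment// /segint mulrC; exact/eqP.
Qed.

End Star.
End Primitive.

Section Cauchy.
Variable R : realType.
Local Notation C := R[i].
Implicit Types (f g F : C -> C) (z w u : C) (r t : R).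

Definition expi t : C := Complex (cos t) (sin t).
Definition circ r t : C := r%:C%C * expi t.

Lemma cabs_expi t : cabs (expi t) = 1.
Proof. by rewrite cabsE /= cos2Dsin2 sqrtr1. Qed.

Lemma cabs_circ r t : 0 <= r -> cabs (circ r t) = r.
Proof. by move=> r0; rewrite /circ cabsM cabs_expi mulr1 cabs_real ger0_norm. Qed.

Lemma circ_disc r t : 0 <= r -> r < 1 -> disc (circ r t).
Proof. by move=> r0 r1; rewrite discE cabs_circ. Qed.

Lemma circ_2pi r : circ r (2 * pi) = circ r 0.
Proof.
by rewrite /circ /expi mulr_natl cos2pi sin2pi cos0 sin0.
Qed.

Lemma circ_path_derive r t : path_derive (circ r) t ('i%C * circ r t).
Proof.
split.
  rewrite (_ : (fun s => _) = (fun s => r * cos s)); last first.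
    by apply/funext => s /=; rewrite mul0r subr0.
  rewrite (_ : complex.Re _ = r *: (- sin t)); last by rewrite /= /GRing.scale /=; ring.
  exact: is_deriveZ.
rewrite (_ : (fun s => _) = (fun s => r * sin s)); last first.
  by apply/funext => s /=; rewrite mul0r addr0.
rewrite (_ : complex.Im _ = r *: (cos t)); last by rewrite /= /GRing.scale /=; ring.
exact: is_deriveZ.
Qed.

Lemma circ_continuous r : continuous (circ r : R -> C^o).
Proof. by move=> t; apply: path_derive_continuous (circ_path_derive r t). Qed.

Lemma pi2_ge0 : 0 <= 2 * pi :> R.
Proof. by rewrite mulr_ge0// pi_ge0. Qed.

Lemma pi2_gt0 : 0 < 2 * pi :> R.
Proof. by rewrite mulr_gt0// pi_gt0. Qed.

Definition cavg (h : R -> C) : C := ((2 * pi)^-1)%:C%C * cint 0 (2 * pi) h.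

Lemma ccts_circ f r : 0 <= r -> r < 1 -> (forall z, disc z -> ccontinuous f z) ->
  ccts 0 (2 * pi) (fun t => f (circ r t)).
Proof.
move=> r0 r1 cf t _.
apply: (@continuous_comp _ _ _ (circ r : R -> C^o) (f : C^o -> C^o) t).
  exact: circ_continuous.
by apply: cf; exact: circ_disc.
Qed.

Lemma analytic_cts f : analytic_on disc f -> forall z, disc z -> ccontinuous f z.
Proof. by move=> df z hz; apply: cderivable_continuous; exact: df. Qed.

Lemma dquo_derivable_off f z0 z : disc z0 -> analytic_on disc f -> disc z -> z != z0 ->
  cderivable (dquo f z0) z.
Proof.
move=> h0 df hz zz0.
suff : derivable (fun u : C^o => (f u - f z0) / (u - z0) : C^o) z 1.
  apply: near_eq_derivable.
  have : 0 < cabs (z - z0) by rewrite cabs_gt0 subr_eq0.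
  move=> zp; apply/cnbhsP; exists (cabs (z - z0)) => // u uz.
  rewrite dquo_neq//; apply: contraTneq uz => ->; rewrite -leNgt cabsC.
  exact: lexx.
apply: derivableM.
  by apply: derivableB; [exact: df|exact: derivable_cst].
apply: derivableV; first by rewrite subr_eq0.
by apply: derivableB; [exact: derivable_id|exact: derivable_cst].
Qed.

Lemma dquo_cts f z0 z : disc z0 -> analytic_on disc f -> disc z ->
  ccontinuous (dquo f z0) z.
Proof.
move=> h0 df hz; have [->|zz0] := eqVneq z z0; first by apply: dquo_continuous; exact: df.
by apply: cderivable_continuous; exact: dquo_derivable_off.
Qed.

(** The integrand is the derivative of F (circ r t), up to a factor, for a
    primitive F of g. *)
Lemma circle_int0 g A r : disc A -> (forall z, disc z -> ccontinuous g z) ->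
  (forall z, disc z -> z != A -> cderivable g z) -> 0 <= r -> r < 1 ->
  cint 0 (2 * pi) (fun t => g (circ r t) * circ r t) = 0.
Proof.
move=> dA cg dg r0 r1; have [F HF] := star_primitive dA cg dg.
have cgc : ccts 0 (2 * pi) (fun t => g (circ r t) * circ r t).
  apply: cctsM; first exact: (ccts_circ r0 r1 cg).
  by move=> t _; exact: circ_continuous.
have cgi : ccts 0 (2 * pi) (fun t => 'i%C * (g (circ r t) * circ r t)).
  by apply: cctsM cgc; exact: ccts_cst.
have := cint_FTC (F := fun t => F (circ r t)) pi2_ge0 cgi.
rewrite circ_2pi subrr (cintZ _ cgc) => H.
suff /eqP : 'i%C * cint 0 (2 * pi) (fun t => g (circ r t) * circ r t) = 0.
  by rewrite mulf_eq0 => /orP[|/eqP//]; rewrite eq_complex /= oner_eq0 andbF.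
apply: H => t _; have [d1 d2] := HF (circ r t) (circ_disc t r0 r1).
rewrite mulrCA -d2.
apply: path_derive_comp; first exact: d1.
exact: circ_path_derive.
Qed.

Lemma cauchy_dquo f z0 r : disc z0 -> analytic_on disc f -> 0 <= r -> r < 1 ->
  cint 0 (2 * pi) (fun t => dquo f z0 (circ r t) * circ r t) = 0.
Proof.
move=> h0 df r0 r1; apply: (circle_int0 h0 _ _ r0 r1) => z hz; first exact: dquo_cts.
by move=> zz0; exact: dquo_derivable_off.
Qed.

Lemma disc0 : disc (0 : C).
Proof. by rewrite discE cabs0. Qed.

(** The difference quotient of f at 0 has integral 0 against circ r t. *)
Lemma cavg_mean f r : analytic_on disc f -> 0 <= r -> r < 1 ->
  cavg (fun t => f (circ r t)) = f 0.
Proof.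
move=> df r0 r1; have := cauchy_dquo disc0 df r0 r1.
rewrite (@eq_cint _ _ _ _ (fun t => f (circ r t) - f 0)); last first.
  by move=> t _; rewrite (dquoE f 0 (circ r t)) subr0 addrAC subrr add0r.
have cc : ccts 0 (2 * pi) (fun t => f (circ r t)) by apply: (ccts_circ r0 r1); exact: analytic_cts.
rewrite (cintB cc (@ccts_cst _ 0 (2 * pi) (f 0))) (cint_cst _ pi2_ge0) subr0.
move/eqP; rewrite subr_eq0 /cavg => /eqP ->.
by rewrite mulrCA -rmorphM /= mulVf ?mulr1// gt_eqF// pi2_gt0.
Qed.

End Cauchy.

(** * Cauchy's integral formula *)

Section CauchyFormula.
Variable R : realType.
Local Notation C := R[i].
Implicit Types (f g F : C -> C) (z w u : C) (r t : R).

Lemma analytic_cst D (k : C) : analytic_on D (fun=> k).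
Proof. by move=> z _; exact: derivable_cst. Qed.
Lemma analytic_id D : analytic_on D (fun z : C => z).
Proof. by move=> z _; exact: derivable_id. Qed.
Lemma analyticD D f g : analytic_on D f -> analytic_on D g -> analytic_on D (fun z => f z + g z).
Proof. by move=> hf hg z Dz; apply: derivableD; [exact: hf|exact: hg]. Qed.
Lemma analyticB D f g : analytic_on D f -> analytic_on D g -> analytic_on D (fun z => f z - g z).
Proof. by move=> hf hg z Dz; apply: derivableB; [exact: hf|exact: hg]. Qed.
Lemma analyticM D f g : analytic_on D f -> analytic_on D g -> analytic_on D (fun z => f z * g z).
Proof. by move=> hf hg z Dz; apply: derivableM; [exact: hf|exact: hg]. Qed.
Lemma analyticV D f : analytic_on D f -> (forall z, D z -> f z != 0) ->
  analytic_on D (fun z => (f z)^-1).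
Proof. by move=> hf h0 z Dz; apply: derivableV; [exact: h0|exact: hf]. Qed.
Lemma analyticX D f n : analytic_on D f -> analytic_on D (fun z => f z ^+ n).
Proof.
move=> hf; elim: n => [|n IH].
  by rewrite (_ : (fun _ => _) = (fun=> 1)); [exact: analytic_cst|apply/funext => z; rewrite expr0].
rewrite (_ : (fun _ => _) = (fun z => f z * f z ^+ n)).
  exact: analyticM.
by apply/funext => z; rewrite exprS.
Qed.
Lemma analytic_comp D f g : analytic_on disc f -> analytic_on D g ->
  (forall z, D z -> disc (g z)) -> analytic_on D (fun z => f (g z)).
Proof.
move=> hf hg h z Dz; apply/derivable1_diffP.
apply: (@differentiable_comp _ _ _ _ (g : C^o -> C^o) (f : C^o -> C^o)).
  exact/derivable1_diffP/hg.
by apply/derivable1_diffP/hf; exact: h.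
Qed.

Lemma cint_conj (h : R -> C) (a b : R) : ccts a b h ->
  cint a b (fun t => conjc (h t)) = conjc (cint a b h).
Proof.
move=> ch; apply: complex_eqP => /=.
  by apply: eq_rint => t _; case: (h t).
rewrite -mulN1r -rintZ; last exact: ccts_Im.
by apply: eq_rint => t _; case: (h t) => x y /=; rewrite mulN1r.
Qed.

Lemma circ_neq z r t : 0 <= r -> cabs z < r -> circ r t - z != 0.
Proof. by move=> r0 zr; rewrite subr_eq0; apply: contraTneq zr => <-; rewrite cabs_circ// ltxx. Qed.

Lemma circ_dist z r t : 0 <= r -> r - cabs z <= cabs (circ r t - z).
Proof. by move=> r0; have := cabsB_ge (circ r t) z; rewrite cabs_circ. Qed.

Lemma ccts_div (h k : R -> C) (a b : R) : ccts a b h -> ccts a b k ->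
  (forall t, a <= t <= b -> k t != 0) -> ccts a b (fun t => h t / k t).
Proof.
move=> ch ck k0; apply: cctsM; first exact: ch.
move=> t tab; have kt0 : k t != 0 by apply: k0; move: tab; rewrite in_itv.
exact: (@continuousV _ _ (k : R -> C^o) t kt0 (ck t tab)).
Qed.

Lemma ccts_circB r z (a b : R) : ccts a b (fun t => circ r t - z).
Proof.
by apply: cctsB; [move=> t _; exact: circ_continuous|exact: ccts_cst].
Qed.

(** On the circle the conjugate of the kernel is 1 / (1 - conjc z / r^2 circ r t),
    an analytic function of circ r t to which the mean value property applies. *)
Lemma cavg_kernel z r : 0 < r -> r < 1 -> cabs z < r ->
  cint 0 (2 * pi) (fun t => circ r t / (circ r t - z)) = (2 * pi)%:C%C.
Proof.
move=> r0 r1 zr.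
pose x := cabs z / r.
have x1 : x < 1 by rewrite /x ltr_pdivrMr// mul1r.
have x0 : 0 <= x by rewrite divr_ge0 ?cabs_ge0// ltW.
pose p := (1 + x) / 2.
have xp : x < p by rewrite /p; lra.
have p1 : p < 1 by rewrite /p; lra.
have p0 : 0 < p by rewrite /p; lra.
pose y : C := conjc z / (r * p)%:C%C.
have y1 : cabs y < 1.
  have rp0 : 0 < r * p by exact: mulr_gt0.
  rewrite /y cabsM cabsV cabs_conj cabs_real gtr0_norm// ltr_pdivrMr// mul1r mulrC.
  by move: xp; rewrite {1}/x ltr_pdivrMr.
have nz u : disc u -> 1 - y * u != 0.
  rewrite discE => u1; rewrite subr_eq0; apply/eqP => /(congr1 (fun z => cabs z)).
  rewrite cabs1 cabsM => e; have := cabs_ge0 y; have := cabs_ge0 u.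
  move: e y1 u1; move: (cabs _) (cabs _) => a b e *; nra.
pose k (u : C) := (1 - y * u)^-1.
have ak : analytic_on disc k.
  apply: analyticV nz; apply: analyticB; first exact: analytic_cst.
  by apply: analyticM; [exact: analytic_cst|exact: analytic_id].
have := cavg_mean ak (ltW p0) p1; rewrite /cavg {2}/k mulr0 subr0 invr1.
have pi0 : (2 * pi : R)%:C%C != 0 :> C.
  by rewrite eq_complex /= negb_and gt_eqF// pi2_gt0.
rewrite fmorphV => /(congr1 (fun w => (2 * pi)%:C%C * w)).
rewrite mulVKf// mulr1 => E.
have ck : ccts 0 (2 * pi) (fun t => k (circ p t)).
  by apply: (ccts_circ (ltW p0) p1) => z' hz'; apply: cderivable_continuous; exact: ak.
rewrite -[RHS]conjc_real -E -(cint_conj ck); apply: eq_cint => t _.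
rewrite /k conjc_inv rmorphB rmorph1 rmorphM /=.
have cn : circ r t != 0 by rewrite -cabs_eq0 cabs_circ ?ltW// gt_eqF.
have cz : circ r t - z != 0 by apply: circ_neq => //; exact: ltW.
have ee : expi t * conjc (expi t) = 1 by rewrite mul_conjc cabs_expi expr1n.
have rC : r%:C%C != 0 :> C by rewrite eq_complex /= negb_and gt_eqF.
have pC : p%:C%C != 0 :> C by rewrite eq_complex /= negb_and gt_eqF.
have -> : conjc y * conjc (circ p t) = z / circ r t.
  have en : expi t != 0 by rewrite -cabs_eq0 cabs_expi oner_eq0.
  have ce : conjc (expi t) = (expi t)^-1 by apply: (mulfI en); rewrite ee mulfV.
  have cM (a b : C) : conjc (a * b) = conjc a * conjc b by exact: rmorphM.
  rewrite /y /circ !cM conjcK conjc_inv !conjc_real ce rmorphM /=.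
  by field; rewrite rC pC en.
by field; rewrite cn cz.
Qed.

(** The difference quotient of f at z has integral 0 against circ r t, and what is
    left is f z times the kernel. *)
Lemma cauchy_formula f z r : analytic_on disc f -> r < 1 -> cabs z < r ->
  f z = cavg (fun t => f (circ r t) * circ r t / (circ r t - z)).
Proof.
move=> df r1 zr; have r0 : 0 < r by exact: le_lt_trans (cabs_ge0 z) zr.
have hz : disc z by rewrite discE (lt_trans zr).
have cf : ccts 0 (2 * pi) (fun t => f (circ r t)).
  by apply: (ccts_circ (ltW r0) r1); exact: analytic_cts.
have cc : ccts 0 (2 * pi) (circ r) by move=> t _; exact: circ_continuous.
have cd := @ccts_circB r z 0 (2 * pi).
have nz t : 0 <= t <= 2 * pi -> circ r t - z != 0 by move=> _; apply: circ_neq => //; exact: ltW.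
have := cauchy_dquo hz df (ltW r0) r1.
rewrite (@eq_cint _ _ _ _ (fun t => f (circ r t) * circ r t / (circ r t - z) -
  f z * (circ r t / (circ r t - z)))); last first.
  move=> t ht; rewrite dquo_neq; last by rewrite -subr_eq0 nz.
  have alg (x y c k : C) : (x - y) / k * c = x * c / k - y * (c / k) by ring.
  exact: alg.
have c1 := ccts_div (cctsM cf cc) cd nz.
have c2 := ccts_div cc cd nz.
rewrite (cintB c1 (cctsM (@ccts_cst _ 0 (2 * pi) (f z)) c2)) (cintZ _ c2).
rewrite (cavg_kernel r0 r1 zr) => /eqP; rewrite subr_eq0 /cavg => /eqP ->.
by rewrite mulrCA -rmorphM /= mulVf ?mulr1// gt_eqF// pi2_gt0.
Qed.

Lemma cauchy_type_continuous (W : R -> C) z r : ccts 0 (2 * pi) W -> cabs z < r ->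
  ccontinuous (fun u => cavg (fun t => W t / (circ r t - u))) z.
Proof.
move=> cW zr; have r0 : 0 < r by exact: le_lt_trans (cabs_ge0 z) zr.
pose d := r - cabs z; have d0 : 0 < d by rewrite subr_gt0.
pose J := rint 0 (2 * pi) (fun t => cabs (W t)).
have J0 : 0 <= J by apply: Rintegral_ge0 => t _; exact: cabs_ge0.
pose K := J * (2 / d ^+ 2).
have K0 : 0 <= K by rewrite mulr_ge0// divr_ge0// sqr_ge0.
apply/ccontinuousP => e e0.
have p20 := pi2_gt0 R.
have q0 : 0 < (2 * pi)^-1 * K + 1 by rewrite ltr_wpDl// mulr_ge0// invr_ge0 ltW.
exists (Num.min (d / 2) (e / ((2 * pi)^-1 * K + 1))).
  by rewrite lt_min !divr_gt0.
move=> u; rewrite lt_min => /andP[ud ue].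
have du t : d / 2 <= cabs (circ r t - u).
  have := circ_dist u t (ltW r0); have := cabsD (u - z) z; rewrite subrK -/d.
  by move: ud; rewrite /d; lra.
have dz t : d <= cabs (circ r t - z) by exact: (circ_dist z t (ltW r0)).
have nu t : 0 <= t <= 2 * pi -> circ r t - u != 0.
  by move=> _; rewrite -cabs_gt0; apply: lt_le_trans (du t); rewrite divr_gt0.
have nz t : 0 <= t <= 2 * pi -> circ r t - z != 0.
  by move=> _; rewrite -cabs_gt0; exact: lt_le_trans (dz t).
have c1 := ccts_div cW (@ccts_circB r u 0 (2 * pi)) nu.
have c2 := ccts_div cW (@ccts_circB r z 0 (2 * pi)) nz.
rewrite /cavg -mulrBr -(cintB c1 c2) cabsM cabs_real gtr0_norm ?invr_gt0//.
have cW' := ccts_cabs cW.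
have b : cabs (cint 0 (2 * pi) (fun t => W t / (circ r t - u) - W t / (circ r t - z)))
    <= K * cabs (u - z).
  apply: (le_trans (cabs_cint_le (cctsB c1 c2))).
  have -> : K * cabs (u - z) = rint 0 (2 * pi) (fun t => (2 / d ^+ 2 * cabs (u - z)) * cabs (W t)).
    by rewrite rintZ// /K /J; ring.
  apply: rint_le.
  - exact: ccts_cabs (cctsB c1 c2).
  - by move=> t tt; apply: cvgM; [exact: cvg_cst|exact: (cW' t tt)].
  - move=> t tt; have nut := nu t tt; have nzt := nz t tt.
    have -> : W t / (circ r t - u) - W t / (circ r t - z) =
        W t * (u - z) / ((circ r t - u) * (circ r t - z)).
      by field; rewrite nut nzt.
    rewrite !cabsM cabsV cabsM.
    rewrite [leRHS](_ : _ = cabs (W t) * cabs (u - z) * (2 / d ^+ 2)); last by ring.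
    apply: ler_wpM2l; first by rewrite mulr_ge0// cabs_ge0.
    rewrite (_ : 2 / d ^+ 2 = ((d / 2) * d)^-1); last by field; rewrite gt_eqF.
    rewrite lef_pV2 ?posrE ?mulr_gt0// ?cabs_gt0// ?divr_gt0//.
    by apply: ler_pM => //; [rewrite divr_ge0// ltW|exact: ltW].
apply: (@le_lt_trans _ _ (((2 * pi)^-1 * K + 1) * cabs (u - z))).
  rewrite [leRHS](_ : _ = (2 * pi)^-1 * (K * cabs (u - z)) + cabs (u - z)); last by ring.
  apply: ler_wpDr; first exact: cabs_ge0.
  by apply: ler_wpM2l b; rewrite invr_ge0 ltW.
by rewrite mulrC -ltr_pdivlMr.
Qed.

(** Away from z0 this is the quotient rule. At z0, Cauchy's formula represents the
    difference quotient as an integral of Cauchy type, which has a difference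
    quotient of the same type. *)
Lemma dquo_analytic f z0 : disc z0 -> analytic_on disc f -> analytic_on disc (dquo f z0).
Proof.
move=> h0 df z hz; have [->|zz0] := eqVneq z z0; last exact: dquo_derivable_off.
pose r := (1 + cabs z0) / 2.
have z0r : cabs z0 < r by move: h0; rewrite /r discE; lra.
have r1 : r < 1 by move: h0; rewrite /r discE; lra.
have r0 : 0 < r by exact: le_lt_trans (cabs_ge0 _) z0r.
have cf : ccts 0 (2 * pi) (fun t => f (circ r t)).
  by apply: (ccts_circ (ltW r0) r1); exact: analytic_cts.
have cc : ccts 0 (2 * pi) (circ r) by move=> t _; exact: circ_continuous.
have nz u t : cabs u < r -> circ r t - u != 0 by move=> ur; apply: circ_neq => //; exact: ltW.
have cW1 : ccts 0 (2 * pi) (fun t => f (circ r t) * circ r t / (circ r t - z0)).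
  exact: (ccts_div (cctsM cf cc) (@ccts_circB r z0 0 (2 * pi)) (fun t _ => nz z0 t z0r)).
have cW2 : ccts 0 (2 * pi) (fun t => f (circ r t) * circ r t / (circ r t - z0) / (circ r t - z0)).
  exact: (ccts_div cW1 (@ccts_circB r z0 0 (2 * pi)) (fun t _ => nz z0 t z0r)).
pose g1 u := cavg (fun t => f (circ r t) * circ r t / (circ r t - z0) / (circ r t - u)).
pose g2 u := cavg (fun t => f (circ r t) * circ r t / (circ r t - z0) / (circ r t - z0) / (circ r t - u)).
have near_r : \forall u \near (z0 : C^o), cabs u < r.
  apply/cnbhsP; exists (r - cabs z0); first by rewrite subr_gt0.
  by move=> u; have := cabsD (u - z0) z0; rewrite subrK; lra.
have step (W : R -> C) u : ccts 0 (2 * pi) W -> cabs u < r ->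
   cavg (fun t => W t / (circ r t - u)) = cavg (fun t => W t / (circ r t - z0)) +
   cavg (fun t => W t / (circ r t - z0) / (circ r t - u)) * (u - z0).
  move=> cW ur.
  have d1 := ccts_div cW (@ccts_circB r z0 0 (2 * pi)) (fun t _ => nz z0 t z0r).
  have d2 := ccts_div d1 (@ccts_circB r u 0 (2 * pi)) (fun t _ => nz u t ur).
  rewrite /cavg -mulrA (mulrC (cint _ _ _) (u - z0)) -(cintZ _ d2) -mulrDr.
  rewrite -(cintD d1 (cctsM (@ccts_cst _ 0 (2 * pi) (u - z0)) d2)).
  congr (_ * _); apply: eq_cint => t _.
  by field; rewrite (nz _ _ z0r) (nz _ _ ur).
have fE u : cabs u < r -> f u = f z0 + g1 u * (u - z0).
  move=> ur; rewrite (cauchy_formula df r1 ur) (cauchy_formula df r1 z0r).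
  by rewrite (step (fun t => f (circ r t) * circ r t) u (cctsM cf cc) ur).
have [_ df0] : cderivable f z0 /\ cderive f z0 = g1 z0.
  apply: dquo_derivable; first exact: (cauchy_type_continuous cW1 z0r).
  by apply: filterS near_r => u /fE.
have dE u : cabs u < r -> dquo f z0 u = g1 u.
  move=> ur; rewrite /dquo; case: eqVneq => [->//|uz].
  by rewrite (fE u ur) addrAC subrr add0r mulfK// subr_eq0.
have [] // := @dquo_derivable _ (dquo f z0) g2 z0 (cauchy_type_continuous cW2 z0r).
apply: filterS near_r => u ur; rewrite dE// dE//.
exact: (step (fun t => f (circ r t) * circ r t / (circ r t - z0)) u cW1 ur).
Qed.

End CauchyFormula.

(** * The maximum principle and mean values *)

Section MaximumModulus.
Variable R : realType.
Local Notation C := R[i].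
Implicit Types (f g h F : C -> C) (z w u : C) (r t : R).

Definition ravg (p : R -> R) : R := (2 * pi)^-1 * rint 0 (2 * pi) p.
Definition rcts (p : R -> R) := {in `[0, 2 * pi], continuous p}.

Lemma rctsD p q : rcts p -> rcts q -> rcts (fun t => p t + q t).
Proof. by move=> cp cq t tt; apply: cvgD; [exact: (cp t tt)|exact: (cq t tt)]. Qed.
Lemma rcts_cst k : rcts (fun=> k).
Proof. by move=> t tt; exact: cvg_cst. Qed.
Lemma rctsM p q : rcts p -> rcts q -> rcts (fun t => p t * q t).
Proof. by move=> cp cq t tt; apply: cvgM; [exact: (cp t tt)|exact: (cq t tt)]. Qed.

Lemma ravgD p q : rcts p -> rcts q -> ravg (fun t => p t + q t) = ravg p + ravg q.
Proof. by move=> cp cq; rewrite /ravg (rintD cp cq) mulrDr. Qed.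

Lemma ravgZ k p : rcts p -> ravg (fun t => k * p t) = k * ravg p.
Proof. by move=> cp; rewrite /ravg (rintZ _ cp) mulrCA. Qed.

Lemma ravg_cst k : ravg (fun=> k) = k.
Proof.
by rewrite /ravg (rint_cst _ (pi2_ge0 R)) subr0 mulrCA mulVf ?mulr1// gt_eqF// pi2_gt0.
Qed.

Lemma ravg_le p q : rcts p -> rcts q -> (forall t, p t <= q t) -> ravg p <= ravg q.
Proof.
move=> cp cq pq; apply: ler_wpM2l; first by rewrite invr_ge0 pi2_ge0.
by apply: (rint_le cp cq) => t _.
Qed.

Lemma eq_ravg p q : (forall t, p t = q t) -> ravg p = ravg q.
Proof. by move=> pq; rewrite /ravg; congr (_ * _); apply: eq_rint => t _. Qed.

Lemma Re_cavg (k : R -> C) : complex.Re (cavg k) = ravg (fun t => complex.Re (k t)).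
Proof. by rewrite /cavg /ravg cReM /= mul0r subr0. Qed.

Lemma cabs_cavg (k : R -> C) : ccts 0 (2 * pi) k ->
  cabs (cavg k) <= ravg (fun t => cabs (k t)).
Proof.
move=> ck; rewrite /cavg cabsM cabs_real ger0_norm ?invr_ge0 ?pi2_ge0//.
by apply: ler_wpM2l; [rewrite invr_ge0 pi2_ge0|exact: cabs_cint_le].
Qed.

Lemma circ_ccts f r : 0 <= r -> r < 1 -> analytic_on disc f ->
  ccts 0 (2 * pi) (fun t => f (circ r t)).
Proof. by move=> r0 r1 df; apply: (ccts_circ r0 r1); exact: analytic_cts. Qed.

Lemma pow_le_const (x y K : R) : 0 <= x -> 0 <= y ->
  (forall n, x ^+ n <= K * y ^+ n) -> x <= y.
Proof.
move=> x0 y0 H; rewrite leNgt; apply/negP => yx.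
have xp : 0 < x by exact: le_lt_trans yx.
have : (fun n => K * (y / x) ^+ n) @ \oo --> (K * 0).
  apply: cvgM; first exact: cvg_cst.
  apply: cvg_expr; rewrite ger0_norm; last by rewrite divr_ge0// ltW.
  by rewrite ltr_pdivrMr// mul1r.
rewrite mulr0 => /cvgrPdist_lt => /(_ 1 ltr01)[n _ /(_ n (leqnn n))].
rewrite /= sub0r normrN => /(le_lt_trans (ler_norm _)); apply/negP; rewrite -leNgt.
by rewrite expr_div_n mulrA ler_pdivlMr ?exprn_gt0// mul1r.
Qed.

(** Cauchy's formula for g^n gives |g z|^n <= K M^n with K independent of n. *)
Lemma max_modulus g r (M : R) z : analytic_on disc g -> r < 1 ->
  (forall t, cabs (g (circ r t)) <= M) -> cabs z < r -> cabs (g z) <= M.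
Proof.
move=> dg r1 gM zr; have r0 : 0 < r by exact: le_lt_trans (cabs_ge0 z) zr.
have M0 : 0 <= M by exact: le_trans (cabs_ge0 _) (gM 0).
have d0 : 0 < r - cabs z by rewrite subr_gt0.
apply: (@pow_le_const _ _ (r / (r - cabs z))) => [||n]; [exact: cabs_ge0|exact: M0|].
have dgn : analytic_on disc (fun u => g u ^+ n) by exact: analyticX.
rewrite -cabsX (cauchy_formula dgn r1 zr).
have cc : ccts 0 (2 * pi) (circ r) by move=> t _; exact: circ_continuous.
have ck := ccts_div (cctsM (circ_ccts (ltW r0) r1 dgn) cc) (@ccts_circB _ r z 0 (2 * pi))
  (fun t _ => circ_neq t (ltW r0) zr).
apply: (le_trans (cabs_cavg ck)).
rewrite -[leRHS]ravg_cst; apply: ravg_le; [exact: ccts_cabs ck|exact: rcts_cst|].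
move=> t; rewrite /= !cabsM cabsV cabsX cabs_expi mulr1 cabs_real (gtr0_norm r0).
have h1 : cabs (g (circ r t)) ^+ n <= M ^+ n by rewrite lerXn2r ?nnegrE ?cabs_ge0.
have h2 : (cabs (circ r t - z))^-1 <= (r - cabs z)^-1.
  rewrite lef_pV2 ?posrE//; first exact: circ_dist (ltW r0).
  by rewrite cabs_gt0 circ_neq// ltW.
rewrite [leRHS]mulrC mulrA; apply: ler_pM => //.
- by rewrite mulr_ge0 ?exprn_ge0 ?cabs_ge0// ltW.
- by rewrite invr_ge0 cabs_ge0.
- by apply: ler_wpM2r => //; exact: ltW.
Qed.

Lemma max_modulus_lim g (M : R) z : analytic_on disc g ->
  (forall e, 0 < e -> exists2 p, p < 1 & forall u, p < cabs u -> disc u -> cabs (g u) <= M + e) ->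
  disc z -> cabs (g z) <= M.
Proof.
move=> dg H; rewrite discE => hz; apply/ler_addgt0Pr => e e0.
have [p p1 Hp] := H e e0.
pose m := Num.max p (cabs z); have m1 : m < 1 by rewrite gt_max p1.
pose r := (1 + m) / 2.
have mr : m < r by rewrite /r; lra.
have r1 : r < 1 by rewrite /r; lra.
have zr : cabs z < r by apply: le_lt_trans mr; rewrite le_max lexx orbT.
have r0 : 0 <= r by exact: ltW (le_lt_trans (cabs_ge0 z) zr).
apply: (max_modulus dg r1 _ zr) => t; apply: Hp; last exact: circ_disc.
by rewrite cabs_circ//; apply: le_lt_trans mr; rewrite le_max lexx.
Qed.

Lemma circle_bound f r : analytic_on disc f -> 0 <= r -> r < 1 ->
  exists2 K : R, 0 <= K & forall t, 0 <= t <= 2 * pi -> cabs (f (circ r t)) <= K.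
Proof.
move=> df r0 r1; have cf := ccts_cabs (circ_ccts r0 r1 df).
have [c _ Hc] := EVT_max (pi2_ge0 R) (ctsW cf).
exists (cabs (f (circ r c))); first exact: cabs_ge0.
by move=> t ht; apply: Hc; rewrite in_itv.
Qed.

(** This transfers bounds on one period to the whole line. *)
Lemma circ_period r t c : exists2 s, c <= s <= c + 2 * pi & circ r t = circ r s.
Proof.
have p0 := pi2_gt0 R.
pose n := Num.floor ((t - c) / (2 * pi)).
have hper (k : int) (s : R) : expi (s + (2 * pi) *~ k) = expi s.
  have hn (m : nat) (x : R) : expi (x + (2 * pi) *+ m) = expi x.
    elim: m x => [|m IH] x; first by rewrite mulr0n addr0.
    by rewrite mulrS addrA IH /expi mulr_natl cosD2pi sinD2pi.
  case: k => m; first exact: hn.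
  by rewrite NegzE mulrNz -[LHS](hn m.+1) pmulrn subrK.
exists (t - (2 * pi) *~ n).
  have h1 : n%:~R <= (t - c) / (2 * pi) by exact: floor_le.
  have h2 : (t - c) / (2 * pi) < (n + 1)%:~R by exact: floorD1_gt.
  rewrite ler_pdivlMr// in h1; rewrite ltr_pdivrMr// intrD in h2.
  by rewrite -mulrzr; apply/andP; split; lra.
by rewrite /circ -[in RHS](hper n (t - _)) subrK.
Qed.

Lemma local_bound f r : analytic_on disc f -> r < 1 ->
  exists2 K : R, 0 <= K & forall z, cabs z <= r -> cabs (f z) <= K.
Proof.
move=> df r1; pose p := (1 + Num.max r 0) / 2.
have m1 : Num.max r 0 < 1 by rewrite gt_max r1 ltr01.
have p1 : p < 1 by rewrite /p; lra.
have mp : Num.max r 0 < p by rewrite /p; lra.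
have p0 : 0 <= p by apply/ltW/(le_lt_trans _ mp); rewrite le_max lexx orbT.
have [K K0 HK] := circle_bound df p0 p1.
exists K => // z zr; apply: (max_modulus df p1).
  move=> t; have [s] := circ_period p t 0; rewrite add0r => s01 ->.
  exact: HK.
by apply: le_lt_trans mp; rewrite le_max zr.
Qed.

Lemma local_lipschitz f r : analytic_on disc f -> r < 1 ->
  exists2 L : R, 0 <= L & forall u v, cabs u <= r -> cabs v <= r ->
    cabs (f u - f v) <= L * cabs (u - v).
Proof.
move=> df r1; pose p := (1 + Num.max r 0) / 2.
have m1 : Num.max r 0 < 1 by rewrite gt_max r1 ltr01.
have p1 : p < 1 by rewrite /p; lra.
have mp : Num.max r 0 < p by rewrite /p; lra.
have rp : r < p by apply: le_lt_trans mp; rewrite le_max lexx.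
have p0 : 0 <= p by apply/ltW/(le_lt_trans _ mp); rewrite le_max lexx orbT.
have [K K0 HK] := local_bound df p1.
have d0 : 0 < p - r by rewrite subr_gt0.
exists (2 * K / (p - r)); first by rewrite divr_ge0 ?mulr_ge0// ltW.
move=> u v ur vr.
have hv : disc v by rewrite discE (le_lt_trans vr).
rewrite {1}(dquoE f v u) addrAC subrr add0r cabsM; apply: ler_wpM2r; first exact: cabs_ge0.
apply: (max_modulus (dquo_analytic hv df) p1 _ (le_lt_trans ur rp)) => t.
have vp : cabs v < p by exact: le_lt_trans rp.
have nz := circ_neq t p0 vp.
rewrite dquo_neq; last by rewrite -subr_eq0.
rewrite cabsM cabsV; apply: ler_pM; [exact: cabs_ge0|by rewrite invr_ge0 cabs_ge0| |].
  have := cabsD (f (circ p t)) (- f v); rewrite cabsN => /le_trans; apply.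
  rewrite mulr_natl mulr2n; apply: lerD; apply: HK; last exact: ltW.
  by rewrite cabs_circ.
rewrite lef_pV2 ?posrE ?cabs_gt0//; apply: le_trans (circ_dist v t p0).
by rewrite lerD2l lerN2.
Qed.

(** The derivative is the value at z of the difference quotient, which is at most
    2 M / (d / 2) on the circle of radius d / 2 about z. *)
Lemma cauchy_estimate f z (d M : R) : analytic_on disc f -> 0 < d -> cabs z + d <= 1 ->
  (forall u, cabs (u - z) < d -> cabs (f u) <= M) -> cabs (cderive f z) <= 4 * M / d.
Proof.
move=> df d0 zd HM.
have hz : disc z by rewrite discE; lra.
have hu u : disc u -> cabs (z + d%:C%C * u - z) < d.
  rewrite discE => u1; rewrite addrAC subrr add0r cabsM cabs_real gtr0_norm//.
  by rewrite -[ltRHS]mulr1 ltr_pM2l.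
have hD u : disc u -> disc (z + d%:C%C * u).
  move=> /hu h; rewrite discE; have := cabsD (z + d%:C%C * u - z) z; rewrite subrK; lra.
pose k u := dquo f z (z + d%:C%C * u).
have dk : analytic_on disc k.
  apply: (analytic_comp (dquo_analytic hz df) _ hD).
  apply: analyticD; first exact: analytic_cst.
  by apply: analyticM; [exact: analytic_cst|exact: analytic_id].
have -> : cderive f z = k 0 by rewrite /k mulr0 addr0 dquo_self.
have h2 : (2^-1 : R) < 1 by lra.
apply: (max_modulus dk h2); last by rewrite cabs0; lra.
move=> t; have hc : disc (circ 2^-1 t) by apply: circ_disc; lra.
have cE : cabs (z + d%:C%C * circ 2^-1 t - z) = d / 2.
  rewrite addrAC subrr add0r cabsM cabs_real gtr0_norm// cabs_circ//; lra.
rewrite /k dquo_neq; last by rewrite -subr_eq0 -cabs_gt0 cE divr_gt0.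
rewrite cabsM cabsV cE.
have -> : 4 * M / d = (M + M) / (d / 2) by field; rewrite gt_eqF.
apply: ler_wpM2r; first by rewrite invr_ge0 divr_ge0// ltW.
have := cabsD (f (z + d%:C%C * circ 2^-1 t)) (- f z); rewrite cabsN => /le_trans; apply.
by apply: lerD; apply: HM; [exact: hu|rewrite subrr cabs0].
Qed.

(** This is the mean value property of f^2. *)
Lemma sq_mean_le f r : analytic_on disc f -> 0 <= r -> r < 1 ->
  cabs (f 0) ^+ 2 <= ravg (fun t => cabs (f (circ r t)) ^+ 2).
Proof.
move=> df r0 r1; have df2 : analytic_on disc (fun u => f u ^+ 2) by exact: analyticX.
rewrite -cabsX -(cavg_mean df2 r0 r1); apply: (le_trans (cabs_cavg (circ_ccts r0 r1 df2))).
by rewrite (@eq_ravg _ (fun t => cabs (f (circ r t)) ^+ 2))// => t; rewrite cabsX.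
Qed.

Lemma Re_mean f r : analytic_on disc f -> 0 <= r -> r < 1 ->
  ravg (fun t => complex.Re (f (circ r t))) = complex.Re (f 0).
Proof. by move=> df r0 r1; rewrite -Re_cavg (cavg_mean df). Qed.

End MaximumModulus.

(** * Blaschke products and logarithmic means *)

Section Jensen.
Variable R : realType.
Local Notation C := R[i].
Implicit Types (f g h F : C -> C) (z w u : C) (r t : R) (zs : seq C).

Lemma ln_le_sub1 (x : R) : 0 < x -> ln x <= x - 1.
Proof. by move=> x0; have := @le_ln1Dx R (x - 1); rewrite addrCA subrr addr0; apply; lra. Qed.

Lemma rcts_ln (p : R -> R) : rcts p -> (forall t, 0 < p t) -> rcts (fun t => ln (p t)).
Proof.
move=> cp p0 t tt; apply: (@continuous_comp _ _ _ p (@ln R) t); first exact: (cp t tt).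
exact: continuous_ln.
Qed.

Lemma rcts_Re (k : R -> C) : ccts 0 (2 * pi) k -> rcts (fun t => complex.Re (k t)).
Proof. by move=> ck; exact: (ccts_Re ck). Qed.

Lemma rcts_cabs (k : R -> C) : ccts 0 (2 * pi) k -> rcts (fun t => cabs (k t)).
Proof. by move=> ck; exact: (ccts_cabs ck). Qed.

Lemma rcts_lncabs (k : R -> C) : ccts 0 (2 * pi) k -> (forall t, k t != 0) ->
  rcts (fun t => ln (cabs (k t))).
Proof.
by move=> ck k0; apply: rcts_ln; [exact: rcts_cabs|move=> t; rewrite cabs_gt0].
Qed.

Lemma ln_cabs_le (q : C) : q != 0 ->
  ln (cabs q) <= complex.Re (q - 1) + cabs (q - 1) ^+ 2 / 2.
Proof.
move=> q0; have qp : 0 < cabs q by rewrite cabs_gt0.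
have : ln (cabs q ^+ 2) <= cabs q ^+ 2 - 1 by apply: ln_le_sub1; rewrite exprn_gt0.
rewrite lnXn// mulr2n !sqr_cabs cReB cImB; case: q {q0 qp} => a b /=.
set l := ln _ => H; rewrite subr0.
have -> : a - 1 + ((a - 1) ^+ 2 + b ^+ 2) / 2 = (a ^+ 2 + b ^+ 2 - 1) / 2 by field.
by rewrite ler_pdivlMr// mulr_natr mulr2n.
Qed.

Lemma analytic_scale f (k : R) : analytic_on disc f -> 0 <= k <= 1 ->
  analytic_on disc (fun u => f (k%:C%C * u)).
Proof.
move=> df /andP[k0 k1]; apply: (analytic_comp df).
  by apply: analyticM; [exact: analytic_cst|exact: analytic_id].
move=> u; rewrite !discE cabsM cabs_real ger0_norm// => u1.
by apply: le_lt_trans u1; apply: ler_piMl; first exact: cabs_ge0.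
Qed.

(** The circle is reached from the centre in n steps; the ratios q of consecutive
    values are analytic with q(0) = 1 and |q - 1| = O(1/n) on the circle. As
    log|q| <= Re (q - 1) + |q - 1|^2 / 2 and the mean of Re (q - 1) is 0, each step
    costs O(1/n^2). *)
Lemma mean_ln_le h r : analytic_on disc h -> (forall z, disc z -> h z != 0) ->
  0 <= r -> r < 1 ->
  ravg (fun t => ln (cabs (h (circ r t)))) <= ln (cabs (h 0)).
Proof.
move=> dh h0 r0 r1.
have [L L0 HL] := local_lipschitz dh r1.
have dhV := analyticV dh h0.
have [K K0 HK] := local_bound dhV r1.
pose B := (L * K) ^+ 2 / 2.
have B0 : 0 <= B by rewrite divr_ge0// sqr_ge0.
suff H (n : nat) : (0 < n)%N ->
    ravg (fun t => ln (cabs (h (circ r t)))) <= ln (cabs (h 0)) + B / n%:R.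
  rewrite -subr_le0; apply: (@small_le0 _ _ B) => e e0.
  pose n := (Num.truncn e^-1).+1.
  have en : e^-1 < n%:R by exact: truncnS_gt.
  have n0 : 0 < n%:R :> R by rewrite ltr0n.
  rewrite lerBlDl; apply: (le_trans (H n isT)); rewrite lerD2l mulrC.
  by apply: ler_wpM2r => //; rewrite -[leRHS]invrK lef_pV2 ?posrE ?invr_gt0// ltW.
move=> n0; have n0' : 0 < n%:R :> R by rewrite ltr0n.
pose k (j : nat) : R := j%:R / n%:R.
have k01 j : (j <= n)%N -> 0 <= k j <= 1.
  by move=> jn; rewrite /k divr_ge0//= ler_pdivrMr// mul1r ler_nat.
pose hj j u := h ((k j)%:C%C * u).
have dhj j : (j <= n)%N -> analytic_on disc (hj j) by move=> jn; exact: analytic_scale (k01 _ jn).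
have kd j u : (j <= n)%N -> cabs u <= r -> cabs ((k j)%:C%C * u) <= r.
  move=> jn ur; have /andP[a b] := k01 _ jn; rewrite cabsM cabs_real ger0_norm//.
  by apply: le_trans ur; apply: ler_piMl; first exact: cabs_ge0.
have kd' j u : (j <= n)%N -> disc u -> disc ((k j)%:C%C * u).
  move=> jn; rewrite !discE => ur; have /andP[a b] := k01 _ jn; rewrite cabsM cabs_real ger0_norm//.
  by apply: le_lt_trans ur; apply: ler_piMl; first exact: cabs_ge0.
have hj0 j u : (j <= n)%N -> disc u -> hj j u != 0 by move=> jn du; apply: h0; exact: kd'.
have cj j : (j <= n)%N -> rcts (fun t => ln (cabs (hj j (circ r t)))).
  move=> jn; apply: rcts_lncabs; first exact: (circ_ccts r0 r1 (dhj _ jn)).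
  by move=> t; apply: hj0 => //; exact: circ_disc.
suff Hj j : (j <= n)%N -> ravg (fun t => ln (cabs (hj j (circ r t)))) <=
    ln (cabs (h 0)) + j%:R * (B / n%:R ^+ 2).
  have := Hj n (leqnn n); have -> : n%:R * (B / n%:R ^+ 2) = B / n%:R by field; rewrite gt_eqF.
  apply: le_trans; rewrite le_eqVlt; apply/orP; left; apply/eqP; apply: eq_ravg => t.
  by rewrite /hj /k mulfV ?gt_eqF// rmorph1 mul1r.
elim: j => [_|j IH jn].
  rewrite mul0r addr0 le_eqVlt; apply/orP; left; apply/eqP.
  rewrite -[RHS]ravg_cst; apply: eq_ravg => t.
  by rewrite /hj /k mul0r rmorph0 mul0r.
have jn' : (j <= n)%N by exact: ltnW.
pose q u := hj j.+1 u / hj j u.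
have dq : analytic_on disc q.
  apply: analyticM; first exact: (dhj _ jn).
  by apply: analyticV; [exact: (dhj _ jn')|move=> z; exact: hj0].
have q1 t : cabs (q (circ r t) - 1) <= L * K / n%:R.
  have hd : disc (circ r t) by exact: circ_disc.
  have cr : cabs (circ r t) <= r by rewrite cabs_circ.
  have nz := hj0 _ _ jn' hd.
  have -> : q (circ r t) - 1 = (hj j.+1 (circ r t) - hj j (circ r t)) * (hj j (circ r t))^-1.
    by rewrite /q; field.
  have b1 : cabs ((hj j (circ r t))^-1) <= K by apply: (HK ((k j)%:C%C * circ r t)); exact: kd.
  have b2 : cabs (hj j.+1 (circ r t) - hj j (circ r t)) <= L / n%:R.
    apply: (le_trans (HL _ _ (kd _ _ jn cr) (kd _ _ jn' cr))).
    apply: ler_wpM2l => //.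
    rewrite -mulrBl -rmorphB cabsM cabs_real /k -mulrBl -natrB// subSnn.
    rewrite ger0_norm ?divr_ge0//; rewrite -[leRHS]mulr1 mul1r.
    by apply: ler_wpM2l; [rewrite invr_ge0|apply: le_trans cr _; exact: ltW].
  rewrite cabsM mulrAC; apply: ler_pM => //; exact: cabs_ge0.
have q0 t : q (circ r t) != 0.
  by rewrite mulf_neq0 ?invr_eq0 ?hj0//; exact: circ_disc.
have cq := circ_ccts r0 r1 dq.
have cReq : rcts (fun t => complex.Re (q (circ r t) - 1) + B / n%:R ^+ 2).
  apply: rctsD; last exact: rcts_cst.
  by apply: rcts_Re; apply: (cctsB cq); exact: ccts_cst.
have -> : ravg (fun t => ln (cabs (hj j.+1 (circ r t)))) =
    ravg (fun t => ln (cabs (hj j (circ r t))) + ln (cabs (q (circ r t)))).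
  apply: eq_ravg => t; have hd : disc (circ r t) by exact: circ_disc.
  rewrite -lnM ?posrE ?cabs_gt0 ?hj0//; congr ln; rewrite -cabsM /q.
  by rewrite mulrC mulfVK// hj0.
rewrite ravgD; [|exact: cj|exact: (rcts_lncabs cq q0)].
rewrite -natr1 mulrDl mul1r addrA; apply: lerD; first exact: IH.
apply: (@le_trans _ _ (ravg (fun t => complex.Re (q (circ r t) - 1) + B / n%:R ^+ 2))).
  apply: ravg_le => [||t]; [exact: (rcts_lncabs cq q0)|exact: cReq|].
  apply: (le_trans (ln_cabs_le (q0 t))); rewrite lerD2l /B.
  have -> : (L * K) ^+ 2 / 2 / n%:R ^+ 2 = (L * K / n%:R) ^+ 2 / 2 by field; rewrite gt_eqF.
  by apply: ler_wpM2r => //; rewrite lerXn2r ?nnegrE ?cabs_ge0// divr_ge0// mulr_ge0.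
rewrite ravgD; [|exact: rcts_Re (cctsB cq (@ccts_cst _ 0 (2 * pi) 1))|exact: rcts_cst].
have dq1 : analytic_on disc (fun u => q u - 1).
  by apply: analyticB; [exact: dq|exact: analytic_cst].
rewrite ravg_cst (Re_mean dq1 r0 r1).
have -> : q 0 = 1 by rewrite /q /hj !mulr0 mulfV// h0//; exact: disc0.
by rewrite subrr /= add0r.
Qed.

(** By this identity Moebius transforms have modulus less than 1 in the disc and
    tend to modulus 1 at the circle. *)
Lemma sqr_blaschke z u : cabs (1 - conjc z * u) ^+ 2 =
  cabs (u - z) ^+ 2 + (1 - cabs u ^+ 2) * (1 - cabs z ^+ 2).
Proof. by rewrite !sqr_cabs; case: z u => a b [c d] /=; ring. Qed.

Lemma blaschke_den z u : disc z -> disc u -> 1 - conjc z * u != 0.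
Proof.
rewrite !discE => z1 u1; rewrite subr_eq0; apply/eqP => /(congr1 (fun z => cabs z)).
rewrite cabs1 cabsM cabs_conj => e; have := cabs_ge0 z; have := cabs_ge0 u.
move: e z1 u1; move: (cabs _) (cabs _) => a b e *; nra.
Qed.

Lemma blaschke_le z u : disc z -> disc u -> cabs (u - z) <= cabs (1 - conjc z * u).
Proof.
rewrite !discE => z1 u1; rewrite -(@ler_pXn2r _ 2)// ?nnegrE ?cabs_ge0//.
rewrite sqr_blaschke lerDl mulr_ge0// subr_ge0 expr_le1 ?cabs_ge0//; exact: ltW.
Qed.

Definition bnum zs u : C := \prod_(z <- zs) (u - z).
Definition bden zs u : C := \prod_(z <- zs) (1 - conjc z * u).

Lemma bnum_cons z zs u : bnum (z :: zs) u = (u - z) * bnum zs u.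
Proof. by rewrite /bnum big_cons. Qed.
Lemma bden_cons z zs u : bden (z :: zs) u = (1 - conjc z * u) * bden zs u.
Proof. by rewrite /bden big_cons. Qed.

Definition in_disc zs := forall z, z \in zs -> disc z.

Lemma in_disc_cons z zs : in_disc (z :: zs) -> disc z /\ in_disc zs.
Proof.
by move=> H; split=> [|w wz]; apply: H; rewrite inE ?eqxx// wz orbT.
Qed.

Lemma analytic_bden zs : analytic_on disc (bden zs).
Proof.
elim: zs => [|z zs IH].
  rewrite (_ : bden [::] = fun=> 1); first exact: analytic_cst.
  by apply/funext => u; rewrite /bden big_nil.
rewrite (_ : bden _ = fun u => (1 - conjc z * u) * bden zs u); last first.
  by apply/funext => u; rewrite bden_cons.
apply: analyticM; last exact: IH.
apply: analyticB; first exact: analytic_cst.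
by apply: analyticM; [exact: analytic_cst|exact: analytic_id].
Qed.

Lemma analytic_bnum zs : analytic_on disc (bnum zs).
Proof.
elim: zs => [|z zs IH].
  rewrite (_ : bnum [::] = fun=> 1); first exact: analytic_cst.
  by apply/funext => u; rewrite /bnum big_nil.
rewrite (_ : bnum _ = fun u => (u - z) * bnum zs u); last first.
  by apply/funext => u; rewrite bnum_cons.
apply: analyticM; last exact: IH.
by apply: analyticB; [exact: analytic_id|exact: analytic_cst].
Qed.

Lemma bden_neq0 zs u : in_disc zs -> disc u -> bden zs u != 0.
Proof.
move=> hzs hu; elim: zs hzs => [_|z zs IH /in_disc_cons[hz hzs]].
  by rewrite /bden big_nil oner_neq0.
by rewrite bden_cons mulf_neq0 ?IH ?blaschke_den.
Qed.

Lemma bden0 zs : bden zs 0 = 1.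
Proof. by elim: zs => [|z zs IH]; rewrite /bden ?big_nil// -/(bden _ _) bden_cons mulr0 subr0 mul1r. Qed.

Lemma blaschke_prod_le zs u : in_disc zs -> disc u -> cabs (bnum zs u) <= cabs (bden zs u).
Proof.
move=> hzs hu; elim: zs hzs => [_|z zs IH /in_disc_cons[hz hzs]].
  by rewrite /bden /bnum !big_nil.
by rewrite bden_cons bnum_cons !cabsM ler_pM ?cabs_ge0 ?IH ?blaschke_le.
Qed.

(** By [sqr_blaschke] every factor tends to modulus 1 at the circle. *)
Lemma blaschke_prod_lim zs (e : R) : in_disc zs -> 0 < e ->
  exists2 p : R, p < 1 & forall u, p < cabs u -> disc u ->
    (1 - e) * cabs (bden zs u) <= cabs (bnum zs u).
Proof.
elim: zs e => [e _ e0|z zs IH e /in_disc_cons[hz hzs] e0].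
  exists 0; first exact: ltr01.
  by move=> u _ _; rewrite /bden /bnum !big_nil cabs1 mulr1; lra.
have [e1|e1] := lerP e 1; last first.
  exists 0; first exact: ltr01.
  move=> u _ _; apply: (@le_trans _ _ 0); last exact: cabs_ge0.
  by rewrite mulr_le0_ge0 ?cabs_ge0//; lra.
have e20 : 0 < e / 2 by rewrite divr_gt0.
have [p p1 Hp] := IH (e / 2) hzs e20.
have z1 : 0 < 1 - cabs z by rewrite subr_gt0.
pose p' := 1 - e / 2 * (1 - cabs z) ^+ 2 / 2.
have p'1 : p' < 1 by rewrite /p' ltrBlDr ltrDl divr_gt0// mulr_gt0// exprn_gt0.
exists (Num.max p p'); first by rewrite gt_max p1.
move=> u; rewrite gt_max => /andP[pu p'u] hu.
rewrite bden_cons bnum_cons !cabsM.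
have E : (1 - e / 2) * cabs (1 - conjc z * u) <= cabs (u - z).
  rewrite -(@ler_pXn2r _ 2)// ?nnegrE ?cabs_ge0//; last first.
    by rewrite mulr_ge0 ?cabs_ge0//; lra.
  rewrite exprMn.
  have [X XE] : exists X, X = cabs (1 - conjc z * u) by exists (cabs (1 - conjc z * u)).
  have := sqr_blaschke z u; rewrite -XE => HX.
  have hX : 1 - cabs z <= X.
    rewrite XE; have := cabsB_ge 1 (conjc z * u); rewrite cabs1 cabsM cabs_conj.
    apply: le_trans; rewrite lerD2l lerN2; apply: ler_piMr; first exact: cabs_ge0.
    exact: ltW.
  have h1 : (1 - cabs u ^+ 2) * (1 - cabs z ^+ 2) <= e / 2 * X ^+ 2.
    apply: (@le_trans _ _ (e / 2 * (1 - cabs z) ^+ 2)); last first.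
      apply: ler_wpM2l; first exact: ltW.
      by clear HX XE; move: (1 - cabs z) X z1 hX => y x y0 yx; nra.
    have a1 : 1 - cabs u ^+ 2 <= e / 2 * (1 - cabs z) ^+ 2.
      have u0 := cabs_ge0 u; move: p'u hu; rewrite discE /p'.
      set D := _ * _ ^+ 2; move: (cabs u) u0 => v; nra.
    apply: (le_trans (ler_wpM2r _ a1)).
      by rewrite subr_ge0 expr_le1 ?cabs_ge0// ltW.
    apply: ler_piMr; last by rewrite lerBlDr lerDl sqr_ge0.
    by rewrite mulr_ge0 ?sqr_ge0// ltW.
  have X2 : 0 <= X ^+ 2 by exact: sqr_ge0.
  have -> : cabs (u - z) ^+ 2 = X ^+ 2 - (1 - cabs u ^+ 2) * (1 - cabs z ^+ 2).
    by rewrite HX addrK.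
  move: h1; move: (_ * (1 - cabs z ^+ 2)) (X ^+ 2) X2 => Y x x0 h1.
  have a1 : 0 <= 1 - e / 2 by lra.
  have := mulr_ge0 x0 (mulr_ge0 a1 (ltW e20)); lra.
apply: (@le_trans _ _ ((1 - e / 2) * cabs (1 - conjc z * u) * ((1 - e / 2) * cabs (bden zs u)))).
  rewrite mulrACA; apply: ler_wpM2r; first by rewrite mulr_ge0 ?cabs_ge0.
  nra.
apply: ler_pM => //; try (by rewrite mulr_ge0 ?cabs_ge0//; lra).
exact: Hp.
Qed.

(** Near the circle the Blaschke product has modulus close to 1, so that the
    quotient is at most K + e there, and inside by the maximum principle. *)
Lemma blaschke_div_bound f h zs (K : R) : 0 < K -> in_disc zs -> analytic_on disc h ->
  (forall u, disc u -> f u = bnum zs u * h u) -> (forall u, disc u -> cabs (f u) <= K) ->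
  forall u, disc u -> cabs (h u * bden zs u) <= K.
Proof.
move=> K0 hzs dh fE fK u; apply: (@max_modulus_lim _ (fun u => h u * bden zs u)).
  by apply: (analyticM dh); exact: analytic_bden.
move=> e e0; pose e' := e / (K + e).
have Ke : 0 < K + e by rewrite addr_gt0.
have e'0 : 0 < e' by rewrite divr_gt0.
have [p p1 Hp] := blaschke_prod_lim hzs e'0.
exists p => // v pv hv; have := Hp v pv hv; have := fK v hv.
rewrite fE// !cabsM; have : 0 < cabs (bden zs v) by rewrite cabs_gt0 bden_neq0.
have -> : 1 - e' = K / (K + e) by rewrite /e'; field; rewrite gt_eqF.
rewrite mulrAC ler_pdivrMr//; have := cabs_ge0 (h v).
move: (cabs (bden zs v)) (cabs (bnum zs v)) (cabs (h v)) => d n y y0 d0 h1 h2.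
have h3 : K * d * y <= n * (K + e) * y by rewrite ler_wpM2r.
rewrite -(ler_pM2l K0); nra.
Qed.

Lemma cabs_bnum0 zs : cabs (bnum zs 0) = \prod_(z <- zs) cabs z.
Proof.
elim: zs => [|z zs IH]; first by rewrite /bnum !big_nil cabs1.
by rewrite bnum_cons big_cons cabsM IH sub0r cabsN.
Qed.

Lemma prod_pos_le zs (p : R) : (forall z, z \in zs -> 0 < cabs z < p) ->
  0 < \prod_(z <- zs) cabs z <= p ^+ size zs.
Proof.
elim: zs => [_|z zs IH H]; first by rewrite big_nil ltr01 expr0 lexx.
have /andP[z0 zp] := H z (mem_head _ _).
have /andP[h1 h2] : 0 < \prod_(z <- zs) cabs z <= p ^+ size zs.
  by apply: IH => w wz; apply: H; rewrite inE wz orbT.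
by rewrite big_cons mulr_gt0//= exprS ler_pM// ltW.
Qed.

Lemma ln_prod zs : (forall z, z \in zs -> z != 0) ->
  ln (\prod_(z <- zs) cabs z) = \sum_(z <- zs) ln (cabs z).
Proof.
elim: zs => [_|z zs IH H]; first by rewrite !big_nil ln1.
have z0 : 0 < cabs z by rewrite cabs_gt0 H ?mem_head.
have hzs x : x \in zs -> x != 0 by move=> xs; apply: H; rewrite inE xs orbT.
rewrite !big_cons lnM ?IH// posrE// big_seq prodr_gt0// => x xs.
by rewrite cabs_gt0 hzs.
Qed.

(** All zeros in a smaller disc can be divided out: each one divided out raises
    the value at 0 by a fixed factor, which stays bounded. *)
Lemma extract_zeros f (K p : R) : analytic_on disc f -> 0 < K ->
  (forall u, disc u -> cabs (f u) <= K) -> f 0 != 0 -> 0 < p -> p < 1 ->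
  exists zs h, [/\ forall z, z \in zs -> 0 < cabs z < p, analytic_on disc h,
    forall u, disc u -> f u = bnum zs u * h u & forall u, cabs u < p -> h u != 0].
Proof.
move=> df K0 fK f0 p0 p1.
pose P (m : nat) := exists zs h, [/\ size zs = m, forall z, z \in zs -> 0 < cabs z < p,
  analytic_on disc h & forall u, disc u -> f u = bnum zs u * h u].
have P0 : P 0%N.
  exists [::], f; split=> // u _; by rewrite /bnum big_nil mul1r.
have f0p : 0 < cabs (f 0) by rewrite cabs_gt0.
have [M HM] : exists M : nat, forall m, P m -> (m <= M)%N.
  have : (fun n => p ^+ n) @ \oo --> (0 : R) by apply: cvg_expr; rewrite ger0_norm// ltW.
  have fK0 : 0 < cabs (f 0) / K by rewrite divr_gt0.
  move/cvgrPdist_lt => /(_ _ fK0)[M _ HM]; exists M => m [zs [h [sz hz dh fE]]].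
  rewrite leqNgt; apply/negP => mM.
  have := HM m (ltnW mM); rewrite sub0r normrN ger0_norm ?exprn_ge0 ?(ltW p0)//.
  have hzs : in_disc zs.
    by move=> z /hz /andP[_ zp]; rewrite discE (lt_trans zp).
  have := blaschke_div_bound K0 hzs dh fE fK (disc0 R).
  rewrite bden0 mulr1 => hK; have /andP[q0 q1] := prod_pos_le hz.
  have := fE 0 (disc0 R) => /(congr1 (fun z => cabs z)); rewrite cabsM cabs_bnum0 => fE0.
  rewrite -sz fE0 ltr_pdivlMr// => H.
  have : (\prod_(z <- zs) cabs z) * cabs (h 0) <= p ^+ size zs * K.
    by apply: ler_pM => //; [exact: ltW|exact: cabs_ge0].
  by rewrite leNgt H.
have exP : exists m, `[< P m >] by exists 0%N; apply/asboolP.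
have ubP m : `[< P m >] -> (m <= M)%N by move/asboolP/HM.
case: (ex_maxnP exP ubP) => m /asboolP[zs [h [sz hz dh fE]]] max.
exists zs, h; split=> // u up; apply/eqP => hu0.
have du : disc u by rewrite discE (lt_trans up).
have u0 : u != 0.
  apply/eqP => u0; move/negP : f0; apply; rewrite fE; last exact: disc0.
  by move: hu0; rewrite u0 => ->; rewrite mulr0 eqxx.
have : P m.+1.
  exists (u :: zs), (dquo h u); split.
  - by rewrite /= sz.
  - by move=> z; rewrite inE => /orP[/eqP->|/hz//]; rewrite cabs_gt0 u0.
  - exact: (dquo_analytic du dh).
  - move=> v hv; rewrite bnum_cons fE// {1}(dquoE h u v) hu0 add0r; ring.
by move/asboolP/max; rewrite ltnn.
Qed.

End Jensen.

(** * The logarithmic potential of a circle *)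

Section LogKernel.
Variable R : realType.
Local Notation C := R[i].
Local Notation mu := (@lebesgue_measure R).
Implicit Types (f g h F : C -> C) (z w u y : C) (r t s : R) (zs : seq C).

(** The constant ln 2 makes the kernel nonnegative at squared distances between
    points of the closed disc, so that integrals can be exchanged without
    integrability conditions. *)
Definition logker s : \bar R := if s <= 0 then +oo%E else (ln 2 - ln s / 2)%:E.

Lemma logker_cabs z : z != 0 -> logker (cabs z ^+ 2) = (ln 2 - ln (cabs z))%:E.
Proof.
rewrite -cabs_gt0 => z0; rewrite /logker lt_geF ?exprn_gt0// lnXn//.
by rewrite mulr2n; congr (_ - _)%:E; field.
Qed.

Lemma logker_ge0 s : s <= 4 -> (0 <= logker s)%E.
Proof.
move=> s4; rewrite /logker; case: (lerP s 0) => // s0; rewrite lee_fin.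
have -> : ln (2 : R) = ln (2 ^+ 2) / 2 by rewrite lnXn//; field.
rewrite -mulrBl mulr_ge0// subr_ge0 ler_ln ?posrE// (le_trans s4)//.
by rewrite (_ : 2 ^+ 2 = 4 :> R)//; ring.
Qed.

Lemma logker_anti s t : s <= t -> (logker t <= logker s)%E.
Proof.
move=> st; rewrite /logker; case: (lerP s 0) => s0; first by rewrite leey.
have t0 : 0 < t by exact: lt_le_trans st.
rewrite (lt_geF t0) lee_fin lerD2l lerN2; apply: ler_wpM2r => //.
by rewrite ler_ln ?posrE.
Qed.

Lemma measurable_logker : measurable_fun setT logker.
Proof.
apply: measurable_fun_ifT => //.
- by apply: measurable_fun_ler => //; exact: measurable_cst.
- apply/measurable_EFinP; apply: measurable_funB => //.
  by apply: measurable_funM => //; exact: measurable_ln.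
Qed.

(** These continuous functions increase to the kernel with n. *)
Definition logker_trunc (n : nat) s : R := ln 2 - ln (Num.max s n.+1%:R^-1) / 2.

Lemma trunc_pos (n : nat) s : 0 < Num.max s n.+1%:R^-1.
Proof. by rewrite lt_max invr_gt0 ltr0n orbT. Qed.

Lemma logker_trunc_nd s : {homo (fun n => (logker_trunc n s)%:E) : n m / (n <= m)%N >-> (n <= m)%E}.
Proof.
move=> n m nm; rewrite lee_fin lerD2l lerN2; apply: ler_wpM2r => //.
rewrite ler_ln ?posrE ?trunc_pos// ge_max le_max lexx /= le_max.
by rewrite lef_pV2 ?posrE ?ltr0n// ler_nat ltnS nm orbT.
Qed.

Lemma logker_trunc_cvg s : (fun n => (logker_trunc n s)%:E) @ \oo --> logker s.
Proof.
rewrite /logker; case: (lerP s 0) => s0.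
  apply/cvgeryP/cvgryPge => A.
  have [k Hk] : exists k : nat, expR (2 * A) <= k%:R.
    by exists (Num.truncn (expR (2 * A))).+1; apply/ltW/truncnS_gt.
  near=> n; rewrite /logker_trunc.
  have -> : Num.max s n.+1%:R^-1 = n.+1%:R^-1.
    by apply/max_idPr; apply: (le_trans s0); rewrite invr_ge0.
  rewrite lnV ?posrE ?ltr0n//.
  have h1 : 2 * A <= ln n.+1%:R.
    rewrite -(@ler_expR R) lnK ?posrE ?ltr0n//; apply: (le_trans Hk).
    by rewrite ler_nat; apply: (@leq_trans n) => //; near: n; exact: nbhs_infty_ge.
  have h2 : 0 <= ln 2 :> R by apply: ln_ge0; lra.
  by move: h1 h2; set a := ln _; set b := ln _; lra.
apply: cvg_near_cst; near=> n; congr (_ - ln _ / 2)%:E.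
apply/max_idPl; rewrite -[leRHS]invrK lef_pV2 ?posrE ?invr_gt0 ?ltr0n//.
apply: ltW; near: n.
exists (Num.truncn s^-1).+1 => // n /= hn.
by apply: (lt_le_trans (truncnS_gt _)); rewrite ler_nat (leq_trans hn).
Unshelve. all: by end_near. Qed.

Lemma int_ravg (p : R -> R) : rcts p ->
  (\int[mu]_(t in `[0%R, (2 * pi)%R]) (p t)%:E = (2 * pi * ravg p)%:E)%E.
Proof.
move=> cp; rewrite /ravg mulVKf ?gt_eqF ?pi2_gt0// /rint /Rintegral fineK//.
exact: integrable_fin_num (cts_integrable cp).
Qed.

Lemma rcts_circB y (q : R) : ccts 0 (2 * pi) (fun t => y - circ q t).
Proof. by apply: cctsB; [exact: ccts_cst|move=> t _; exact: circ_continuous]. Qed.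

Lemma circ1 t : circ 1 t = expi t.
Proof. by rewrite /circ rmorph1 mul1r. Qed.

(** The inequality for functions without zeros is applied to an affine function and
    to its inverse. *)
Lemma ravg_ln_affine (x : C) : cabs x < 1 ->
  ravg (fun t => ln (cabs (1 - x * circ 1 t))) = 0.
Proof.
move=> x1; pose q := (1 + cabs x) / 2.
have x0 := cabs_ge0 x.
have q1 : q < 1 by rewrite /q; lra.
have q0 : 0 < q by rewrite /q; lra.
have xq : cabs x < q by rewrite /q; lra.
have qC : q%:C%C != 0 :> C by rewrite eq_complex /= negb_and gt_eqF.
pose h u := 1 - x / q%:C%C * u.
have dh : analytic_on disc h.
  apply: analyticB; first exact: analytic_cst.
  by apply: analyticM; [exact: analytic_cst|exact: analytic_id].
have h0 u : disc u -> h u != 0.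
  rewrite discE subr_eq0 => u1; apply/eqP => /(congr1 (fun z => cabs z)).
  rewrite cabs1 !cabsM cabsV cabs_real gtr0_norm// => e.
  have : cabs x / q < 1 by rewrite ltr_pdivrMr// mul1r.
  have := cabs_ge0 u; have : 0 <= cabs x / q by rewrite divr_ge0// ltW.
  by move: e u1; move: (cabs x / q) (cabs u) => a b *; nra.
have hE t : h (circ q t) = 1 - x * circ 1 t.
  by rewrite /h /circ rmorph1 mul1r mulrA mulfVK.
have dhV := analyticV dh h0.
have h0V u : disc u -> (h u)^-1 != 0 by move=> du; rewrite invr_eq0 h0.
have A1 := mean_ln_le dh h0 (ltW q0) q1.
have A2 := mean_ln_le dhV h0V (ltW q0) q1.
have H0 : h 0 = 1 by rewrite /h mulr0 subr0.
rewrite H0 cabs1 ln1 in A1; rewrite H0 invr1 cabs1 ln1 in A2.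
have E1 : ravg (fun t => ln (cabs (h (circ q t)))) = ravg (fun t => ln (cabs (1 - x * circ 1 t))).
  by apply: eq_ravg => t; rewrite hE.
have cl : rcts (fun t => ln (cabs (1 - x * circ 1 t))).
  rewrite (_ : (fun _ => _) = (fun t => ln (cabs (h (circ q t))))); last first.
    by apply/funext => t; rewrite hE.
  apply: rcts_lncabs; first exact: (circ_ccts (ltW q0) q1 dh).
  by move=> t; apply: h0; exact: circ_disc (ltW q0) q1.
have E2 : ravg (fun t => ln (cabs (h (circ q t))^-1)) = - ravg (fun t => ln (cabs (1 - x * circ 1 t))).
  rewrite -mulN1r -(ravgZ _ cl); apply: eq_ravg => t.
  rewrite mulN1r -hE cabsV lnV ?posrE// cabs_gt0; apply: h0; exact: circ_disc (ltW q0) q1.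
rewrite E1 in A1; rewrite E2 in A2.
by apply/eqP; rewrite eq_le A1 -oppr_le0 A2.
Qed.

(** The larger of q and |y| is factored out, which leaves an affine function of
    expi t without zeros in the closed disc. *)
Lemma ravg_ln_circ y (q : R) : 0 < q -> cabs y != q ->
  [/\ forall t, y - circ q t != 0,
      ravg (fun t => ln (cabs (y - circ q t))) = ln (Num.max q (cabs y))
    & rcts (fun t => ln (cabs (y - circ q t)))].
Proof.
move=> q0 yq.
have nz t : y - circ q t != 0.
  rewrite subr_eq0; apply: contra yq => /eqP ->; rewrite cabs_circ ?eqxx//; exact: ltW.
have cl : rcts (fun t => ln (cabs (y - circ q t))).
  by apply: rcts_lncabs nz; exact: rcts_circB.
split=> //.
have qC : q%:C%C != 0 :> C by rewrite eq_complex /= negb_and gt_eqF.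
have key (x : C) (k : R) : 0 < k -> cabs x < 1 ->
    (forall t, cabs (y - circ q t) = k * cabs (1 - x * circ 1 t)) ->
    ravg (fun t => ln (cabs (y - circ q t))) = ln k.
  move=> k0 x1 H.
  have nx t : 0 < cabs (1 - x * circ 1 t).
    by rewrite -(pmulr_rgt0 _ k0) -H cabs_gt0.
  have E t : ln (cabs (y - circ q t)) = ln k + ln (cabs (1 - x * circ 1 t)).
    by rewrite H lnM ?posrE.
  rewrite (eq_ravg E) ravgD ?ravg_cst ?ravg_ln_affine ?addr0//; first exact: rcts_cst.
  rewrite (_ : (fun _ => _) = (fun t => ln (cabs (y - circ q t)) + - ln k)); last first.
    by apply/funext => t; rewrite E addrAC subrr add0r.
  by apply: rctsD cl _; exact: rcts_cst.
have [yl|yg|ye] := ltgtP (cabs y) q; last by rewrite ye eqxx in yq.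
  apply: (key (conjc y / q%:C%C)) => // [|t].
    by rewrite cabsM cabsV cabs_conj cabs_real gtr0_norm// ltr_pdivrMr// mul1r.
  have cM (a b : C) : conjc (a * b) = conjc a * conjc b by exact: rmorphM.
  have cB (a b : C) : conjc (a - b) = conjc a - conjc b by exact: rmorphB.
  have ee : conjc (expi t) * expi t = 1 by rewrite mulrC mul_conjc cabs_expi expr1n.
  have -> : q * cabs (1 - conjc y / q%:C%C * circ 1 t) =
      cabs (q%:C%C * (1 - conjc y / q%:C%C * circ 1 t)) by rewrite cabsM cabs_real gtr0_norm.
  transitivity (cabs (y - circ q t) * cabs (expi t)); first by rewrite cabs_expi mulr1.
  rewrite -cabs_conj -cabsM.
  rewrite circ1 cB /circ cM conjc_real mulrBl -(mulrA q%:C%C) ee mulr1 mulrBr mulr1.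
  by rewrite -[LHS]cabsN opprB; congr (cabs (_ - _)); field.
have y0 : 0 < cabs y by exact: lt_trans yg.
have yn : y != 0 by rewrite -cabs_gt0.
apply: (key (q%:C%C / y)) => // [|t].
  by rewrite cabsM cabsV cabs_real gtr0_norm// ltr_pdivrMr// mul1r.
rewrite -cabsM mulrBr mulr1; congr (cabs (_ - _)).
by rewrite circ1 /circ; field.
Qed.

End LogKernel.

(** * The means of Cartan and Jensen *)

Section Cartan.
Variable R : realType.
Local Notation C := R[i].
Local Notation mu := (@lebesgue_measure R).
Local Notation D := (`[0%R, (2 * pi)%R]%classic : set R).
Implicit Types (f g h F : C -> C) (z w u y v : C) (r t s : R) (zs : seq C).

Lemma ravg_cstB (k : R) p : rcts p -> ravg (fun t => k - p t) = k - ravg p.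
Proof.
move=> cp; have cN : rcts (fun t => -1 * p t) by apply: rctsM cp; exact: rcts_cst.
rewrite -[X in _ = _ + X]mulN1r -(ravgZ _ cp) -[in RHS](ravg_cst k) -ravgD; last exact: cN.
  by apply: eq_ravg => t; rewrite mulN1r.
exact: rcts_cst.
Qed.

Lemma rcts_cstB (k : R) p : rcts p -> rcts (fun t => k - p t).
Proof. by move=> cp t tt; apply: cvgB; [exact: cvg_cst|exact: (cp t tt)]. Qed.

Lemma rcts_measurable (p : R -> R) : rcts p -> measurable_fun D (EFin \o p).
Proof. by move=> cp; exact: (measurable_int mu (cts_integrable cp)). Qed.

Lemma cabs_sub_le2 y v : cabs y <= 1 -> cabs v <= 1 -> cabs (y - v) ^+ 2 <= 4.
Proof.
move=> y1 v1; have : cabs (y - v) <= 2.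
  by have := cabsD y (- v); rewrite cabsN => /le_trans; apply; lra.
by have := cabs_ge0 (y - v); move: (cabs _) => x; nra.
Qed.

Lemma rcts_logker_trunc n (p : R -> R) : rcts p -> rcts (fun t => logker_trunc n (p t)).
Proof.
move=> cp; apply: rcts_cstB; apply: rctsM; last exact: rcts_cst.
apply: rcts_ln; last by move=> t; exact: trunc_pos.
move=> t tt; apply: (@continuous_max _ _ p (fun=> n.+1%:R^-1) t); first exact: (cp t tt).
exact: cvg_cst.
Qed.

(** On the circle itself the truncated potential is compared with the potential at
    the nearby points (1 - e) y inside the circle. *)
Lemma ravg_trunc_le n y (q : R) : 0 < q -> q <= 1 -> cabs y = q ->
  ravg (fun t => logker_trunc n (cabs (y - circ q t) ^+ 2)) <= ln 2 - ln q.
Proof.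
move=> q0 q1 yq; rewrite -subr_le0.
apply: (@small_le0_near _ 1 _ (5 / 2 * n.+1%:R)) => [//||e e0 e1].
  by rewrite mulr_ge0// divr_ge0.
pose y' := (1 - e)%:C%C * y.
have y'q : cabs y' = (1 - e) * q by rewrite /y' cabsM cabs_real yq gtr0_norm// subr_gt0.
have y'lt : cabs y' < q by rewrite y'q; nra.
have y'neq : cabs y' != q by rewrite lt_eqF.
have [nz avg cl] := ravg_ln_circ q0 y'neq.
have mq : Num.max q (cabs y') = q by apply/max_idPl/ltW.
rewrite mq in avg.
have ccy := @rcts_circB _ y q.
have cs : rcts (fun t => cabs (y - circ q t) ^+ 2).
  by apply: rctsM; exact: rcts_cabs.
have cR : rcts (fun t => ln 2 + 5 / 2 * n.+1%:R * e - ln (cabs (y' - circ q t))).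
  exact: rcts_cstB.
rewrite lerBlDr; apply: (@le_trans _ _
  (ravg (fun t => ln 2 + 5 / 2 * n.+1%:R * e - ln (cabs (y' - circ q t))))); last first.
  by rewrite ravg_cstB// avg; lra.
apply: ravg_le => // [|t]; first exact: rcts_logker_trunc.
set s := cabs (y - circ q t) ^+ 2.
have hv : cabs (circ q t) = q by rewrite cabs_circ// ltW.
set m := Num.max s n.+1%:R^-1.
have m0 : 0 < m by exact: trunc_pos.
have d0 := cabs_ge0 (y - circ q t).
have d2 : cabs (y - circ q t) <= 2.
  by have := cabsD y (- circ q t); rewrite cabsN yq hv => /le_trans; apply; lra.
have d1 : cabs (y' - circ q t) <= cabs (y - circ q t) + e.
  have -> : y' - circ q t = (y - circ q t) + (- (e%:C%C * y)).
    by rewrite /y' rmorphB rmorph1; ring.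
  apply: (le_trans (cabsD _ _)); rewrite lerD2l cabsN cabsM cabs_real gtr0_norm// yq.
  by apply: ler_piMr => //; exact: ltW.
have s' : cabs (y' - circ q t) ^+ 2 <= m * (1 + 5 * e * n.+1%:R).
  have h1 : cabs (y' - circ q t) ^+ 2 <= s + 5 * e.
    have := cabs_ge0 (y' - circ q t); move: d1 d0 d2; rewrite /s.
    by move: (cabs (y' - _)) (cabs (y - _)) => a b *; nra.
  have h2 : s <= m by rewrite le_max lexx.
  have h3 : n.+1%:R^-1 <= m by rewrite le_max lexx orbT.
  have h4 : 1 <= m * n.+1%:R by rewrite -ler_pdivrMr ?ltr0n// mul1r.
  have h5 : 5 * e <= 5 * e * (m * n.+1%:R) by apply: ler_peMr => //; lra.
  apply: (le_trans h1); rewrite [leRHS](_ : _ = m + 5 * e * (m * n.+1%:R)); last by ring.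
  exact: lerD h2 h5.
have c0 : 0 < cabs (y' - circ q t) by rewrite cabs_gt0.
have e5 : 0 <= 5 * e * n.+1%:R by rewrite !mulr_ge0// ltW.
have : ln (cabs (y' - circ q t) ^+ 2) <= ln m + 5 * e * n.+1%:R.
  apply: (@le_trans _ _ (ln (m * (1 + 5 * e * n.+1%:R)))).
    by rewrite ler_ln ?posrE ?exprn_gt0// mulr_gt0//; lra.
  rewrite lnM ?posrE//; last lra.
  by rewrite lerD2l; apply: le_ln1Dx; lra.
rewrite lnXn// mulr2n /logker_trunc -/m.
have -> : 5 / 2 * n.+1%:R * e = (5 * e * n.+1%:R) / 2 by field.
by move: (5 * e * _) (ln m) (ln (cabs _)) (ln 2) => X a b c; lra.
Qed.

(** Only the case |y| = q remains after [ravg_ln_circ]; it follows from the truncated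
    potentials by monotone convergence. *)
Lemma cartan_le y (q : R) : 0 < q -> q <= 1 -> cabs y <= 1 ->
  (\int[mu]_(t in D) logker (cabs (y - circ q t) ^+ 2)%R
    <= (2 * pi * (ln 2 - ln (Num.max q (cabs y))))%:E)%E.
Proof.
move=> q0 q1 y1; have [yq|yq] := eqVneq (cabs y) q; last first.
  have [nz avg cl] := ravg_ln_circ q0 yq.
  have -> : (\int[mu]_(t in D) logker (cabs (y - circ q t) ^+ 2)%R =
      \int[mu]_(t in D) (ln 2 - ln (cabs (y - circ q t)))%:E)%E.
    by apply: eq_integral => t _; rewrite logker_cabs.
  by rewrite int_ravg; [rewrite ravg_cstB// avg|exact: rcts_cstB].
have mq : Num.max q (cabs y) = q by rewrite yq maxxx.
have cs : rcts (fun t => cabs (y - circ q t) ^+ 2).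
  by apply: rctsM; apply: rcts_cabs; exact: rcts_circB.
pose fn n t := (logker_trunc n (cabs (y - circ q t) ^+ 2))%:E.
have s4 t : cabs (y - circ q t) ^+ 2 <= 4.
  by apply: cabs_sub_le2 => //; rewrite cabs_circ// ltW.
have mD : measurable D by exact: measurable_itv.
have mfn n : measurable_fun D (fn n).
  exact: (rcts_measurable (rcts_logker_trunc (n := n) cs)).
have fn0 n t : D t -> (0 <= fn n t)%E.
  move=> _; rewrite /fn lee_fin /logker_trunc subr_ge0.
  have -> : ln (2 : R) = ln (2 ^+ 2) / 2 by rewrite lnXn//; field.
  apply: ler_wpM2r => //; rewrite ler_ln ?posrE ?trunc_pos// ge_max.
  have -> : 2 ^+ 2 = 4 :> R by ring.
  by rewrite s4/=; apply: (@le_trans _ _ 1); [rewrite invf_le1 ?ltr0n// ler1n|lra].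
have ndfn t : D t -> {homo fn^~ t : n m / (n <= m)%N >-> (n <= m)%E}.
  by move=> _; exact: logker_trunc_nd.
have -> : (\int[mu]_(t in D) logker (cabs (y - circ q t) ^+ 2)%R =
    \int[mu]_(t in D) limn (fn ^~ t))%E.
  by apply: eq_integral => t _; apply/esym/cvg_lim => //; exact: logker_trunc_cvg.
have cvgI := cvg_monotone_convergence (mu := mu) mD mfn fn0 ndfn.
rewrite -(cvg_lim _ cvgI)//; apply: lime_le; first exact: (cvgP _ cvgI).
apply: nearW => n; rewrite /fn int_ravg; last exact: rcts_logker_trunc.
rewrite lee_fin; apply: ler_wpM2l; first exact: pi2_ge0.
by rewrite mq; exact: ravg_trunc_le.
Qed.

(** Once the zeros of g - v are divided out, g - v is a Blaschke product, of modulus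
    at most 1, times a function k without zeros in a smaller disc. The mean of log|k|
    is at most log|k(0)|, which exceeds log|g(0) - v| by the sum over the zeros. *)
Lemma jensen_lower g v r (B : R) : analytic_on disc g ->
  (forall u, disc u -> disc (g u)) -> cabs v < cabs (g 0) -> 0 <= r -> r < 1 ->
  (forall zs h, (forall z, z \in zs -> 0 < cabs z < 1) -> analytic_on disc h ->
    (forall u, disc u -> g u - v = bnum zs u * h u) ->
    \sum_(z <- zs) - ln (cabs z) <= B) ->
  ((2 * pi * (ln 2 - ln (cabs (g 0 - v)) - B))%:E <=
    \int[mu]_(t in D) logker (cabs (g (circ r t) - v) ^+ 2)%R)%E.
Proof.
move=> dg gd vg r0 r1 HB.
have g01 : cabs (g 0) < 1 by have := gd 0 (disc0 R).
have v1 : cabs v < 1 by exact: lt_trans g01.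
pose f u := g u - v.
have df : analytic_on disc f by apply: analyticB dg _; exact: analytic_cst.
have fK u : disc u -> cabs (f u) <= 2.
  move=> /gd; rewrite discE => gu; have := cabsD (g u) (- v); rewrite cabsN => /le_trans; apply; lra.
have f0 : f 0 != 0.
  by rewrite subr_eq0; apply: contraTneq vg => ->; rewrite ltxx.
pose p := (1 + r) / 2.
have p0 : 0 < p by rewrite /p; lra.
have p1 : p < 1 by rewrite /p; lra.
have rp : r < p by rewrite /p; lra.
have [zs [h [hz dh fE hnz]]] := extract_zeros df (ltr0n _ 2) fK f0 p0 p1.
have hz1 z : z \in zs -> 0 < cabs z < 1.
  by move=> /hz /andP[-> zp]; rewrite (lt_trans zp).
have hzs : in_disc zs by move=> z /hz1 /andP[].
have sumB := HB zs h hz1 dh fE.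
pose k u := h u * bden zs u.
have dk : analytic_on disc k by apply: analyticM dh _; exact: analytic_bden.
have k2 := blaschke_div_bound (ltr0n _ 2) hzs dh fE fK.
have knz u : cabs u < p -> k u != 0.
  move=> up; rewrite mulf_neq0 ?hnz// bden_neq0// discE; exact: lt_trans p1.
have fk u : disc u -> cabs (f u) <= cabs (k u).
  move=> hu; rewrite fE// !cabsM mulrC; apply: ler_wpM2l; first exact: cabs_ge0.
  exact: blaschke_prod_le.
have dkp : analytic_on disc (fun u => k (p%:C%C * u)).
  by apply: analytic_scale => //; rewrite !ltW.
have kpnz u : disc u -> k (p%:C%C * u) != 0.
  rewrite discE => u1; apply: knz; rewrite cabsM cabs_real gtr0_norm//.
  by rewrite -[ltRHS]mulr1 ltr_pM2l.
have rp1 : r / p < 1 by rewrite ltr_pdivrMr// mul1r.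
have rp0 : 0 <= r / p by rewrite divr_ge0// ltW.
have := mean_ln_le dkp kpnz rp0 rp1; rewrite mulr0.
have pC : p%:C%C != 0 :> C by rewrite eq_complex /= negb_and gt_eqF.
rewrite (@eq_ravg _ _ (fun t => ln (cabs (k (circ r t))))); last first.
  move=> t; congr (ln (cabs (k _))); rewrite /circ mulrA; congr (_ * _).
  by rewrite -rmorphM mulrCA mulfV ?mulr1 ?gt_eqF.
have k0 : k 0 = h 0 by rewrite /k bden0 mulr1.
have := fE 0 (disc0 R); rewrite -/(f 0) => /(congr1 (fun z => cabs z)); rewrite cabsM cabs_bnum0 => f0E.
have lnE : ln (cabs (h 0)) = ln (cabs (f 0)) + \sum_(z <- zs) - ln (cabs z).
  have h0n : 0 < cabs (h 0) by rewrite cabs_gt0 hnz// cabs0.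
  have z0 z : z \in zs -> z != 0 by move=> /hz1 /andP[]; rewrite cabs_gt0.
  have P0 : 0 < \prod_(z <- zs) cabs z.
    by rewrite big_seq; apply: prodr_gt0 => z zz; rewrite cabs_gt0; exact: z0.
  by rewrite f0E lnM ?posrE// ln_prod// sumrN addrAC subrr add0r.
rewrite k0 lnE => mean.
have knzr t : k (circ r t) != 0 by apply: knz; rewrite cabs_circ.
have ck := circ_ccts r0 r1 dk.
have clk := rcts_lncabs ck knzr.
have cB := rcts_cstB (k := ln 2) clk.
apply: (@le_trans _ _ (\int[mu]_(t in D) (ln 2 - ln (cabs (k (circ r t))))%:E)%E).
  rewrite int_ravg// lee_fin; apply: ler_wpM2l; first exact: pi2_ge0.
  by rewrite ravg_cstB//; move: mean sumB; rewrite /f; lra.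
have ch t := circ_disc t r0 r1.
apply: ge0_le_integral => //.
- move=> t _; rewrite lee_fin subr_ge0 ler_ln ?posrE ?cabs_gt0//; exact: k2.
- exact: (rcts_measurable cB).
- apply: measurableT_comp; first exact: measurable_logker.
  apply/measurable_EFinP; apply: (@rcts_measurable (fun t => cabs (g (circ r t) - v) ^+ 2)).
  have cf := circ_ccts r0 r1 df.
  by apply: rctsM; exact: (rcts_cabs cf).
- move=> t _; rewrite -logker_cabs//; apply: logker_anti.
  by rewrite lerXn2r ?nnegrE ?cabs_ge0//; exact: fk.
Qed.

Lemma tonelli_square (F : R * R -> \bar R) : measurable_fun setT F -> (forall x, 0 <= F x)%E ->
  (\int[mu]_(x in D) \int[mu]_(y in D) F (x, y) = \int[mu]_(y in D) \int[mu]_(x in D) F (x, y))%E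
  /\ measurable_fun D (fun x => \int[mu]_(y in D) F (x, y))%E.
Proof.
move=> mF F0; pose G := F \_ (D `*` D).
have mD : measurable D by exact: measurable_itv.
have mG : measurable_fun setT G.
  apply/measurable_restrict => //; first exact: measurableX.
  by rewrite setTI; apply: measurable_funTS.
have G0 x : (0 <= G x)%E by rewrite /G patchE; case: ifP.
have inX (a b : R) : ((a, b) \in D `*` D) = (a \in D) && (b \in D).
  by apply/idP/andP; rewrite !inE => -[].
have E1 (a : R) : D a -> (\int[mu]_(b in D) F (a, b) = \int[mu]_b G (a, b))%E.
  move=> Da; rewrite integral_mkcond; apply: eq_integral => b _.
  by rewrite /G !patchE inX (mem_set Da).
have E2 (b : R) : D b -> (\int[mu]_(a in D) F (a, b) = \int[mu]_a G (a, b))%E.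
  move=> Db; rewrite integral_mkcond; apply: eq_integral => a _.
  by rewrite /G !patchE inX (mem_set Db) andbT.
split.
  transitivity (\int[mu]_a \int[mu]_b G (a, b))%E.
    rewrite integral_mkcond; apply: eq_integral => a _; rewrite patchE.
    case: ifPn => [|Da]; first by rewrite inE => /E1.
    by rewrite integral0_eq// => b _; rewrite /G patchE inX (negbTE Da).
  rewrite fubini_tonelli//.
  rewrite [RHS]integral_mkcond; apply: eq_integral => b _; rewrite patchE.
  case: ifPn => [|Db]; first by rewrite inE => /E2.
  by rewrite integral0_eq// => a _; rewrite /G patchE inX (negbTE Db) andbF.
have := @measurable_fun_fubini_tonelli_F _ _ _ _ _ mu G mG G0.
move=> /(measurable_funS measurableT (@subsetT _ D)) H.
apply: eq_measurable_fun H => x; rewrite inE => Dx.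
by rewrite /fubini_F E1.
Qed.

Lemma cancel_sq (P a b c d : R) : 0 < P ->
  P * (P * (d - c)) <= P * (P * (d - a)) + P * (P * b) -> a <= c + b.
Proof. by move=> P0; rewrite -!mulrDr !(ler_pM2l P0); lra. Qed.

(** Jensen's inequality for g - circ q s is averaged over s and the two averages are
    exchanged. By Cartan's formula the average over s of ln|y - circ q s| is
    ln (max q |y|); at y = g 0 this is ln|g 0|, since q < |g 0|. *)
Lemma cartan_jensen g r (q : R) (B : R -> R) : analytic_on disc g ->
  (forall u, disc u -> disc (g u)) -> 0 < q -> q < cabs (g 0) -> 0 <= r -> r < 1 ->
  rcts B -> (forall s, 0 <= B s) ->
  (forall s zs h, (forall z, z \in zs -> 0 < cabs z < 1) -> analytic_on disc h ->
    (forall u, disc u -> g u - circ q s = bnum zs u * h u) ->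
    \sum_(z <- zs) - ln (cabs z) <= B s) ->
  ravg (fun t => ln (Num.max q (cabs (g (circ r t))))) <= ln (cabs (g 0)) + ravg B.
Proof.
move=> dg gd q0 qg r0 r1 cB B0 HB.
have g01 : cabs (g 0) < 1 by have := gd 0 (disc0 R).
have q1 : q < 1 by exact: lt_trans g01.
have mD : measurable D by exact: measurable_itv.
pose F (x : R * R) := logker (cabs (g (circ r x.2) - circ q x.1) ^+ 2).
have cq t : cabs (circ q t) = q by rewrite cabs_circ// ltW.
have F0 x : (0 <= F x)%E.
  apply: logker_ge0; apply: cabs_sub_le2; last by rewrite cq ltW.
  by apply: ltW; apply: gd; exact: circ_disc.
have cg : continuous ((fun t => g (circ r t)) : R -> C^o).
  move=> t; apply: (@continuous_comp _ _ _ (circ r : R -> C^o) (g : C^o -> C^o) t).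
    exact: circ_continuous.
  by apply: (analytic_cts dg); exact: circ_disc.
have mc (c : R -> C) : continuous (c : R -> C^o) ->
    measurable_fun setT (fun t => complex.Re (c t)) /\ measurable_fun setT (fun t => complex.Im (c t)).
  move=> cc; split; apply: continuous_measurable_fun => t.
    by apply: (@continuous_comp _ _ _ (c : R -> C^o) (@complex.Re R) t);
      [exact: cc|exact: continuous_Re].
  by apply: (@continuous_comp _ _ _ (c : R -> C^o) (@complex.Im R) t);
      [exact: cc|exact: continuous_Im].
have [mg1 mg2] := mc _ cg.
have [mq1 mq2] := mc _ (@circ_continuous R q).
have mF : measurable_fun setT F.
  apply: measurableT_comp; first exact: measurable_logker.
  rewrite (_ : (fun _ => _) = (fun x : R * R =>
     (complex.Re (g (circ r x.2)) - complex.Re (circ q x.1)) ^+ 2 +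
     (complex.Im (g (circ r x.2)) - complex.Im (circ q x.1)) ^+ 2)); last first.
    by apply/funext => x; rewrite sqr_cabs cReB cImB.
  have c2 (k : R -> R) : measurable_fun setT k -> measurable_fun setT (fun x : R * R => k x.2).
    by move=> mk; apply: (measurableT_comp mk); exact: measurable_snd.
  have c1 (k : R -> R) : measurable_fun setT k -> measurable_fun setT (fun x : R * R => k x.1).
    by move=> mk; apply: (measurableT_comp mk); exact: measurable_fst.
  apply: measurable_funD; apply: measurable_funX; apply: measurable_funB.
  - exact: c2 mg1.
  - exact: c1 mq1.
  - exact: c2 mg2.
  - exact: c1 mq2.
have [ton mInt] := tonelli_square mF F0.
have g0q : cabs (g 0) != q by rewrite gt_eqF.
have [nz avg cl] := ravg_ln_circ q0 g0q.
have mq : Num.max q (cabs (g 0)) = cabs (g 0) by apply/max_idPr/ltW.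
rewrite mq in avg.
have c2B : rcts (fun s => 2 * pi * B s) by apply: rctsM cB; exact: rcts_cst.
have c2l : rcts (fun s => 2 * pi * (ln 2 - ln (cabs (g 0 - circ q s)))).
  by apply: rctsM; [exact: rcts_cst|exact: rcts_cstB].
have p2 := pi2_ge0 R.
have IF0 s : D s -> (0 <= \int[mu]_(t in D) F (s, t))%E.
  by move=> _; apply: integral_ge0 => t _; exact: F0.
have B20 s : D s -> (0 <= (2 * pi * B s)%:E)%E.
  by move=> _; rewrite lee_fin; apply: mulr_ge0.
have lo : ((2 * pi * (2 * pi * (ln 2 - ln (cabs (g 0)))))%:E <=
    \int[mu]_(s in D) \int[mu]_(t in D) F (s, t) + (2 * pi * (2 * pi * ravg B))%:E)%E.
  have -> : ((2 * pi * (2 * pi * ravg B))%:E = \int[mu]_(s in D) (2 * pi * B s)%:E)%E.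
    by rewrite (int_ravg c2B) (ravgZ _ cB).
  rewrite -(ge0_integralD mu mD IF0 mInt B20 (rcts_measurable c2B)).
  have -> : ((2 * pi * (2 * pi * (ln 2 - ln (cabs (g 0)))))%:E =
     \int[mu]_(s in D) (2 * pi * (ln 2 - ln (cabs (g 0 - circ q s))))%:E)%E.
    by rewrite (int_ravg c2l) (ravgZ _ (rcts_cstB (k := ln 2) cl)) (ravg_cstB _ cl) avg.
  apply: (ge0_le_integral mu mD).
  - move=> s _; rewrite lee_fin; apply: mulr_ge0; first exact: p2.
    rewrite subr_ge0 ler_ln ?posrE ?cabs_gt0; [|exact: nz|lra].
    have := cabsD (g 0) (- circ q s); rewrite cabsN cq => /le_trans; apply; lra.
  - exact: (rcts_measurable c2l).
  - by apply: (emeasurable_funD mInt); exact: (rcts_measurable c2B).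
  - move=> s _; have vs : cabs (circ q s) < cabs (g 0) by rewrite cq.
    have := jensen_lower dg gd vs r0 r1 (HB s).
    rewrite (_ : 2 * pi * (ln 2 - ln (cabs (g 0 - circ q s)) - B s) =
      2 * pi * (ln 2 - ln (cabs (g 0 - circ q s))) - 2 * pi * B s); last by ring.
    by rewrite EFinB leeBlDr.
have cm : rcts (fun t => Num.max q (cabs (g (circ r t)))).
  have cgc := rcts_cabs (circ_ccts r0 r1 dg).
  move=> t tt; apply: (@continuous_max _ _ (fun=> q) (fun t => cabs (g (circ r t))) t).
    exact: cvg_cst.
  exact: (cgc t tt).
have m0 t : 0 < Num.max q (cabs (g (circ r t))) by rewrite lt_max q0.
have clm := rcts_ln cm m0.
have c2m : rcts (fun t => 2 * pi * (ln 2 - ln (Num.max q (cabs (g (circ r t)))))).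
  by apply: rctsM; [exact: rcts_cst|exact: rcts_cstB].
have hi : (\int[mu]_(t in D) \int[mu]_(s in D) F (s, t) <=
    (2 * pi * (2 * pi * (ln 2 - ravg (fun t => ln (Num.max q (cabs (g (circ r t))))))))%:E)%E.
  have -> : ((2 * pi * (2 * pi * (ln 2 - ravg (fun t => ln (Num.max q (cabs (g (circ r t))))))))%:E =
     \int[mu]_(t in D) (2 * pi * (ln 2 - ln (Num.max q (cabs (g (circ r t))))))%:E)%E.
    by rewrite (int_ravg c2m) (ravgZ _ (rcts_cstB (k := ln 2) clm)) (ravg_cstB _ clm).
  have mF' : measurable_fun setT (fun x : R * R => F (x.2, x.1)).
    apply: (measurableT_comp mF); apply: measurable_fun_pair; [exact: measurable_snd|exact: measurable_fst].
  have [_ mInt'] := tonelli_square mF' (fun x => F0 (x.2, x.1)).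
  apply: (ge0_le_integral mu mD).
  - by move=> t _; apply: integral_ge0 => s _; exact: F0.
  - exact: mInt'.
  - exact: (rcts_measurable c2m).
  - move=> t _; have h1 : cabs (g (circ r t)) <= 1.
      by apply/ltW/gd; exact: circ_disc.
    exact: (cartan_le q0 (ltW q1) h1).
rewrite ton in lo; have := le_trans lo (leeD2r _ hi).
rewrite -EFinD lee_fin; exact: cancel_sq (pi2_gt0 R).
Qed.

End Cartan.

(** * Differentiability of Lipschitz functions *)

Section Lipschitz.
Variable R : realType.
Local Notation mu := (@lebesgue_measure R).

Lemma lipschitz_continuous (f : R -> R) (K : R) :
  (forall x y, `|f x - f y| <= K * `|x - y|) -> continuous f.
Proof.
move=> H x; apply/cvgrPdist_lt => e e0.
have K1 : 0 < `|K| + 1 by rewrite ltr_wpDl.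
have d0 : 0 < e / (`|K| + 1) by rewrite divr_gt0.
near=> y; apply: (le_lt_trans (H x y)).
apply: (@le_lt_trans _ _ ((`|K| + 1) * `|x - y|)).
  by apply: ler_wpM2r => //; have := ler_norm K; lra.
rewrite mulrC -ltr_pdivlMr//; near: y.
Unshelve. all: by end_near. Qed.

Definition lipschitz_with (K : R) (f : R -> R) := forall x y, `|f x - f y| <= K * `|x - y|.

(** Adding a linear function makes a Lipschitz function nondecreasing; the proof is
    an argument because the cumulative structure declared below depends on it. *)
Definition lip_cumul K f (_ : lipschitz_with K f) (x : R) : R := f x + K * x.

Section Cumul.
Variables (f : R -> R) (K : R) (fK : lipschitz_with K f).

Lemma lip_cumul_nd : nondecreasing (lip_cumul fK).
Proof.
move=> x y xy; have := fK x y; rewrite distrC [in X in _ <= X]distrC.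
rewrite (ger0_norm (_ : 0 <= y - x)) ?subr_ge0// => /ler_normlP[? _].
by rewrite /lip_cumul; lra.
Qed.

Lemma lip_cumul_cont : continuous (lip_cumul fK).
Proof.
move=> x; apply: cvgD; first exact: (lipschitz_continuous fK).
by apply: cvgM; [exact: cvg_cst|exact: cvg_id].
Qed.

HB.instance Definition _ := isCumulative.Build R _ R (lip_cumul fK) lip_cumul_nd
  (right_continuousW lip_cumul_cont).

End Cumul.

Lemma stieltjes_itv (c : cumulative R R) (a b : R) : a <= b ->
  lebesgue_stieltjes_measure c `]a, b]%classic = (c b - c a)%:E.
Proof.
move=> ab; rewrite /lebesgue_stieltjes_measure /measure_extension measurable_mu_extE/=; last exact: is_ocitv.
by rewrite wlength_itv_bnd.
Qed.

(** The Lebesgue-Stieltjes measures of f + K x and -f + K x add up to a multiple of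
    Lebesgue measure, so that the first one has a density; its integrals are
    differentiable almost everywhere by the Lebesgue differentiation theorem. *)
Lemma lipschitz_ae_derivable (f : R -> R) (K a b : R) : 0 < K -> a < b ->
  lipschitz_with K f -> {ae mu, forall x, a < x < b -> derivable f x 1}.
Proof.
move=> K0 ab fK.
have gK : lipschitz_with K (fun x => - f x) by move=> x y; rewrite -opprD normrN; exact: fK.
pose c1 : cumulative R R := lip_cumul fK.
pose c2 : cumulative R R := lip_cumul gK.
pose m1 : {measure set (measurableTypeR R) -> \bar R} := lebesgue_stieltjes_measure c1.
pose m2 : {measure set (measurableTypeR R) -> \bar R} := lebesgue_stieltjes_measure c2.
have m1E x y : x <= y -> m1 `]x, y]%classic = (c1 y - c1 x)%:E by exact: stieltjes_itv.
have m2E x y : x <= y -> m2 `]x, y]%classic = (c2 y - c2 x)%:E by exact: stieltjes_itv.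
have k0 : 0 <= (2 * K)^-1 by rewrite invr_ge0 mulr_ge0// ltW.
pose m := mscale (NngNum k0) (measure_add m1 m2).
have mE' X : m X = (((2 * K)^-1)%:E * (m1 X + m2 X))%E.
  by rewrite /m /mscale; congr (_ * _)%E; exact: measure_addE.
have mE X : measurable X -> mu X = m X.
  apply: lebesgue_measure_unique => Y [[x y] _ <-] /=.
  apply: etrans (esym (mE' _)); have [xy|yx] := leP x y; last first.
    have -> : [set` Interval (BRight (x, y).1) (BRight (x, y).2)] = set0 :> set R.
      by apply: set_itv_ge; rewrite bnd_simp /= -leNgt ltW.
    have m10 : m1 set0 = 0%E by exact: measure0.
    have m20 : m2 set0 = 0%E by exact: measure0.
    by rewrite m10 m20 adde0 mule0 measure0.
  rewrite m1E// m2E// -EFinD -EFinM.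
  have -> : (2 * K)^-1 * (c1 y - c1 x + (c2 y - c2 x)) = y - x.
    by rewrite /= /lip_cumul; field; rewrite gt_eqF.
  rewrite lebesgue_measure_itv/= lte_fin; case: ltP => // yx.
  have -> : y = x by apply/eqP; rewrite eq_le xy yx.
  by rewrite subrr.
have dom : m1 `<< mu.
  apply/null_content_dominatesP => A mA muA.
  have := etrans (esym (etrans (mE A mA) (mE' A))) muA => /eqP.
  rewrite mule_eq0 eqe invr_eq0 gt_eqF ?mulr_gt0//= padde_eq0; last 2 first.
  - exact: measure_ge0.
  - exact: measure_ge0.
  by move=> /andP[/eqP-> _].
have mI : measurable (`]a, b]%classic : set (measurableTypeR R)) by exact: measurable_itv.
have fI : (m1 `]a, b]%classic < +oo)%E by rewrite m1E ?ltry// ltW.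
pose nu : {finite_measure set (measurableTypeR R) -> \bar R} := mfrestr mI fI.
have nudom : nu `<< mu.
  apply/null_content_dominatesP => A mA muA; rewrite /nu /= /mfrestr /mrestr.
  apply/eqP; rewrite eq_le measure_ge0 andbT.
  have : m1 A = 0 by have /null_content_dominatesP := dom; apply.
  by move=> <-; apply: le_measure; rewrite ?inE//; exact: measurableI.
have [g [g0 gfin gint gE]] := radon_nikodym_sigma_finite nudom.
pose h := fine \o g.
have hE : g = EFin \o h by apply/funext => x; rewrite /h /= fineK.
have hint : mu.-integrable setT (EFin \o h) by rewrite -hE.
have hloc : locally_integrable setT h.
  have := integrable_locally measurableT hint; rewrite (_ : h \_ setT = h)//.
  by apply/funext => x; rewrite patchE mem_set.
have hintS y : mu.-integrable [set` Interval (BRight a) (BRight y)] (EFin \o h).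
  by apply: (integrableS _ _ _ hint) => //; exact: measurable_itv.
have := FTC1 hintS hloc.
apply: filterS; first exact: (ae_filter_ringOfSetsType mu).
move=> x Hx /andP[ax xb]; have [dF _] := Hx (ax : (BRight a < BRight x)%O).
pose F y := \int[mu]_(t in `]a, y]) h t.
have FE y : a < y < b -> c1 y = c1 a + F y.
  move=> /andP[ay yb]; apply/eqP; rewrite addrC -subr_eq; apply/eqP.
  have -> : F y = fine (m1 `]a, y]%classic).
    rewrite /F /Rintegral; congr fine.
    have -> : m1 `]a, y]%classic = nu `]a, y]%classic.
      rewrite /nu /= /mfrestr /mrestr setIidl//.
      by apply: subset_itvl; rewrite bnd_simp ltW.
    by rewrite gE// hE.
  by rewrite m1E// ltW.
have dF1 : derivable (fun y => c1 a + F y - K * y) x 1.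
  apply: derivableB; first by apply: derivableD; [exact: derivable_cst|exact: dF].
  by apply: derivableM; [exact: derivable_cst|exact: derivable_id].
apply: near_eq_derivable dF1; near=> y.
have yab : a < y < b.
  by near: y; apply: near_in_itvoo; rewrite in_itv/= ax xb.
by rewrite -FE// /c1 /= /lip_cumul addrK.
Unshelve. all: by end_near. Qed.

End Lipschitz.

(** * Fatou's theorem at a point *)

Section Fatou.
Variable R : realType.
Local Notation C := R[i].
Local Notation mu := (@lebesgue_measure R).
Implicit Types (z w u v : C) (r s t : R).

(** The function q r + r is nondecreasing and bounded, and its supremum minus 1 is
    the limit of q at 1. *)
Lemma lipschitz_limit (q : R -> R) :
  (forall r s, 0 <= r < 1 -> 0 <= s < 1 -> `|q r - q s| <= `|r - s|) ->
  exists l, forall r, 0 <= r < 1 -> `|l - q r| <= 1 - r.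
Proof.
move=> Hq; pose S := [set q r + r | r in [set r | 0 <= r < 1]].
have ubr r : 0 <= r < 1 -> ubound S (q r - r + 2).
  move=> r01 _ [s s01 <-]; have := Hq r s r01 s01; move/andP: r01 => [r0 r1].
  move/andP: s01 => [s0 s1].
  have [sr|/ltW sr] := leP s r.
    by rewrite (ger0_norm (_ : 0 <= r - s)) ?subr_ge0// => /ler_normlP[]; lra.
  by rewrite distrC (distrC r) (ger0_norm (_ : 0 <= s - r)) ?subr_ge0// => /ler_normlP[]; lra.
have r00 : 0 <= (0 : R) < 1 by rewrite lexx ltr01.
have hs : has_sup S.
  by split; [exists (q 0 + 0); exists 0|exists (q 0 - 0 + 2); exact: ubr].
exists (sup S - 1) => r r01.
have h1 : q r + r <= sup S by apply: ub_le_sup; [exact: hs.2|exists r].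
have h2 : sup S <= q r - r + 2 by apply: ge_sup; [exact: hs.1|exact: ubr].
by rewrite ler_norml; apply/andP; split; lra.
Qed.

Lemma expi_lipschitz s t : cabs (expi s - expi t) <= `|s - t|.
Proof.
wlog st : s t / t <= s.
  move=> H; have [st|st] := leP t s; first exact: H.
  by rewrite cabsC distrC; apply: H; exact: ltW.
have cc : ccts t s (fun x => 'i%C * circ 1 x).
  by apply: cctsM; [exact: ccts_cst|move=> x _; exact: circ_continuous].
have := cint_FTC st cc (fun x _ => circ_path_derive 1 x); rewrite !circ1 => <-.
apply: le_trans (cabs_cint_bound (M := 1) st cc _) _.
  move=> x _; rewrite cabsM cabs_circ ?ler01// mulr1 cabsE /= expr0n add0r expr1n sqrtr1.
  exact: lexx.
by rewrite mul1r ger0_norm// subr_ge0.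
Qed.

Lemma cRe_realM r z : complex.Re (r%:C%C * z) = r * complex.Re z.
Proof. by case: z => x y /=; rewrite mul0r subr0. Qed.

Lemma circ_sub r s t : circ r t - circ s t = (r - s)%:C%C * expi t.
Proof. by rewrite /circ rmorphB mulrBl. Qed.

Lemma cabs_circ_sub r s t : cabs (circ r t - circ s t) = `|r - s|.
Proof. by rewrite circ_sub cabsM cabs_expi mulr1 cabs_real. Qed.

Variable psi : C -> C.
Hypothesis dpsi : analytic_on disc psi.
Hypothesis psid : forall z, disc z -> disc (psi z).

(** As |psi| < 1, a primitive of psi is 1-Lipschitz and extends to the circle, where
    it is 1-Lipschitz as well. *)
Lemma primitive_boundary : exists F (Fb : R -> C),
  [/\ analytic_on disc F, forall z, disc z -> cderive F z = psi z,
      forall t r, 0 <= r < 1 -> cabs (Fb t - F (circ r t)) <= 2 * (1 - r)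
    & forall t s, cabs (Fb t - Fb s) <= cabs (expi t - expi s)].
Proof.
have [F HF] := star_primitive (disc0 R) (analytic_cts dpsi) (fun z hz _ => dpsi hz).
have dF : analytic_on disc F by move=> z /HF[].
have lipF u v : disc u -> disc v -> cabs (F u - F v) <= cabs (u - v).
  move=> hu hv.
  have sc : segcts psi v u.
    by move=> s s01; apply: (analytic_cts dpsi); exact: seg_disc.
  have := segint_FTC sc (fun s s01 => HF _ (seg_disc hv hu s01)) => <-.
  rewrite -[leRHS]mul1r; apply: (segint_bound sc) => s s01.
  by apply/ltW/psid; exact: seg_disc.
have cd t r : 0 <= r < 1 -> disc (circ r t) by move=> /andP[r0 r1]; exact: circ_disc.
have lipr t r s : 0 <= r < 1 -> 0 <= s < 1 -> cabs (F (circ r t) - F (circ s t)) <= `|r - s|.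
  by move=> hr hs; rewrite -(cabs_circ_sub r s t); apply: lipF; exact: cd.
have ex t : exists w, forall r, 0 <= r < 1 -> cabs (w - F (circ r t)) <= 2 * (1 - r).
  have [a Ha] := @lipschitz_limit (fun r => complex.Re (F (circ r t)))
    (fun r s hr hs => le_trans (eq_ind _ (fun x => `|x| <= _) (cabs_Re _) _ (cReB _ _)) (lipr t r s hr hs)).
  have [b Hb] := @lipschitz_limit (fun r => complex.Im (F (circ r t)))
    (fun r s hr hs => le_trans (eq_ind _ (fun x => `|x| <= _) (cabs_Im _) _ (cImB _ _)) (lipr t r s hr hs)).
  exists (Complex a b) => r hr; apply: (le_trans (cabs_ReIm _)).
  rewrite cReB cImB /= mulr_natl mulr2n; exact: lerD (Ha r hr) (Hb r hr).
have [Fb HFb] := choice ex.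
exists F, Fb; split=> //; first by move=> z /HF[].
move=> t s; rewrite -subr_le0; apply: (@small_le0_near _ 1 _ 4) => // e e0 e1.
have hr : 0 <= 1 - e < 1 by apply/andP; split; lra.
have h1 := HFb t _ hr; have h2 := HFb s _ hr.
have h3 : cabs (F (circ (1 - e) t) - F (circ (1 - e) s)) <= cabs (expi t - expi s).
  apply: le_trans (lipF _ _ (cd _ _ hr) (cd _ _ hr)) _.
  rewrite /circ -mulrBr cabsM cabs_real; apply: ler_piMl; first exact: cabs_ge0.
  by rewrite ger0_norm; lra.
have h4 := cabsB_le (Fb t) (Fb s) (F (circ (1 - e) t)).
have h5 := cabsB_le (F (circ (1 - e) t)) (Fb s) (F (circ (1 - e) s)).
rewrite (cabsC (F (circ (1 - e) s)) (Fb s)) in h5.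
rewrite (_ : 1 - (1 - e) = e) in h1 h2; last by ring.
lra.
Qed.

Section Point.
Variables (F : C -> C) (Fb : R -> C) (t0 : R) (d : C).
Hypotheses (dF : analytic_on disc F) (F' : forall z, disc z -> cderive F z = psi z).
Hypothesis Fbr : forall t r, 0 <= r < 1 -> cabs (Fb t - F (circ r t)) <= 2 * (1 - r).
Hypothesis Fbl : forall t s, cabs (Fb t - Fb s) <= cabs (expi t - expi s).
Hypothesis Fbd : path_derive Fb t0 d.

Let zeta := expi t0.
Let A : C := d / ('i%C * zeta).
Let M := 1 + cabs A.
(* H is the error of the first-order expansion of F at zeta. *)
Let H (z : C) : C := F z - Fb t0 - A * (z - zeta).
Let Hb (t : R) : C := Fb t - Fb t0 - A * (expi t - zeta).

Let zeta1 : cabs zeta = 1. Proof. exact: cabs_expi. Qed.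
Let iz0 : 'i%C * zeta != 0.
Proof.
by rewrite -cabs_eq0 cabsM zeta1 mulr1 cabsE /= expr0n add0r expr1n sqrtr1 oner_eq0.
Qed.

Lemma path_derive_expand c (t1 : R) (k : C) : path_derive c t1 k -> forall e : R, 0 < e ->
  exists2 x : R, 0 < x & forall t, `|t - t1| < x ->
    cabs (c t - c t1 - k * (t - t1)%:C%C) <= e * `|t - t1|.
Proof.
move=> /path_deriveP /(@ccvgP _ _ (dnbhs (0 : R))) H1 e e0.
have /nbhs_ballP[x /= x0 Hx] := H1 e e0.
exists x => // t tx.
have [->|tt] := eqVneq t t1; first by rewrite !subrr mulr0 subrr cabs0 normr0 mulr0.
have h0 : t - t1 != 0 by rewrite subr_eq0.
have hC : (t - t1)%:C%C != 0 :> C by rewrite eq_complex /= negb_and h0.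
have : cabs (((t - t1)^-1)%:C%C * (c (t - t1 + t1) - c t1) - k) < e.
  by apply: Hx => //; rewrite /ball /= sub0r normrN.
rewrite subrK fmorphV => hh.
have -> : c t - c t1 - k * (t - t1)%:C%C =
    ((t - t1)%:C%C^-1 * (c t - c t1) - k) * (t - t1)%:C%C.
  by rewrite mulrBl mulrAC mulVf// mul1r.
by rewrite cabsM cabs_real; apply: ler_wpM2r => //; exact: ltW.
Qed.

Lemma chord_near (e : R) : 0 < e -> exists2 x : R, 0 < x &
  forall t, `|t - t0| < x -> cabs (Hb t) <= e * cabs (expi t - zeta).
Proof.
move=> e0.
have M0 : 0 < M by rewrite /M ltr_pwDl// cabs_ge0.
pose e' := Num.min (1 / 2) (e / (2 * M)).
have e'0 : 0 < e' by rewrite lt_min !divr_gt0// mulr_gt0.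
have [x1 x10 H1] := path_derive_expand Fbd e'0.
have [x2 x20 H2] := path_derive_expand (circ_path_derive 1 t0) e'0.
exists (Num.min x1 x2); first by rewrite lt_min x10.
move=> t; rewrite lt_min => /andP[/H1 h1 /H2].
rewrite !circ1 -/zeta => h2.
have e'1 : e' <= 1 / 2 by rewrite ge_min lexx.
have e'2 : e' * (2 * M) <= e by rewrite -ler_pdivlMr ?mulr_gt0// ge_min lexx orbT.
have izn : cabs ('i%C * zeta) = 1.
  by rewrite cabsM zeta1 mulr1 cabsE /= expr0n add0r expr1n sqrtr1.
have h3 : `|t - t0| <= 2 * cabs (expi t - zeta).
  have := cabsB_ge ('i%C * zeta * (t - t0)%:C%C) ('i%C * zeta * (t - t0)%:C%C - (expi t - zeta)).
  rewrite subKr (cabsC (_ * _) (expi t - zeta)) cabsM izn mul1r cabs_real.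
  have h0 := normr_ge0 (t - t0).
  have h4 : e' * `|t - t0| <= 1 / 2 * `|t - t0| by exact: ler_wpM2r.
  by move=> h5; lra.
have dA : d = A * ('i%C * zeta) by rewrite /A (mulfVK iz0).
have -> : Hb t = (Fb t - Fb t0 - d * (t - t0)%:C%C) + - (A * (expi t - zeta - 'i%C * zeta * (t - t0)%:C%C)).
  by rewrite /Hb {1}dA; ring.
apply: (le_trans (cabsD _ _)); rewrite cabsN cabsM.
have h4 : cabs A * cabs (expi t - zeta - 'i%C * zeta * (t - t0)%:C%C) <= cabs A * (e' * `|t - t0|).
  by apply: ler_wpM2l => //; exact: cabs_ge0.
apply: (@le_trans _ _ (e' * M * `|t - t0|)).
  by rewrite /M; move: h1 h4; move: (cabs _) (cabs A) (cabs _) => a b c; lra.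
apply: (@le_trans _ _ (e' * M * (2 * cabs (expi t - zeta)))).
  by apply: ler_wpM2l => //; rewrite mulr_ge0// ltW.
rewrite [leLHS](_ : _ = e' * (2 * M) * cabs (expi t - zeta)); last by ring.
by apply: ler_wpM2r => //; exact: cabs_ge0.
Qed.

Lemma chord_all t : cabs (Hb t) <= M * cabs (expi t - zeta).
Proof.
apply: (le_trans (cabsD _ _)); rewrite cabsN cabsM /M mulrDl mul1r.
by apply: lerD => //; exact: Fbl.
Qed.

Lemma chord_sqr t : complex.Re (1 - conjc zeta * expi t) = cabs (expi t - zeta) ^+ 2 / 2.
Proof.
have a1 := cos2Dsin2 t; have a2 := cos2Dsin2 t0.
rewrite sqr_cabs /zeta /expi /=; lra.
Qed.

Lemma chord_far (x : R) : 0 < x -> exists2 y : R, 0 < y & forall t,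
  t0 - pi <= t <= t0 - pi + 2 * pi -> x <= `|t - t0| -> y <= cabs (expi t - zeta) ^+ 2.
Proof.
move=> x0; pose x' := Num.min x pi.
have pi0 := pi_gt0 R.
have x'0 : 0 < x' by rewrite lt_min x0.
have x'p : x' <= pi by rewrite ge_min lexx orbT.
exists (2 * (1 - cos x')).
  rewrite mulr_gt0// subr_gt0 -(@cos0 R) ltr_cos// in_itv/= ?lexx ?(ltW pi0) ?(ltW x'0) ?x'p//.
move=> t /andP[h1 h2] xt.
have -> : cabs (expi t - zeta) ^+ 2 = 2 * (1 - cos `|t - t0|).
  have -> : cos `|t - t0| = cos (t - t0) by case: (ger0P (t - t0)) => // _; rewrite cosN.
  rewrite cosB sqr_cabs /zeta /expi /=.
  have a1 := cos2Dsin2 t; have a2 := cos2Dsin2 t0; lra.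
rewrite ler_pM2l// lerD2l lerN2.
have tp : `|t - t0| <= pi by rewrite ler_norml; apply/andP; split; lra.
have x't : x' <= `|t - t0| by apply: le_trans xt; rewrite ge_min lexx.
move: x't; rewrite le_eqVlt => /predU1P[->//|x't]; apply/ltW.
by rewrite ltr_cos// in_itv/= ?tp ?x'p ?(ltW x'0) ?normr_ge0.
Qed.

(** A boundary estimate |H| <= |q| |z - zeta| extends inside by the maximum
    principle for H / (q (z - w)), where the zero of z - zeta is first moved to
    w = (1 + tau) zeta outside the disc. The factor q = e (1 + k (1 - conjc zeta z))
    is close to e at zeta, has no zero in the disc, and is large away from zeta when
    k is. *)
Lemma inner_bound (e k : R) : 0 < e -> 0 <= k ->
  (forall t, t0 - pi <= t <= t0 - pi + 2 * pi ->
     cabs (Hb t) <= cabs (e%:C%C * (1 + k%:C%C * (1 - conjc zeta * expi t))) * cabs (expi t - zeta)) ->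
  forall z, disc z -> cabs (H z) <= cabs (e%:C%C * (1 + k%:C%C * (1 - conjc zeta * z))) * cabs (z - zeta).
Proof.
move=> e0 k0 Hbd z hz.
pose q (u : C) : C := e%:C%C * (1 + k%:C%C * (1 - conjc zeta * u)).
rewrite -/(q z).
have q_ge u : cabs u <= 1 -> e <= cabs (q u).
  move=> u1; rewrite /q cabsM cabs_real gtr0_norm// -[leLHS]mulr1; apply: ler_wpM2l; first exact: ltW.
  apply: le_trans (cabs_Re _); apply: le_trans (ler_norm _).
  rewrite cReD cRe_realM cReB lerDl mulr_ge0// subr_ge0.
  apply: (le_trans (ler_norm _)); apply: (le_trans (cabs_Re _)).
  by rewrite cabsM cabs_conj zeta1 mul1r.
have q_le u : cabs u <= 1 -> cabs (q u) <= e * (1 + 2 * k).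
  move=> u1; rewrite /q cabsM cabs_real gtr0_norm//; apply: ler_wpM2l; first exact: ltW.
  apply: (le_trans (cabsD _ _)); rewrite cabs1 lerD2l cabsM cabs_real ger0_norm// mulrC.
  apply: ler_wpM2r => //; have := cabsD 1 (- (conjc zeta * u)).
  by rewrite cabs1 cabsN cabsM cabs_conj zeta1 mul1r => /le_trans; apply; lra.
have q_lip u v : cabs (q u - q v) <= e * k * cabs (u - v).
  have -> : q u - q v = - (e%:C%C * k%:C%C * (conjc zeta * (u - v))) by rewrite /q; ring.
  by rewrite cabsN !cabsM cabs_conj zeta1 mul1r !cabs_real gtr0_norm// ger0_norm.
have Kq : 0 <= cabs (q z) by exact: cabs_ge0.
suff Ht (tau : R) : 0 < tau -> tau < 1 -> cabs (H z) <= cabs (q z) * cabs (z - (1 + tau)%:C%C * zeta).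
  rewrite -subr_le0; apply: (@small_le0_near _ 1 _ (cabs (q z))) => // tau tau0 tau1.
  have h1 := Ht _ tau0 tau1.
  have h2 : cabs (z - (1 + tau)%:C%C * zeta) <= cabs (z - zeta) + tau.
    have -> : z - (1 + tau)%:C%C * zeta = (z - zeta) - tau%:C%C * zeta by rewrite rmorphD rmorph1; ring.
    apply: (le_trans (cabsD _ _)); rewrite cabsN cabsM zeta1 mulr1 cabs_real gtr0_norm//; exact: lexx.
  have h3 := ler_wpM2l Kq h2.
  by move: h1 h3; rewrite mulrDr; lra.
move=> tau0 tau1.
pose w := (1 + tau)%:C%C * zeta.
have cw : cabs w = 1 + tau by rewrite /w cabsM zeta1 mulr1 cabs_real ger0_norm; lra.
have w_ge u : cabs u <= 1 -> tau <= cabs (u - w).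
  by move=> u1; have := cabsB_ge w u; rewrite cw cabsC; lra.
have w_le u : cabs u <= 1 -> cabs (u - w) <= 3.
  by move=> u1; have := cabsD u (- w); rewrite cabsN cw; lra.
have w_chord t : cabs (expi t - zeta) <= cabs (expi t - w).
  rewrite -(@ler_pXn2r _ 2)// ?nnegrE ?cabs_ge0// !sqr_cabs /w /zeta /expi /=.
  have a1 := cos2Dsin2 t; have a2 := cos2Dsin2 t0.
  have a3 : cos t * cos t0 + sin t * sin t0 <= 1 by rewrite -cosB cos_le1.
  rewrite !mul0r subr0 addr0.
  have -> : (cos t - (1 + tau) * cos t0) ^+ 2 + (sin t - (1 + tau) * sin t0) ^+ 2 =
    (cos t - cos t0) ^+ 2 + (sin t - sin t0) ^+ 2 + tau * (2 * (1 - (cos t * cos t0 + sin t * sin t0)))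
     + tau ^+ 2 * (cos t0 ^+ 2 + sin t0 ^+ 2) + 2 * tau * (cos t0 ^+ 2 + sin t0 ^+ 2 - 1).
    ring.
  rewrite a2 subrr mulr0 addr0 mulr1 -addrA lerDl addr_ge0 ?sqr_ge0//.
  by rewrite mulr_ge0 ?(ltW tau0)// mulr_ge0// subr_ge0.
pose E u := H u / (q u * (u - w)).
have nz u : disc u -> q u * (u - w) != 0.
  move=> /ltW u1; rewrite mulf_neq0// -cabs_gt0.
    exact: lt_le_trans (q_ge _ u1).
  exact: lt_le_trans (w_ge _ u1).
have dq : analytic_on disc q.
  apply: analyticM; first exact: analytic_cst.
  apply: analyticD; first exact: analytic_cst.
  apply: analyticM; first exact: analytic_cst.
  apply: analyticB; first exact: analytic_cst.
  by apply: analyticM; [exact: analytic_cst|exact: analytic_id].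
have dE : analytic_on disc E.
  apply: analyticM.
    apply: analyticB; first by apply: analyticB; [exact: dF|exact: analytic_cst].
    apply: analyticM; first exact: analytic_cst.
    by apply: analyticB; [exact: analytic_id|exact: analytic_cst].
  apply: analyticV; last exact: nz.
  by apply: analyticM; [exact: dq|apply: analyticB; [exact: analytic_id|exact: analytic_cst]].
suff E1 : cabs (E z) <= 1.
  move: E1; rewrite /E cabsM cabsV ler_pdivrMr ?cabs_gt0 ?nz// mul1r cabsM; exact.
apply/ler_addgt0Pr => eta eta0.
pose c1 := 2 + cabs A; pose c2 := e * k; pose Q := e * (1 + 2 * k).
pose B := c1 + (1 + eta) * (Q + c2 * 3).
have c10 : 0 < c1 by rewrite /c1 ltr_pwDl// cabs_ge0.
have c20 : 0 <= c2 by rewrite mulr_ge0// ltW.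
have Q0 : 0 <= Q by rewrite mulr_ge0 ?(ltW e0)// addr_ge0// mulr_ge0.
have B0 : 0 < B.
  rewrite /B ltr_pwDl// mulr_ge0//; first by lra.
  by rewrite addr_ge0// mulr_ge0.
pose x0 := Num.min (1 - cabs z) (eta * (e * tau) / B).
have x00 : 0 < x0.
  rewrite lt_min subr_gt0 hz divr_gt0// !mulr_gt0//.
pose x := x0 / 2.
have xp : 0 < x by rewrite divr_gt0.
have xz : x < 1 - cabs z.
  by apply: (@lt_le_trans _ _ x0); [rewrite /x; lra|rewrite ge_min lexx].
have xB : x * B <= eta * (e * tau).
  rewrite -ler_pdivlMr//; apply: (@le_trans _ _ x0); first by rewrite /x; lra.
  by rewrite ge_min lexx orbT.
have z0 := cabs_ge0 z.
have r1 : 1 - x < 1 by lra.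
have r0 : 0 <= 1 - x by lra.
have zr : cabs z < 1 - x by lra.
apply: (max_modulus dE r1 _ zr) => t1.
have [t ht ->] := circ_period (1 - x) t1 (t0 - pi).
set u := circ (1 - x) t; set ee := expi t.
have hu : disc u by exact: circ_disc.
have hu1 : cabs u <= 1 by exact: ltW.
have ee1 : cabs ee <= 1 by rewrite cabs_expi.
have ue : cabs (u - ee) = x.
  by rewrite /u /ee -(circ1 t) cabs_circ_sub (_ : 1 - x - 1 = - x) ?normrN ?gtr0_norm//; ring.
have HuE : cabs (H u) <= cabs (q ee) * cabs (ee - zeta) + c1 * x.
  have -> : H u = Hb t + (- (Fb t - F u) - A * (u - ee)) by rewrite /H /Hb /ee; ring.
  apply: (le_trans (cabsD _ _)); apply: lerD; first exact: Hbd.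
  apply: (le_trans (cabsD _ _)); rewrite !cabsN cabsM ue /c1 mulrDl lerD2r.
  have := Fbr t (r := 1 - x); rewrite r0 r1 => /(_ isT).
  by rewrite (_ : 1 - (1 - x) = x)//; ring.
rewrite /E cabsM cabsV ler_pdivrMr ?cabs_gt0 ?nz// cabsM.
have q1 : cabs (q ee) - c2 * x <= cabs (q u).
  have := cabsB_ge (q ee) (q ee - q u); rewrite subKr; have := q_lip ee u.
  by rewrite cabsC (cabsC ee) ue -/c2; rewrite (cabsC (q u)); lra.
have w1 : cabs (ee - w) - x <= cabs (u - w).
  have := cabsB_ge (ee - w) (ee - u).
  rewrite (_ : ee - w - (ee - u) = u - w); last by ring.
  by rewrite (cabsC ee u) ue.
have q2 := q_ge _ ee1; have q3 := q_le _ ee1; have w2 := w_ge _ ee1; have w3 := w_le _ ee1.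
have w4 := w_chord t; rewrite -/ee in w4.
have quu := q_ge _ hu1; have wuu := w_ge _ hu1.
rewrite -/Q in q3.
move: HuE q1 w1 q2 q3 w2 w3 w4 quu wuu xB.
have a0 := cabs_ge0 (ee - zeta).
move: (cabs (H u)) (cabs (q ee)) (cabs (ee - zeta)) (cabs (ee - w)) (cabs (q u)) (cabs (u - w)) a0.
move=> h qe a b qu bu a0 HuE q1 w1 q2 q3 w2 w3 w4 quu wuu xB.
have p1 : qe * b - x * (Q + c2 * 3) <= qu * bu.
  have [n1|n1] := lerP 0 (b - x).
    have m1 : (qe - c2 * x) * (b - x) <= qu * bu.
      by apply: le_trans (ler_wpM2r n1 q1) _; apply: ler_wpM2l w1; lra.
    apply: le_trans m1; have m2 : qe * x <= Q * x by apply: ler_wpM2r => //; lra.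
    have m3 : c2 * x * b <= c2 * x * 3 by apply: ler_wpM2l => //; rewrite mulr_ge0// ltW.
    have m4 : 0 <= c2 * x * x by rewrite !mulr_ge0// ltW.
    lra.
  have m1 : qe * b <= Q * x by apply: ler_pM => //; lra.
  have m2 : 0 <= c2 * x by rewrite mulr_ge0// ltW.
  have m3 : 0 <= qu * bu by rewrite mulr_ge0//; lra.
  lra.
have p2 : e * tau <= qe * b by apply: ler_pM => //; lra.
have p3 : qe * a <= qe * b by apply: ler_wpM2l => //; lra.
have eta1 : 0 <= 1 + eta by lra.
have p4 := ler_wpM2l eta1 p1.
have p5 := ler_wpM2l (ltW eta0) p2.
apply: le_trans p4; rewrite /B in xB.
lra.
Qed.

(** Near t0 the boundary values of H are at most e |z - zeta| by differentiability,
    and elsewhere a large k makes q large enough. In a Stolz region Cauchy's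
    estimate turns the bound on H into one on its derivative psi - A, as the
    distance from z to the circle is comparable with |z - zeta|. *)
Lemma fatou_point : forall e al : R, 0 < e -> 1 < al -> exists2 x : R, 0 < x &
  forall z, stolz al zeta z -> cabs (z - zeta) < x -> cabs (psi z - A) < e.
Proof.
move=> e0 al e00 al1.
pose e := e0 / (32 * al).
have al0 : 0 < al by lra.
have ep : 0 < e by rewrite divr_gt0// mulr_gt0.
have [x x0 Hx] := chord_near ep.
have [y y0 Hy] := chord_far x0.
have M0 : 0 < M by rewrite /M ltr_pwDl// cabs_ge0.
pose k := 2 * M / (e * y).
have kp : 0 < k by rewrite divr_gt0// mulr_gt0.
have Hbd t : t0 - pi <= t <= t0 - pi + 2 * pi ->
    cabs (Hb t) <= cabs (e%:C%C * (1 + k%:C%C * (1 - conjc zeta * expi t))) * cabs (expi t - zeta).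
  move=> ht.
  have qR : e * (1 + k * (cabs (expi t - zeta) ^+ 2 / 2)) <=
      cabs (e%:C%C * (1 + k%:C%C * (1 - conjc zeta * expi t))).
    rewrite cabsM cabs_real gtr0_norm//; apply: ler_wpM2l; first exact: ltW.
    apply: le_trans (cabs_Re _); apply: le_trans (ler_norm _).
    by rewrite cReD cReM chord_sqr /= mul0r subr0.
  have [tx|tx] := ltP `|t - t0| x.
    apply: (le_trans (Hx t tx)); apply: ler_wpM2r; first exact: cabs_ge0.
    apply: le_trans qR; rewrite -[leLHS]mulr1; apply: ler_wpM2l; first exact: ltW.
    by rewrite lerDl mulr_ge0 ?(ltW kp)// divr_ge0// sqr_ge0.
  apply: (le_trans (chord_all t)); apply: ler_wpM2r; first exact: cabs_ge0.
  apply: le_trans qR; have hy := Hy t ht tx.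
  have -> : M = e * (k * (y / 2)) by rewrite /k; field; rewrite !gt_eqF.
  apply: ler_wpM2l; first exact: ltW.
  apply: (@le_trans _ _ (k * (cabs (expi t - zeta) ^+ 2 / 2))); last by rewrite lerDr.
  by apply: ler_wpM2l; [exact: ltW|apply: ler_wpM2r].
have Hin := inner_bound ep (ltW kp) Hbd.
exists (1 / (2 * k)); first by rewrite divr_gt0// mulr_gt0.
move=> z [hz hst] zx.
have hz1 : 0 < 1 - cabs z by rewrite subr_gt0.
have dz : 1 - cabs z <= cabs (z - zeta).
  by have := cabsB_ge zeta z; rewrite zeta1 cabsC.
have Hu u : cabs (u - z) < 1 - cabs z -> cabs (H u) <= 4 * e * cabs (z - zeta).
  move=> uz; have hu : disc u by rewrite discE; have := cabsD (u - z) z; rewrite subrK; lra.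
  apply: (le_trans (Hin u hu)).
  have uze : cabs (u - zeta) <= 2 * cabs (z - zeta).
    by have := cabsB_le u zeta z; lra.
  have qu : cabs (e%:C%C * (1 + k%:C%C * (1 - conjc zeta * u))) <= 2 * e.
    rewrite cabsM cabs_real gtr0_norm// mulrC; apply: ler_wpM2r; first exact: ltW.
    apply: (le_trans (cabsD _ _)); rewrite cabs1 cabsM cabs_real gtr0_norm//.
    have -> : 1 - conjc zeta * u = conjc zeta * (zeta - u).
      by rewrite mulrBr (mulrC _ zeta) mul_conjc zeta1 expr1n.
    rewrite cabsM cabs_conj zeta1 mul1r cabsC.
    have : k * cabs (u - zeta) <= k * (1 / k).
      apply: ler_wpM2l; first exact: ltW.
      apply: (le_trans uze); move: zx; have k2 : 0 < 2 * k by rewrite pmulr_rgt0.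
      by rewrite ltr_pdivlMr// ler_pdivlMr// => *; lra.
    by rewrite mul1r mulfV ?gt_eqF//; lra.
  have -> : 4 * e * cabs (z - zeta) = 2 * e * (2 * cabs (z - zeta)) by ring.
  by apply: ler_pM => //; exact: cabs_ge0.
have dH : analytic_on disc H.
  apply: analyticB; first by apply: analyticB; [exact: dF|exact: analytic_cst].
  apply: analyticM; first exact: analytic_cst.
  by apply: analyticB; [exact: analytic_id|exact: analytic_cst].
have zd : cabs z + (1 - cabs z) <= 1 by lra.
have := cauchy_estimate dH hz1 zd Hu.
have -> : cderive H z = psi z - A.
  have HE : \forall u \near (z : C^o), H u = H z + (dquo F z u - A) * (u - z).
    by apply: (@filterE _ (nbhs (z : C^o))) => u; rewrite /H {1}(dquoE F z u); ring.
  have [_ ->] := dquo_derivable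
    (ccontinuousB (dquo_continuous (dF hz)) (@ccontinuous_cst _ A z)) HE.
  by rewrite dquo_self F'.
move=> /le_lt_trans; apply; rewrite ltr_pdivrMr//.
have e32 : e0 = e * (32 * al) by rewrite /e mulfVK// gt_eqF// mulr_gt0.
rewrite e32; move: hst; move: (cabs (z - zeta)) (1 - cabs z) hz1 dz => a b b0 ab ha.
have : e * a < e * (al * b) by rewrite ltr_pM2l.
have : 0 < e * (al * b) by apply: mulr_gt0 => //; exact: mulr_gt0.
lra.
Qed.

End Point.
End Fatou.

(** * Boundary values and the circle integral *)

Section OffNull.
Context d (T : measurableType d) (R : realType) (mu : {measure set T -> \bar R}).

(** Integrals of nonnegative functions are suprema over simple functions, so a
    null set does not count even when a function is not measurable. *)
Lemma ge0_integral_le_off_null (E N : set T) (f g : T -> \bar R) :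
  measurable N -> mu N = 0%E ->
  (forall x, E x -> 0%E <= f x)%E -> (forall x, E x -> 0%E <= g x)%E ->
  (forall x, E x -> ~ N x -> f x <= g x)%E ->
  (\int[mu]_(x in E) f x <= \int[mu]_(x in E) g x)%E.
Proof.
move=> mN N0 f0 g0 fg; rewrite !ge0_integralE//.
apply: ge_ereal_sup => _ [h hf <-].
have mNC : measurable (~` N) by exact: measurableC.
have -> : sintegral mu h = sintegral mu (proj_nnsfun h mNC).
  rewrite -!integralT_nnsfun; apply: ge0_ae_eq_integral => //.
  - by apply/measurable_EFinP.
  - by apply/measurable_EFinP.
  - by move=> x _; rewrite lee_fin.
  - by move=> x _; rewrite lee_fin.
  exists N; split=> // x /= Hx; apply: contrapT => Nx; apply: Hx => _.
  by rewrite /= mindicE mem_set// mulr1.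
apply: ereal_sup_ubound => /=; exists (proj_nnsfun h mNC) => //= x.
have := hf x; rewrite mindicE /patch.
case: ifPn => [/set_mem Ex|_] hx.
  have [/set_mem Nx|/negP Nx] := boolP (x \in ~` N).
    by rewrite mulr1 (le_trans hx)// fg.
  by rewrite mulr0 g0.
have [Nx|Nx] := boolP (x \in ~` N); first by rewrite mulr1.
by rewrite mulr0.
Qed.

Lemma ge0_integral_eq_off_null (E N : set T) (f g : T -> \bar R) :
  measurable N -> mu N = 0%E ->
  (forall x, E x -> 0%E <= f x)%E -> (forall x, E x -> 0%E <= g x)%E ->
  (forall x, E x -> ~ N x -> f x = g x) ->
  (\int[mu]_(x in E) f x = \int[mu]_(x in E) g x)%E.
Proof.
move=> mN N0 f0 g0 fg; apply/eqP; rewrite eq_le; apply/andP.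
split; apply: (@ge0_integral_le_off_null _ N) => // x Ex Nx; rewrite fg//.
Qed.

End OffNull.

Section Boundary.
Variable R : realType.
Local Notation C := R[i].
Local Notation mu := (@lebesgue_measure R).
Local Notation D := [set` `[0%R, (2 * pi : R)%R]].
Implicit Types (a z w u v zeta : C) (r s t : R).

Lemma radius_dist zeta r : cabs zeta = 1 -> r <= 1 -> cabs (r%:C%C * zeta - zeta) = 1 - r.
Proof.
move=> z1 r1; rewrite (_ : r%:C%C * zeta - zeta = (r - 1)%:C%C * zeta).
  by rewrite cabsM z1 mulr1 cabs_real distrC ger0_norm// subr_ge0.
by rewrite rmorphB rmorph1; ring.
Qed.

Lemma stolz_radius zeta r : cabs zeta = 1 -> 0 <= r < 1 -> stolz 2 zeta (r%:C%C * zeta).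
Proof.
move=> z1 /andP[r0 r1]; have rz : cabs (r%:C%C * zeta) = r.
  by rewrite cabsM z1 mulr1 cabs_real ger0_norm.
split; first by rewrite discE rz.
by rewrite rz radius_dist ?ltW//; lra.
Qed.

Lemma nontangential_proper zeta : cabs zeta = 1 -> ProperFilter (nontangential zeta).
Proof.
move=> z1; split; last first.
  split.
  - by move=> al _; exact: filterT.
  - by move=> P Q HP HQ al al1; apply: filterI; [exact: HP|exact: HQ].
  - by move=> P Q PQ HP al al1; apply: filterS (HP al al1).
move=> /(_ 2 (ltr1n _ 2)) /cnbhsP[e e0 He].
pose r := Num.max 0 (1 - e / 2).
have hr : 0 <= r < 1 by rewrite le_max lexx /= gt_max ltr01 gtrBl divr_gt0.
apply: (He (r%:C%C * zeta)) (stolz_radius z1 hr).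
rewrite radius_dist//; last by move/andP: hr => [_ /ltW].
have : 1 - e / 2 <= r by rewrite le_max lexx orbT.
by lra.
Qed.

(** Nontangential convergence of psi to A at zeta, without filters. *)
Definition stolz_limit (psi : C -> C) zeta A := forall e al : R, 0 < e -> 1 < al ->
  exists2 x : R, 0 < x &
    forall z, stolz al zeta z -> cabs (z - zeta) < x -> cabs (psi z - A) < e.

Lemma stolz_limit_boundary (psi : C -> C) zeta A : cabs zeta = 1 ->
  stolz_limit psi zeta A -> boundary psi zeta = A.
Proof.
move=> z1 H; have FF := nontangential_proper z1.
have fl : (psi : C^o -> C^o) @ nontangential zeta --> (A : C^o).
  apply/(@ccvgP _ _ (nontangential zeta)) => e e0 al al1.
  have [x x0 Hx] := H e al e0 al1.
  by apply/cnbhsP; exists x => // u ux hu; exact: Hx.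
exact: (cvg_lim (@norm_hausdorff _ C^o) fl).
Qed.

Variable psi : C -> C.
Hypothesis dpsi : analytic_on disc psi.
Hypothesis psid : forall z, disc z -> disc (psi z).

(** Boundary functions of primitives are Lipschitz, hence differentiable almost
    everywhere, and [fatou_point] applies where they are. *)
Lemma fatou : {ae mu, forall t, 0 <= t <= 2 * pi ->
  stolz_limit psi (expi t) (boundary psi (expi t))}.
Proof.
have [F [Fb [dF F' Fbr Fbl]]] := primitive_boundary dpsi psid.
have lipF : lipschitz_with 1 (fun t => complex.Re (Fb t)).
  move=> s t; rewrite -cReB mul1r; apply: (le_trans (cabs_Re _)).
  exact: le_trans (Fbl _ _) (expi_lipschitz _ _).
have lipG : lipschitz_with 1 (fun t => complex.Im (Fb t)).
  move=> s t; rewrite -cImB mul1r; apply: (le_trans (cabs_Im _)).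
  exact: le_trans (Fbl _ _) (expi_lipschitz _ _).
have ab : (-1 : R) < 2 * pi + 1 by have := pi_gt0 R; lra.
have H1 := lipschitz_ae_derivable ltr01 ab lipF.
have H2 := lipschitz_ae_derivable ltr01 ab lipG.
have FF := ae_filter_ringOfSetsType mu.
apply: (@filterS2 _ _ FF _ _ _ _ H1 H2) => t h1 h2 /andP[t0 t1].
have t01 : -1 < t < 2 * pi + 1 by apply/andP; split; lra.
have pd : path_derive Fb t (Complex ('D_1 (fun t => complex.Re (Fb t)) t)
    ('D_1 (fun t => complex.Im (Fb t)) t)).
  by split; apply: DeriveDef => //; [exact: h1|exact: h2].
have := fatou_point dF F' Fbr Fbl pd => H.
by rewrite (stolz_limit_boundary (cabs_expi t) H).
Qed.

Definition radii (n : nat) : R := 1 - n.+2%:R^-1.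

Lemma radii_ge0 n : 0 <= radii n.
Proof. by rewrite subr_ge0 invf_le1 ?ltr0n// ler1n. Qed.

Lemma radii_lt1 n : radii n < 1.
Proof. by rewrite gtrBl invr_gt0 ltr0n. Qed.

Lemma radii_near (x : R) : x < 1 -> \forall n \near \oo, x < radii n.
Proof.
move=> x1; have : (fun n => radii n) @ \oo --> (1 - 0 : R).
  apply: cvgB; first exact: cvg_cst.
  have := @cvg_harmonic R; rewrite -cvg_shiftS => H.
  by apply: cvg_trans H; apply: near_eq_cvg; near=> n.
rewrite subr0 => /cvgrPdist_lt /(_ (1 - x)); rewrite subr_gt0 => /(_ x1).
apply: filterS => n /=; have := radii_lt1 n => h; rewrite ger0_norm; last by rewrite subr_ge0 ltW.
by lra.
Unshelve. all: by end_near. Qed.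

Lemma radial_cvg zeta : cabs zeta = 1 -> stolz_limit psi zeta (boundary psi zeta) ->
  (fun n => psi ((radii n)%:C%C * zeta) : C^o) @ \oo --> (boundary psi zeta : C^o).
Proof.
move=> z1 H; apply/(@ccvgP _ _ \oo) => e e0.
have [x x0 Hx] := H e 2 e0 (ltr1n _ 2).
have x1 : 1 - x < 1 by rewrite gtrBl.
apply: filterS (radii_near x1) => n hn; apply: Hx.
  by apply: stolz_radius => //; rewrite radii_ge0 radii_lt1.
rewrite radius_dist ?ltW ?radii_lt1//.
by lra.
Qed.

(** The integrand of the circle integral, as a function of the boundary value v. *)
Definition pker a v : R := (1 - cabs a ^+ 2) / cabs (1 - conjc a * v) ^+ 2.

Lemma one_sub_sqr a : disc a -> 0 < 1 - cabs a ^+ 2.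
Proof. by move=> a1; rewrite subr_gt0 expr_lt1// cabs_ge0. Qed.

Lemma pker_ge0 a v : disc a -> 0 <= pker a v.
Proof. by move=> a1; rewrite divr_ge0 ?sqr_ge0// ltW// one_sub_sqr. Qed.

Lemma pker_le a v : disc a -> cabs v <= 1 -> pker a v <= (1 - cabs a ^+ 2) / (1 - cabs a) ^+ 2.
Proof.
rewrite discE => a1 v1; apply: ler_wpM2l; first by rewrite ltW// one_sub_sqr.
have h : 1 - cabs a <= cabs (1 - conjc a * v).
  have := cabsB_ge 1 (conjc a * v); rewrite cabs1 cabsM cabs_conj.
  have := ler_wpM2l (cabs_ge0 a) v1; rewrite mulr1; lra.
have a0 : 0 < 1 - cabs a by rewrite subr_gt0.
rewrite lef_pV2 ?posrE ?exprn_gt0//; last exact: lt_le_trans h.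
by rewrite lerXn2r ?nnegrE ?cabs_ge0// ltW.
Qed.

Lemma den_neq0 a v : disc a -> cabs v <= 1 -> 1 - conjc a * v != 0.
Proof.
rewrite discE => a1 v1; rewrite -cabs_gt0.
have := cabsB_ge 1 (conjc a * v); rewrite cabs1 cabsM cabs_conj.
have := ler_wpM2l (cabs_ge0 a) v1; rewrite mulr1; lra.
Qed.

Lemma pker_cvg a (v_ : nat -> C) v : disc a -> cabs v <= 1 ->
  (v_ : nat -> C^o) @ \oo --> (v : C^o) -> (fun n => pker a (v_ n)) @ \oo --> pker a v.
Proof.
move=> a1 v1 vv; apply: cvgM; first exact: cvg_cst.
apply: cvgV; first by rewrite expf_neq0// cabs_eq0 den_neq0.
have H : (fun n => cabs (1 - conjc a * v_ n)) @ \oo --> cabs (1 - conjc a * v).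
  apply/(@cvgrPdist_lt _ _ _ \oo) => e e0.
  apply: filterS ((@ccvgP _ _ \oo _ _ _).1 vv e e0) => n; apply: le_lt_trans.
  have h : cabs ((1 - conjc a * v_ n) - (1 - conjc a * v)) <= cabs (v_ n - v).
    rewrite (_ : _ - _ = - (conjc a * (v_ n - v))); last by ring.
    rewrite cabsN cabsM cabs_conj; apply: ler_piMl; [exact: cabs_ge0|exact: ltW].
  have h1 := cabsB_ge (1 - conjc a * v_ n) (1 - conjc a * v).
  have h2 := cabsB_ge (1 - conjc a * v) (1 - conjc a * v_ n); rewrite cabsC in h2.
  by rewrite ler_norml; apply/andP; split; lra.
by rewrite !expr2; apply: cvgM.
Qed.

Lemma rcts_pker a r : disc a -> 0 <= r -> r < 1 -> rcts (fun t => pker a (psi (circ r t))).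
Proof.
move=> a1 r0 r1.
have dg : analytic_on disc (fun u => (1 - conjc a * psi u)^-1).
  apply: analyticV; last by move=> z hz; apply: blaschke_den => //; exact: psid.
  apply: analyticB; first exact: analytic_cst.
  by apply: analyticM; [exact: analytic_cst|exact: dpsi].
have cg := rcts_cabs (circ_ccts r0 r1 dg).
have := rctsM (@rcts_cst _ (1 - cabs a ^+ 2)) (rctsM cg cg).
rewrite (_ : (fun t => _ * _) = (fun t => pker a (psi (circ r t)))); first exact.
by apply/funext => t; rewrite /pker cabsV -expr2 exprVn.
Qed.

(** Dominated convergence along circles; the limit function itself is
    replaced by an upper limit of continuous functions, which is measurable. *)
Lemma circle_integral_lim a : disc a -> exists2 I : R,
  circle_integral (fun zeta => (pker a (boundary psi zeta))%:E) = I%:E &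
  (fun n => ravg (fun t => pker a (psi (circ (radii n) t)))) @ \oo --> I.
Proof.
move=> a1.
pose f_ n t : \bar R := (pker a (psi (circ (radii n) t)))%:E.
pose f t : \bar R := limn_esup (f_ ^~ t).
pose K := (1 - cabs a ^+ 2) / (1 - cabs a) ^+ 2.
have mf_ n : measurable_fun D (f_ n) by exact: rcts_measurable (rcts_pker a1 (radii_ge0 n) (radii_lt1 n)).
have mf : measurable_fun D f by apply: measurable_fun_limn_esup => n; exact: mf_.
have psib r t : 0 <= r -> r < 1 -> cabs (psi (circ r t)) <= 1.
  by move=> r0 r1; apply/ltW/psid/circ_disc.
have [N [mN N0 HN]] := fatou.
have lim_ t : D t -> ~ N t -> f_ ^~ t @ \oo --> (pker a (boundary psi (expi t)))%:E.
  rewrite /= in_itv /= => t01 Nt.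
  have Ht : stolz_limit psi (expi t) (boundary psi (expi t)).
    by move: t01; apply: contrapT => h; apply: Nt; apply: HN.
  have vv := radial_cvg (cabs_expi t) Ht.
  have v1 : cabs (boundary psi (expi t)) <= 1.
    apply/ler_addgt0Pr => e e0.
    have [n _ /(_ n (leqnn n)) /= Hn] := (@ccvgP _ _ \oo _ _ _).1 vv e e0.
    have := cabsD (boundary psi (expi t) - psi (circ (radii n) t)) (psi (circ (radii n) t)).
    rewrite subrK cabsC; have := psib _ t (radii_ge0 n) (radii_lt1 n).
    by move: Hn; rewrite /circ; lra.
  by apply: cvg_EFin; [exact: nearW|exact: pker_cvg].
have fE t : D t -> ~ N t -> f t = (pker a (boundary psi (expi t)))%:E.
  move=> Dt Nt; have H := lim_ t Dt Nt.
  by rewrite /f is_cvg_limn_esupE ?(cvg_lim _ H)//; apply/cvg_ex; exists (pker a (boundary psi (expi t)))%:E.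
have iK : mu.-integrable D (EFin \o (fun=> K)).
  by apply: (cts_integrable (a := 0) (b := 2 * pi)); exact: rcts_cst.
have aef : {ae mu, forall t, D t -> f_ ^~ t @ \oo --> f t}.
  exists N; split=> // t /= H; apply: contrapT => Nt; apply: H => Dt.
  by rewrite fE//; exact: lim_.
have aeb : {ae mu, forall t, forall n, D t -> (`|f_ n t| <= (EFin \o (fun=> K)) t)%E}.
  apply: aeW => t n _; rewrite gee0_abs ?lee_fin ?pker_ge0//.
  by apply: pker_le => //; apply: psib; [exact: radii_ge0|exact: radii_lt1].
have [fi _ H] := @dominated_convergence _ (measurableTypeR R) R mu D (measurable_itv _)
  f_ f (EFin \o (fun=> K)) mf_ mf aef iK aeb.
have ff : (\int[mu]_(t in D) f t)%E \is a fin_num by exact: integrable_fin_num.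
exists ((2 * pi)^-1 * fine (\int[mu]_(t in D) f t)).
  rewrite /circle_integral EFinM fineK; last exact: ff.
  congr (_ * _)%E.
  apply: (@ge0_integral_eq_off_null _ (measurableTypeR R) R mu D N
    (fun t => (pker a (boundary psi (expi t)))%:E) f mN N0).
  - by move=> t _; rewrite lee_fin pker_ge0.
  - by move=> t _; apply: limf_esup_ge0 => [[n _ /(_ n (leqnn n))]//|n]; rewrite lee_fin pker_ge0.
  - by move=> t Dt Nt; rewrite fE.
have -> : (fun n => ravg (fun t => pker a (psi (circ (radii n) t)))) =
   (fun n => (2 * pi)^-1 * fine (\int[mu]_(t in D) f_ n t)).
  by apply/funext => n.
apply: cvgM; first exact: cvg_cst.
by apply: fine_cvg; rewrite fineK.
Qed.

End Boundary.

(** * Means of the Poisson kernels *)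

Section Means.
Variable R : realType.
Local Notation C := R[i].
Implicit Types (a z w u v : C) (r s t : R) (f g h psi : C -> C).

(** By [mobius_sqr], 1 - |phi|^2 = (1 - |w|^2) sker w v for the Moebius transform
    phi = (v - w) / (1 - conjc w v) of v. *)
Definition sker w v : R := (1 - cabs v ^+ 2) / cabs (1 - conjc w * v) ^+ 2.

Lemma sqr_den_gt0 w v : disc w -> cabs v <= 1 -> 0 < cabs (1 - conjc w * v) ^+ 2.
Proof. by move=> w1 v1; rewrite exprn_gt0// cabs_gt0 den_neq0. Qed.

Lemma mobius_sqr w v : disc w -> cabs v <= 1 ->
  cabs (v - w) ^+ 2 / cabs (1 - conjc w * v) ^+ 2 = 1 - (1 - cabs w ^+ 2) * sker w v.
Proof.
move=> w1 v1; have h := sqr_den_gt0 w1 v1.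
apply: (mulIf (lt0r_neq0 h)); rewrite mulfVK ?gt_eqF// mulrBl mul1r -mulrA mulfVK ?gt_eqF//.
by rewrite sqr_blaschke; ring.
Qed.

Lemma poisson_Re w v : disc w -> cabs v <= 1 ->
  complex.Re ((1 + conjc w * v) * (1 - conjc w * v)^-1) = pker w v + cabs w ^+ 2 * sker w v.
Proof.
move=> w1 v1; have h := sqr_den_gt0 w1 v1.
set k := conjc w * v in h *.
have kk : cabs k ^+ 2 = cabs w ^+ 2 * cabs v ^+ 2 by rewrite /k cabsM cabs_conj exprMn.
have -> : (1 + k) * (1 - k)^-1 = ((cabs (1 - k) ^+ 2)^-1)%:C%C * ((1 + k) * conjc (1 - k)).
  have hk : 1 - k != 0 by exact: den_neq0 w1 v1.
  apply: (mulIf hk); rewrite mulfVK// -!mulrA (mulrC (conjc _)) mul_conjc mulrCA.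
  by rewrite -rmorphM mulVf ?gt_eqF// rmorph1 mulr1.
rewrite cRe_realM.
have -> : complex.Re ((1 + k) * conjc (1 - k)) = 1 - cabs k ^+ 2.
  by rewrite sqr_cabs; case: (k) => x y /=; ring.
by rewrite kk /pker /sker -/k; ring.
Qed.

Lemma poisson_mean f w r : analytic_on disc f -> (forall z, disc z -> disc (f z)) ->
  disc w -> 0 <= r -> r < 1 ->
  ravg (fun t => pker w (f (circ r t)) + cabs w ^+ 2 * sker w (f (circ r t))) =
  pker w (f 0) + cabs w ^+ 2 * sker w (f 0).
Proof.
move=> df fd w1 r0 r1; have d0 := fd _ (disc0 R).
have dg : analytic_on disc (fun u => (1 + conjc w * f u) * (1 - conjc w * f u)^-1).
  apply: analyticM.
    apply: analyticD; first exact: analytic_cst.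
    by apply: analyticM; [exact: analytic_cst|exact: df].
  apply: analyticV; last by move=> z hz; apply: blaschke_den => //; exact: fd.
  apply: analyticB; first exact: analytic_cst.
  by apply: analyticM; [exact: analytic_cst|exact: df].
rewrite -(poisson_Re w1 (ltW d0)) -(Re_mean dg r0 r1); apply: eq_ravg => t.
by rewrite poisson_Re//; apply/ltW/fd/circ_disc.
Qed.

Lemma rcts_sker f w r : analytic_on disc f -> (forall z, disc z -> disc (f z)) ->
  disc w -> 0 <= r -> r < 1 -> rcts (fun t => sker w (f (circ r t))).
Proof.
move=> df fd w1 r0 r1.
have dg : analytic_on disc (fun u => (1 - conjc w * f u)^-1).
  apply: analyticV; last by move=> z hz; apply: blaschke_den => //; exact: fd.
  apply: analyticB; first exact: analytic_cst.
  by apply: analyticM; [exact: analytic_cst|exact: df].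
have cg := rcts_cabs (circ_ccts r0 r1 dg).
have cf := rcts_cabs (circ_ccts r0 r1 df).
have := rctsM (rcts_cstB (k := 1) (rctsM cf cf)) (rctsM cg cg).
rewrite (_ : (fun t => _ * _) = (fun t => sker w (f (circ r t)))); first exact.
by apply/funext => t; rewrite /sker cabsV -!expr2 exprVn.
Qed.

(** The mean value property of the real part of
    (1 + conjc w f) / (1 - conjc w f) turns means of pker into means of sker, that
    is, into means of the squared modulus of a Moebius transform of f. *)
Lemma pker_sker_mean f w r : analytic_on disc f -> (forall z, disc z -> disc (f z)) ->
  disc w -> 0 <= r -> r < 1 ->
  ravg (fun t => pker w (f (circ r t))) + cabs w ^+ 2 * ravg (fun t => sker w (f (circ r t))) =
  pker w (f 0) + cabs w ^+ 2 * sker w (f 0).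
Proof.
move=> df fd w1 r0 r1; rewrite -(poisson_mean df fd w1 r0 r1).
have c1 := rcts_pker df fd w1 r0 r1; have c2 := rcts_sker df fd w1 r0 r1.
have c3 := rctsM (@rcts_cst _ (cabs w ^+ 2)) c2.
by rewrite (ravgD c1 c3) (ravgZ _ c2).
Qed.

End Means.

(** * Zeros and the counting function *)

Section ZeroSums.
Variable R : realType.
Local Notation C := R[i].
Implicit Types (a z w u v : C) (r s t : R) (f g h psi : C -> C) (zs : seq C).

Definition divides_at f z (n : nat) := exists2 g, analytic_on disc g &
  forall u, disc u -> f u = (u - z) ^+ n * g u.

Lemma bnum_nseq n z zs u : bnum (nseq n z ++ zs) u = (u - z) ^+ n * bnum zs u.
Proof. by elim: n => [|n IH]; rewrite ?mul1r//= bnum_cons IH exprS mulrA. Qed.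

Lemma bnum_neq0 z zs : z \notin zs -> bnum zs z != 0.
Proof.
elim: zs => [|x zs IH]; first by rewrite /bnum big_nil oner_eq0.
by rewrite inE negb_or bnum_cons => /andP[zx /IH h]; rewrite mulf_neq0// subr_eq0.
Qed.

(** The quotient is h / (u - z)^n away from z; it is g / bnum zs near z, where
    bnum zs has no zero. *)
Lemma divides_bnum f z n zs h : disc z -> z \notin zs -> divides_at f z n ->
  analytic_on disc h -> (forall u, disc u -> f u = bnum zs u * h u) ->
  exists2 k, analytic_on disc k &
    forall u, disc u -> f u = bnum (nseq n z ++ zs) u * k u.
Proof.
move=> hz zzs [g dg fg] dh fh; have Qz := bnum_neq0 zzs.
have dQ := @analytic_bnum R zs.
pose k u := if u == z then g z / bnum zs z else h u / (u - z) ^+ n.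
have kE u : disc u -> u != z -> (u - z) ^+ n * k u = h u.
  move=> hu uz; rewrite /k ifN// mulrC mulfVK// expf_neq0// subr_eq0//.
have Qnear : \forall u \near (z : C^o), bnum zs u != 0.
  have /(@ccvgP _ _ (nbhs (z : C^o))) H := analytic_cts dQ hz.
  have c0 : 0 < cabs (bnum zs z) by rewrite cabs_gt0.
  apply: filterS (H _ c0) => u; apply: contraTneq => ->.
  by rewrite sub0r cabsN ltxx.
have kz : \forall u \near (z : C^o), g u / bnum zs u = k u.
  apply: filterS2 Qnear (disc_open hz) => u Qu hu.
  have [->|uz] := eqVneq u z; first by rewrite /k eqxx.
  have pz : (u - z) ^+ n != 0 by rewrite expf_neq0// subr_eq0.
  apply: (mulIf Qu); rewrite mulfVK//; apply: (mulfI pz).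
  by rewrite -fg// fh// mulrA kE// mulrC.
exists k => [u hu|u hu].
  have [->|uz] := eqVneq u z.
    apply: (@near_eq_derivable _ C^o C^o (fun u => g u / bnum zs u)) => //.
    by apply: derivableM; [exact: dg|apply: derivableV; [exact: Qz|exact: dQ]].
  apply: (@near_eq_derivable _ C^o C^o (fun u => h u / (u - z) ^+ n)) => //.
    apply/cnbhsP; exists (cabs (u - z)); first by rewrite cabs_gt0 subr_eq0.
    move=> v vu; rewrite /k ifN//; apply: contraTneq vu => ->.
    by rewrite cabsC ltxx.
  apply: derivableM; first exact: dh.
  apply: derivableV; first by rewrite expf_neq0// subr_eq0.
  have dz : analytic_on disc (fun u => (u - z) ^+ n).
    by apply: analyticX; apply: analyticB; [exact: analytic_id|exact: analytic_cst].
  exact: dz.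
rewrite bnum_nseq; have [->|uz] := eqVneq u z; last by rewrite -mulrA mulrCA kE// fh.
by rewrite /k eqxx fg// -mulrA [bnum zs z * _]mulrC mulfVK.
Qed.

Lemma divides_all f (m : C -> nat) (s : seq C) : analytic_on disc f -> uniq s -> in_disc s ->
  (forall z, z \in s -> divides_at f z (m z)) ->
  exists2 h, analytic_on disc h &
    forall u, disc u -> f u = bnum (flatten [seq nseq (m z) z | z <- s]) u * h u.
Proof.
move=> df; elim: s => [_ _ _|z s IH /andP[zs us] /in_disc_cons[hz hs] H].
  by exists f => // u _; rewrite /bnum big_nil mul1r.
have Hs x : x \in s -> divides_at f x (m x) by move=> xs; apply: H; rewrite inE xs orbT.
have [h dh fh] := IH us hs Hs.
apply: (divides_bnum hz _ (H z (mem_head _ _)) dh fh).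
apply: contra zs => /flattenP[_ /mapP[x xs ->]].
by rewrite mem_nseq => /andP[_ /eqP ->].
Qed.

Lemma sum_flatten (m : C -> nat) (s : seq C) (F : C -> R) :
  \sum_(z <- flatten [seq nseq (m z) z | z <- s]) F z = \sum_(z <- s) (m z)%:R * F z.
Proof.
elim: s => [|z s IH]; first by rewrite !big_nil.
rewrite /= big_cat IH big_cons; congr (_ + _).
by elim: (m z) => [|n IHn]; rewrite ?big_nil ?mul0r//= big_cons IHn -natr1 mulrDl mul1r addrC.
Qed.

End ZeroSums.

Section Counting.
Variable R : realType.
Local Notation C := R[i].
Implicit Types (a z w u v : C) (r s t : R) (f g h psi : C -> C) (zs : seq C).

Lemma lne_cabs z : z != 0 -> (- lne (cabs z)%:E = (- ln (cabs z))%:E)%E.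
Proof. by rewrite -cabs_gt0 => z0; rewrite lne_EFin. Qed.

Lemma cabs_neg_ln z : z != 0 -> disc z -> 0 < - ln (cabs z).
Proof. by rewrite -cabs_gt0 => z0 z1; rewrite oppr_gt0 ln_lt0// z0. Qed.

(** A bound on the sums over all finite families of zeros makes the multiplicities
    finite, hence attained, and those of finitely many points can be divided out
    together. *)
Lemma nevanlinna_le psi w (B : R) : analytic_on disc psi -> psi 0 != w ->
  (forall zs h, in_disc zs -> analytic_on disc h ->
    (forall u, disc u -> psi u - w = bnum zs u * h u) ->
    \sum_(z <- zs) - ln (cabs z) <= B) ->
  (nevanlinna psi w <= B%:E)%E.
Proof.
move=> dpsi p0w HB.
pose f u := psi u - w.
have df : analytic_on disc f by apply: analyticB; [exact: dpsi|exact: analytic_cst].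
pose Z := [set z | disc z /\ psi z = w].
have Zn0 z : Z z -> z != 0.
  by move=> [_ pz]; apply: contraNneq p0w => z0; rewrite -pz z0.
have attained z : exists n : nat, Z z -> divides_at f z n /\ zero_mult psi w z = (n%:R)%:E.
  have [Zz|nZ] := pselect (Z z); last by exists 0%N.
  have c0 := cabs_neg_ln (Zn0 _ Zz) Zz.1.
  have bound n : `[< divides_at f z n >] -> (n <= Num.bound (`|B| / - ln (cabs z)))%N.
    move=> /asboolP[g dg fg].
    have hz : in_disc (nseq n z) by move=> x; rewrite mem_nseq => /andP[_ /eqP ->]; exact: Zz.1.
    have fb u : disc u -> psi u - w = bnum (nseq n z) u * g u.
      by move=> hu; rewrite -[nseq n z]cats0 bnum_nseq /bnum big_nil mulr1; exact: fg.
    have := HB _ _ hz dg fb; rewrite big_nseq -Monoid.iteropE /= -/(GRing.natmul _ n).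
    rewrite -mulr_natl => hB.
    have : n%:R <= `|B| / - ln (cabs z).
      by rewrite ler_pdivlMr//; apply: (le_trans hB); exact: ler_norm.
    move=> /le_lt_trans /(_ (archi_boundP _)) => H; apply: ltnW; rewrite -(ltr_nat R).
    by apply: H; rewrite divr_ge0// ltW.
  have ex0 : exists n, `[< divides_at f z n >].
    exists 0%N; apply/asboolP; exists f => // u _; by rewrite expr0 mul1r.
  case: (ex_maxnP ex0 bound) => n /asboolP Hn nmax; exists n => _; split=> //.
  apply/eqP; rewrite eq_le; apply/andP; split.
    apply: ge_ereal_sup => _ [k Hk <-]; rewrite lee_fin ler_nat; apply: nmax.
    exact/asboolP.
  by apply: ereal_sup_ubound; exists n.
have [m Hm] := choice attained.
apply: ge_ereal_sup => _ [A [finA AZ] <-].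
rewrite fsbig_finite//=; set s := finmap.enum_fset (fset_set A).
have sZ z : z \in s -> Z z.
  move=> zs; apply: AZ; have : z \in fset_set A by exact: zs.
  by rewrite in_fset_set// => /set_mem.
have -> : (\sum_(z <- s) zero_mult psi w z * - lne (cabs z)%:E =
    (\sum_(z <- s) (m z)%:R * - ln (cabs z))%:E)%E.
  rewrite -sumEFin big_seq [RHS]big_seq; apply: eq_bigr => z /sZ Zz.
  by rewrite (Hm z Zz).2 lne_cabs ?Zn0// -EFinM.
rewrite lee_fin -(sum_flatten m s (fun z => - ln (cabs z))).
have hA : in_disc s by move=> z /sZ[].
have [h dh fh] := divides_all df (finmap.fset_uniq _) hA (fun z zA => (Hm z (sZ z zA)).1).
apply: HB dh fh => z /flattenP[_ /mapP[x xA ->]].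
by rewrite mem_nseq => /andP[_ /eqP ->]; exact: hA.
Qed.

Lemma bnum_count z zs u :
  bnum zs u = (u - z) ^+ count_mem z zs * bnum [seq x <- zs | x != z] u.
Proof.
elim: zs => [|x zs IH]; first by rewrite /bnum big_nil mulr1.
rewrite bnum_cons IH /=; case: eqVneq => [->|xz] /=; first by rewrite exprS mulrA.
by rewrite add0n bnum_cons mulrCA.
Qed.

(** Equal points of zs are collected; a point that occurs n times has multiplicity
    at least n. *)
Lemma nevanlinna_ge psi w zs h : (forall z, z \in zs -> 0 < cabs z < 1) ->
  analytic_on disc h -> (forall u, disc u -> psi u - w = bnum zs u * h u) ->
  ((\sum_(z <- zs) - ln (cabs z))%:E <= nevanlinna psi w)%E.
Proof.
move=> hzs dh fh.
apply: ereal_sup_ge; exists (\sum_(z \in [set` undup zs]) (zero_mult psi w z * - lne (cabs z)%:E))%E.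
  exists [set` undup zs] => //; split; first exact: finite_seq.
  move=> z /=; rewrite mem_undup => zz; have /andP[_ z1] := hzs z zz; split=> //.
  apply/eqP; rewrite -subr_eq0 fh//.
  by rewrite /bnum (big_rem z)//= subrr !mul0r.
rewrite -fsbig_seq ?undup_uniq//=.
rewrite -(big_undup_iterop_count _ zs xpredT (fun z => - ln (cabs z))) -sumEFin.
rewrite big_seq [leRHS]big_seq; apply: lee_sum => z; rewrite mem_undup => zz.
have /andP[z0 z1] := hzs z zz.
rewrite lne_cabs -?cabs_gt0// -/(GRing.natmul _ _) -mulr_natl EFinM.
apply: lee_wpmul2r.
  by rewrite lee_fin ltW// cabs_neg_ln// -cabs_gt0.
apply: ereal_sup_ubound; exists (count_mem z zs) => //=.
exists (fun u => bnum [seq x <- zs | x != z] u * h u).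
  by apply: analyticM; [exact: analytic_bnum|exact: dh].
by move=> u hu; rewrite fh// (bnum_count z) mulrA.
Qed.

End Counting.

(** * From the circle integral to the counting function *)

Section LowerBound.
Variable R : realType.
Local Notation C := R[i].
Implicit Types (a z w u v : C) (r s t : R) (zs : seq C).
Variables (psi : C -> C).
Hypothesis dpsi : analytic_on disc psi.
Hypothesis psid : forall z, disc z -> disc (psi z).

Lemma sker_ge0 w v : disc v -> 0 <= sker w v.
Proof. by move=> v1; rewrite divr_ge0 ?sqr_ge0// ltW// one_sub_sqr. Qed.

(** The Moebius transform of psi, divided by the Blaschke product of the zeros zs, is
    analytic, and on large circles its square mean is at most (1 - e)^-2 times that
    of the transform itself, which [pker_sker_mean] computes. *)
Lemma blaschke_quotient_le w zs h (I : R) : disc w -> w != 0 ->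
  in_disc zs -> analytic_on disc h ->
  (forall u, disc u -> psi u - w = bnum zs u * h u) ->
  (fun n => ravg (fun t => pker w (psi (circ (radii R n) t)))) @ \oo --> I ->
  cabs w ^+ 2 * cabs (h 0 / (1 - conjc w * psi 0)) ^+ 2 <=
  cabs w ^+ 2 - (1 - cabs w ^+ 2) * (pker w (psi 0) + cabs w ^+ 2 * sker w (psi 0) - I).
Proof.
move=> w1 w0 hzs dh fh II.
pose ht u := h u * bden zs u * (1 - conjc w * psi u)^-1.
have dht : analytic_on disc ht.
  apply: analyticM; first by apply: analyticM; [exact: dh|exact: analytic_bden].
  apply: analyticV; last by move=> z hz; apply: blaschke_den => //; exact: psid.
  apply: analyticB; first exact: analytic_cst.
  by apply: analyticM; [exact: analytic_cst|exact: dpsi].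
have -> : h 0 / (1 - conjc w * psi 0) = ht 0 by rewrite /ht bden0 mulr1.
set W := cabs w ^+ 2; set PP := pker w _ + _; set H0 := cabs (ht 0) ^+ 2.
have W0 : 0 < W by rewrite exprn_gt0// cabs_gt0.
have W1 : 0 < 1 - W by exact: one_sub_sqr.
have H00 : 0 <= H0 by exact: sqr_ge0.
rewrite -subr_le0; apply: (@small_le0_near _ 1 _ (2 * (W * H0) + 1)) => //.
  by rewrite addr_ge0// mulr_ge0// mulr_ge0// ltW.
move=> e e0 e1.
have [p p1 Hp] := blaschke_prod_lim hzs e0.
have [n [nI np]] : exists n, ravg (fun t => pker w (psi (circ (radii R n) t))) < I + e /\ p < radii R n.
  have [N1 _ H1] := (@cvgrPdist_lt _ _ _ \oo _ _ _).1 II e e0.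
  have [N2 _ H2] := radii_near p1.
  exists (maxn N1 N2); split; last by apply: H2; exact: leq_maxr.
  by have := H1 (maxn N1 N2) (leq_maxl _ _); rewrite /= ltr_distlC => /andP[].
have r0 := radii_ge0 R n; have r1 := radii_lt1 R n.
have key u : disc u -> p < cabs u ->
    (1 - e) ^+ 2 * cabs (ht u) ^+ 2 <= 1 - (1 - W) * sker w (psi u).
  move=> hu pu; have hp := psid hu; have hd := sqr_den_gt0 w1 (ltW hp).
  rewrite -mobius_sqr ?(ltW hp)// ler_pdivlMr// -!exprMn fh//.
  rewrite lerXn2r ?nnegrE ?cabs_ge0 ?mulr_ge0 ?cabs_ge0 ?subr_ge0 ?(ltW e1)//.
  rewrite -mulrA -cabsM /ht mulfVK ?den_neq0 ?(ltW hp)//.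
  rewrite !cabsM (mulrC (cabs (h u))) mulrA.
  by apply: ler_wpM2r; [exact: cabs_ge0|exact: Hp].
have c1 := rcts_cabs (circ_ccts r0 r1 dht).
have c2 := rcts_sker dpsi psid w1 r0 r1.
have c3 := rctsM (@rcts_cst _ (1 - W)) c2.
have c4 := rctsM c1 c1.
have c5 := rctsM (@rcts_cst _ ((1 - e) ^+ 2)) c4.
have m1 : (1 - e) ^+ 2 * H0 <= 1 - (1 - W) * ravg (fun t => sker w (psi (circ (radii R n) t))).
  apply: (@le_trans _ _ ((1 - e) ^+ 2 * ravg (fun t => cabs (ht (circ (radii R n) t)) * cabs (ht (circ (radii R n) t))))).
    by apply: ler_wpM2l; [exact: sqr_ge0|exact: sq_mean_le dht r0 r1].
  rewrite -(ravgZ _ c4) -(ravgZ _ c2) -(ravg_cstB 1 c3).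
  apply: (ravg_le c5 (rcts_cstB (k := 1) c3)) => t.
  by apply: key; [exact: circ_disc|rewrite cabs_circ].
have m2 := pker_sker_mean dpsi psid w1 r0 r1.
rewrite -/PP -/W in m2.
have m3 : W * ((1 - e) ^+ 2 * H0) <= W - (1 - W) * (W * ravg (fun t => sker w (psi (circ (radii R n) t)))).
  by apply: le_trans (ler_wpM2l (ltW W0) m1) _; rewrite mulrBr mulr1 mulrCA.
move: m2 m3 nI; move: (ravg _) (ravg _) => Sn In m2 m3 nI.
have -> : W * H0 - (W - (1 - W) * (PP - I)) =
   W * H0 - W + (1 - W) * (W * Sn) + (1 - W) * (In - I) by rewrite -m2; ring.
have m4 : (1 - W) * (In - I) <= 1 * e.
  by apply: (@le_trans _ _ ((1 - W) * e)); [apply: ler_wpM2l|apply: ler_wpM2r]; lra.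
have m5 : W * H0 * (1 - 2 * e) <= W * H0 * (1 - e) ^+ 2.
  apply: ler_wpM2l; first by rewrite mulr_ge0// ltW.
  have := sqr_ge0 e; lra.
lra.
Qed.

(** The product of the moduli of the zeros is |phi(psi 0)| divided by the value at 0
    of the quotient just bounded. Both logarithms are estimated by ln y <= y - 1. *)
Lemma counting_le w (I : R) : disc w -> w != 0 -> psi 0 != w -> 0 <= I ->
  (fun n => ravg (fun t => pker w (psi (circ (radii R n) t)))) @ \oo --> I ->
  (nevanlinna psi w <= ((1 - cabs w) * (sker w (psi 0) *
     ((1 - (1 - cabs w ^+ 2) * sker w (psi 0))^-1 - 1) + I / cabs w ^+ 2))%:E)%E.
Proof.
move=> w1 w0 p0w I0 II; apply: nevanlinna_le => // zs h hzs dh fh.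
have hp := psid (disc0 R).
have := blaschke_quotient_le w1 w0 hzs dh fh II.
have x2E := mobius_sqr w1 (ltW hp).
have hd := sqr_den_gt0 w1 (ltW hp).
have x20 : 0 < 1 - (1 - cabs w ^+ 2) * sker w (psi 0).
  by rewrite -x2E divr_gt0// exprn_gt0// cabs_gt0 subr_eq0.
have z0 z : z \in zs -> z != 0.
  move=> zz; apply: contraNneq p0w => zE; rewrite -subr_eq0 (fh _ (disc0 R)).
  by rewrite /bnum (big_rem z)//= zE subrr !mul0r.
have P0 : 0 < \prod_(z <- zs) cabs z.
  rewrite big_seq; apply: prodr_gt0 => x xs; rewrite cabs_gt0; exact: z0.
rewrite sumrN -ln_prod//.
have x2P : 1 - (1 - cabs w ^+ 2) * sker w (psi 0) =
   (\prod_(z <- zs) cabs z) ^+ 2 * cabs (h 0 / (1 - conjc w * psi 0)) ^+ 2.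
  by rewrite -x2E (fh _ (disc0 R)) cabsM cabs_bnum0 cabsM cabsV !exprMn exprVn -mulrA.
have s0 := sker_ge0 w hp; have k0 := pker_ge0 (psi 0) w1.
have ww0 : 0 < cabs w by rewrite cabs_gt0.
have ww1 : cabs w < 1 by [].
move: x20 x2P P0 s0 k0 ww0 ww1.
move: (sker w _) (pker w _) (\prod_(z <- zs) _) (cabs (h 0 / _)) (cabs w).
move=> s k P H W x20 x2P P0 s0 k0 W0 W1 HQ.
have H0 : 0 < H ^+ 2 by move: x20; rewrite x2P pmulr_rgt0// exprn_gt0.
have W20 : 0 < W ^+ 2 by rewrite exprn_gt0.
have e1 : 2 * - ln P = ln ((1 - (1 - W ^+ 2) * s)^-1) + ln (H ^+ 2).
  have P2 : 0 < P ^+ 2 by exact: exprn_gt0.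
  rewrite x2P lnV ?posrE; last exact: mulr_gt0.
  by rewrite (lnM P2 H0) [ln (P ^+ 2)]lnXn// -mulr_natl; ring.
have e2 := ln_le_sub1 H0.
have e3 : ln ((1 - (1 - W ^+ 2) * s)^-1) <= (1 - (1 - W ^+ 2) * s)^-1 - 1.
  by apply: ln_le_sub1; rewrite invr_gt0.
set x := 1 - (1 - W ^+ 2) * s in x20 e1 e3 x2P *.
have e4 : x^-1 - 1 = (1 - W ^+ 2) * (s / x).
  by apply: (mulIf (lt0r_neq0 x20)); rewrite mulrBl mulVf ?gt_eqF// -mulrA mulfVK ?gt_eqF// /x; ring.
have e5 : H ^+ 2 <= 1 - (1 - W ^+ 2) * ((k + W ^+ 2 * s - I) / W ^+ 2).
  rewrite -(ler_pM2l W20); apply: (le_trans HQ); rewrite le_eqVlt; apply/orP; left; apply/eqP.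
  by field; rewrite gt_eqF.
have e6 : (k + W ^+ 2 * s - I) / W ^+ 2 = k / W ^+ 2 + s - I / W ^+ 2.
  by rewrite mulrBl mulrDl [W ^+ 2 * s]mulrC mulfK// gt_eqF.
rewrite e6 in e5.
have kW : 0 <= k / W ^+ 2 by rewrite divr_ge0// ltW.
have IW : 0 <= I / W ^+ 2 by rewrite divr_ge0// ltW.
have W21 : 0 <= 1 - W ^+ 2 by rewrite subr_ge0 expr_le1 ?ltW.
have x1 : x <= 1 by rewrite /x gerBl mulr_ge0.
have sx : 0 <= s * (x^-1 - 1) by rewrite mulr_ge0// subr_ge0 invf_ge1.
have e7 : 0 <= (1 - W ^+ 2) * (k / W ^+ 2) by exact: mulr_ge0.
have e8 : (1 - W ^+ 2) * (s * (x^-1 - 1) + I / W ^+ 2) <=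
   (1 - W) * 2 * (s * (x^-1 - 1) + I / W ^+ 2).
  apply: ler_wpM2r; first exact: addr_ge0.
  have : 0 <= (1 - W) ^+ 2 by exact: sqr_ge0.
  lra.
have e9 : (1 - W ^+ 2) * (s * (x^-1 - 1) + I / W ^+ 2) =
  x^-1 - 1 - (1 - W ^+ 2) * s + (1 - W ^+ 2) * (I / W ^+ 2) by rewrite [in RHS]e4; ring.
move: e1 e2 e3 e5 e8 e9 e7.
move: (ln P) (ln x^-1) (ln (H ^+ 2)) (H ^+ 2) (x^-1) (k / _) (I / _) => *.
lra.
Qed.

End LowerBound.

(** * From the counting function to the circle integral *)

Section UpperBound.
Variable R : realType.
Local Notation C := R[i].
Implicit Types (a z w u v : C) (r s t : R) (zs : seq C).
Variables (psi : C -> C).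
Hypothesis dpsi : analytic_on disc psi.
Hypothesis psid : forall z, disc z -> disc (psi z).

Lemma ln_max_ge (q x : R) : 0 < q -> q <= 1 -> 0 <= x -> x <= 1 ->
  - (1 - x ^+ 2) / (2 * q ^+ 2) <= ln (Num.max q x).
Proof.
move=> q0 q1 x0 x1; set m := Num.max q x.
have qm : q <= m by rewrite le_max lexx.
have xm : x <= m by rewrite le_max lexx orbT.
have m1 : m <= 1 by rewrite ge_max q1.
have m0 : 0 < m by exact: lt_le_trans qm.
have h : ln (m ^+ 2)^-1 <= (m ^+ 2)^-1 - 1.
  by apply: ln_le_sub1; rewrite invr_gt0 exprn_gt0.
rewrite lnV ?posrE ?exprn_gt0// lnXn// in h.
have m2 : 0 < m ^+ 2 by rewrite exprn_gt0.
have q2 : 0 < q ^+ 2 by rewrite exprn_gt0.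
have qm2 : q ^+ 2 <= m ^+ 2 by rewrite lerXn2r ?nnegrE// ltW.
have xm2 : x ^+ 2 <= m ^+ 2 by rewrite lerXn2r ?nnegrE// ltW.
have m12 : m ^+ 2 <= 1 by rewrite expr_le1// ltW.
have h2 : (m ^+ 2)^-1 - 1 <= (1 - x ^+ 2) / q ^+ 2.
  have -> : (m ^+ 2)^-1 - 1 = (1 - m ^+ 2) / m ^+ 2 by rewrite mulrBl mulfV ?gt_eqF// mul1r.
  apply: (@le_trans _ _ ((1 - m ^+ 2) / q ^+ 2)).
    by apply: ler_wpM2l; [rewrite subr_ge0|rewrite lef_pV2].
  by apply: ler_wpM2r; [rewrite invr_ge0 ltW|lra].
have -> : - (1 - x ^+ 2) / (2 * q ^+ 2) = - (((1 - x ^+ 2) / q ^+ 2) / 2) by field; rewrite gt_eqF.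
move: h h2; rewrite mulr2n; move: (ln m) (_ / q ^+ 2) => *; lra.
Qed.

(** By [pker_sker_mean] for the identity function, as
    (1 - |a|^2) sker a v <= pker a v. *)
Lemma sker_mean_id a (q : R) : disc a -> 0 <= q -> q < 1 ->
  ravg (fun t => sker a (circ q t)) <= 1.
Proof.
move=> a1 q0 q1.
have did : analytic_on disc (id : C -> C) by exact: analytic_id.
have h0 := pker_sker_mean did (fun z hz => hz) a1 q0 q1.
have c1 := rcts_pker did (fun z hz => hz) a1 q0 q1.
have c2 := rcts_sker did (fun z hz => hz) a1 q0 q1.
have : ravg (fun t => (1 - cabs a ^+ 2) * sker a (circ q t)) <= ravg (fun t => pker a (circ q t)).
  apply: (ravg_le (rctsM (@rcts_cst _ (1 - cabs a ^+ 2)) c2) c1) => t.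
  rewrite /pker /sker mulrA; apply: ler_wpM2r; first by rewrite invr_ge0 sqr_ge0.
  apply: ler_piMr; first by rewrite ltW// one_sub_sqr.
  by rewrite gerBl sqr_ge0.
rewrite (ravgZ _ c2) => h1; move: h0.
rewrite /= /pker /sker mulr0 subr0 cabs0 cabs1 !expr1n !divr1 expr0n /= subr0 mulr1 subrK.
move: h1; rewrite /pker /sker; lra.
Qed.

Lemma mobius_inverse a v g p : p - a = g * (1 - conjc a * p) -> 1 + conjc a * v != 0 ->
  p - (v + a) / (1 + conjc a * v) = (g - v) * (1 - conjc a * p) / (1 + conjc a * v).
Proof.
move=> hg h0; apply: (mulIf h0); rewrite mulrBl !mulfVK// mulrBl -hg; ring.
Qed.

(** The zeros of g - circ q s, where g is the Moebius transform of psi, are zeros of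
    psi - w for the preimage w of circ q s under the same transform. When |a| is
    close to 1 so is |w|, and the hypothesis on the counting function bounds the
    sums over zeros in [cartan_jensen]. *)
Lemma sker_mean_ge a r (q r0 L : R) : disc a -> 0 < q -> q < 1 -> 0 <= r0 -> 0 <= L ->
  0 <= r -> r < 1 -> q < cabs ((psi 0 - a) / (1 - conjc a * psi 0)) ->
  (forall s, r0 < cabs ((circ q s + a) / (1 + conjc a * circ q s))) ->
  (forall w, r0 < cabs w -> cabs w < 1 -> (nevanlinna psi w <= (L * (1 - cabs w))%:E)%E) ->
  q ^+ 2 * (sker a (psi 0) - 2 * (L / (1 + r0))) <= ravg (fun t => sker a (psi (circ r t))).
Proof.
move=> a1 q0 q1 r00 L0 rp r1 qg0 hq NL.
pose g u := (psi u - a) * (1 - conjc a * psi u)^-1.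
have na1 : disc (- a) by rewrite discE cabsN.
have nden v : cabs v <= 1 -> 1 + conjc a * v != 0.
  by move=> v1; have := den_neq0 na1 v1; rewrite rmorphN mulNr opprK.
have gE u : disc u -> psi u - a = g u * (1 - conjc a * psi u).
  by move=> hu; rewrite /g mulfVK// den_neq0//; apply/ltW/psid.
have g2 u : disc u -> cabs (g u) ^+ 2 = 1 - (1 - cabs a ^+ 2) * sker a (psi u).
  by move=> hu; rewrite /g cabsM cabsV exprMn exprVn mobius_sqr//; apply/ltW/psid.
have A1 := one_sub_sqr a1.
have gd u : disc u -> disc (g u).
  move=> hu; rewrite discE -(@expr_lt1 _ 2)// ?cabs_ge0// g2// gtrBl mulr_gt0//.
  by rewrite divr_gt0 ?one_sub_sqr ?sqr_den_gt0//; [exact: psid|apply/ltW/psid].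
have dg : analytic_on disc g.
  apply: analyticM; first by apply: analyticB; [exact: dpsi|exact: analytic_cst].
  apply: analyticV; last by move=> z hz; apply: blaschke_den => //; exact: psid.
  apply: analyticB; first exact: analytic_cst.
  by apply: analyticM; [exact: analytic_cst|exact: dpsi].
have did : analytic_on disc (id : C -> C) by exact: analytic_id.
have cid := rcts_sker did (fun z hz => hz) na1 (ltW q0) q1.
pose k := L / (1 + r0) * (1 - cabs a ^+ 2).
have k0 : 0 <= k by rewrite mulr_ge0 ?(ltW A1)// divr_ge0// addr_ge0.
have cq s : disc (circ q s) by apply: circ_disc => //; exact: ltW.
have H := @cartan_jensen _ g r q (fun s => k * sker (- a) (circ q s)) dg gd q0 qg0 rp r1
  (rctsM (@rcts_cst _ k) cid).
have {}H : ravg (fun t => ln (Num.max q (cabs (g (circ r t))))) <= ln (cabs (g 0)) +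
    ravg (fun s => k * sker (- a) (circ q s)).
  apply: H => [s|s zs h hzs dh fh].
    by rewrite mulr_ge0// sker_ge0.
  set v := circ q s in fh *.
  have v1 : cabs v <= 1 by apply/ltW/cq.
  pose w := (v + a) / (1 + conjc a * v).
  have dk : analytic_on disc (fun u => h u * ((1 - conjc a * psi u) * (1 + conjc a * v)^-1)).
    apply: analyticM; first exact: dh.
    apply: analyticM; last exact: analytic_cst.
    apply: analyticB; first exact: analytic_cst.
    by apply: analyticM; [exact: analytic_cst|exact: dpsi].
  have fk u : disc u -> psi u - w = bnum zs u * (h u * ((1 - conjc a * psi u) * (1 + conjc a * v)^-1)).
    by move=> hu; rewrite (mobius_inverse (gE u hu) (nden _ v1)) fh// !mulrA.
  have w2 : cabs w ^+ 2 = 1 - (1 - cabs a ^+ 2) * sker (- a) v.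
    rewrite -(cabsN a) -mobius_sqr// opprK rmorphN mulNr opprK.
    by rewrite /w cabsM cabsV exprMn exprVn.
  have sv : 0 < sker (- a) v.
    by rewrite divr_gt0 ?one_sub_sqr ?sqr_den_gt0//; exact: cq.
  have wr : r0 < cabs w by exact: hq.
  have w1 : cabs w < 1.
    by rewrite -(@expr_lt1 _ 2)// ?cabs_ge0// w2 gtrBl mulr_gt0.
  have := le_trans (nevanlinna_ge hzs dk fk) (NL w wr w1).
  rewrite lee_fin => /le_trans; apply.
  have -> : k * sker (- a) v = L * ((1 - cabs w ^+ 2) / (1 + r0)).
    by rewrite w2 /k; field; rewrite gt_eqF// ltr_pwDl.
  apply: ler_wpM2l => //; rewrite ler_pdivlMr ?ltr_pwDl//.
  have -> : 1 - cabs w ^+ 2 = (1 - cabs w) * (1 + cabs w) by ring.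
  by apply: ler_wpM2l; lra.
have S1 : ravg (fun s => k * sker (- a) (circ q s)) <= k.
  by rewrite (ravgZ _ cid) ler_piMr//; apply: sker_mean_id => //; exact: ltW.
have cS := rcts_sker dpsi psid a1 rp r1.
pose k' := - ((1 - cabs a ^+ 2) / (2 * q ^+ 2)).
have lo : k' * ravg (fun t => sker a (psi (circ r t))) <=
    ravg (fun t => ln (Num.max q (cabs (g (circ r t))))).
  rewrite -(ravgZ _ cS).
  apply: (ravg_le (rctsM (@rcts_cst _ k') cS)).
    apply: rcts_ln; last by move=> t; rewrite lt_max q0.
    move=> t tt; apply: (@continuous_max _ _ (fun=> q) (fun t => cabs (g (circ r t))) t).
      exact: cvg_cst.
    exact: (rcts_cabs (circ_ccts rp r1 dg) tt).
  move=> t; have hc : disc (circ r t) by exact: circ_disc.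
  apply: le_trans (ln_max_ge q0 (ltW q1) (cabs_ge0 _) (ltW (gd _ hc))).
  by rewrite g2// /k' le_eqVlt; apply/orP; left; apply/eqP; ring.
have g00 : 0 < cabs (g 0) by exact: lt_trans qg0.
have up : ln (cabs (g 0)) <= - ((1 - cabs a ^+ 2) * sker a (psi 0)) / 2.
  have : ln (cabs (g 0) ^+ 2) <= cabs (g 0) ^+ 2 - 1 by apply: ln_le_sub1; rewrite exprn_gt0.
  by rewrite lnXn// (g2 _ (disc0 R)) mulr2n; move: (ln _) (_ * _) => *; lra.
have := le_trans lo (le_trans H (lerD up S1)).
move: q0 A1; rewrite /k' /k.
move: (ravg (fun t => sker a _)) (1 - cabs a ^+ 2) (sker a _) (L / _) => S A s0 l q0 A1 HH.
have q2 : 0 < 2 * q ^+ 2 / A by rewrite divr_gt0// mulr_gt0// exprn_gt0.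
have := ler_wpM2l (ltW q2) HH.
have -> : 2 * q ^+ 2 / A * (- (A / (2 * q ^+ 2)) * S) = - S by field; rewrite !gt_eqF.
have -> : 2 * q ^+ 2 / A * (- (A * s0) / 2 + l * A) = - (q ^+ 2 * (s0 - 2 * l)).
  by field; rewrite gt_eqF.
by rewrite lerN2.
Qed.

Lemma integral_le a r (q r0 L : R) : disc a -> 0 < q -> q < 1 -> 0 <= r0 -> 0 <= L ->
  0 <= r -> r < 1 -> q < cabs ((psi 0 - a) / (1 - conjc a * psi 0)) ->
  (forall s, r0 < cabs ((circ q s + a) / (1 + conjc a * circ q s))) ->
  (forall w, r0 < cabs w -> cabs w < 1 -> (nevanlinna psi w <= (L * (1 - cabs w))%:E)%E) ->
  ravg (fun t => pker a (psi (circ r t))) <=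
    pker a (psi 0) + (1 - q ^+ 2) * sker a (psi 0) + 2 * (L / (1 + r0)).
Proof.
move=> a1 q0 q1 r00 L0 rp r1 qg0 hq NL.
have h1 := sker_mean_ge a1 q0 q1 r00 L0 rp r1 qg0 hq NL.
have h2 := pker_sker_mean dpsi psid a1 rp r1.
have l0 : 0 <= L / (1 + r0) by rewrite divr_ge0// addr_ge0.
have s0 := sker_ge0 a (psid (disc0 R)).
have A0 : 0 <= cabs a ^+ 2 by exact: sqr_ge0.
have A1 := one_sub_sqr a1.
have q2 : q ^+ 2 <= 1 by rewrite expr_le1// ltW.
have q20 : 0 <= q ^+ 2 by exact: sqr_ge0.
move: h1 h2 l0 s0 A0 A1 q2 q20.
move: (ravg _) (ravg _) (pker _ _) (sker _ _) (L / _) (cabs a ^+ 2) (q ^+ 2).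
move=> In Sn p s l A Q h1 h2 l0 s0 A0 A1 Q1 Q0.
have h3 := ler_wpM2l A0 h1.
have h4 : A * (1 - Q) * s <= 1 * (1 - Q) * s.
  by apply: ler_wpM2r => //; apply: ler_wpM2r; lra.
have h5 : A * Q * l <= 1 * l.
  by apply: ler_wpM2r => //; apply: (@le_trans _ _ (1 * Q)); [apply: ler_wpM2r|]; lra.
lra.
Qed.

End UpperBound.

(** * Comparison of the limits superior *)

Section Limsup.
Variable R : realType.
Local Notation C := R[i].
Implicit Types (a z w u v : C) (r s t c : R) (f g : C^o -> \bar R).

Lemma to_circleP (V : set C^o) : to_circle V <->
  exists2 p : R, p < 1 & forall z, p < cabs z -> cabs z < 1 -> V z.
Proof.
split=> [/nbhs_ballP[e /= e0 H]|[p p1 H]].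
  exists (1 - e); first by rewrite gtrBl.
  move=> z h1 h2; apply: (H (cabs z)) => //.
  by rewrite /ball /= ger0_norm ?subr_ge0; [lra|exact: ltW].
apply/nbhs_ballP; exists (1 - p); first by rewrite /= subr_gt0.
move=> r; rewrite /ball /= => h1 h2 z zr; apply: H; rewrite zr//.
by move: h1; rewrite ger0_norm ?subr_ge0; [lra|exact: ltW].
Qed.

Lemma limsup_circle_le f (c : \bar R) (p : R) : p < 1 ->
  (forall z, p < cabs z -> cabs z < 1 -> (f z <= c)%E) ->
  (limf_esup f to_circle <= c)%E.
Proof.
move=> p1 H; apply: ge_ereal_inf.
exists (ereal_sup (f @` [set z | p < cabs z < 1])).
  exists [set z | p < cabs z < 1] => //; apply/to_circleP; exists p => // z h1 h2.
  by rewrite /= h1 h2.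
by apply: ge_ereal_sup => _ [z /andP[h1 h2] <-]; exact: H.
Qed.

Lemma limsup_circle_lt f (c : \bar R) : (limf_esup f to_circle < c)%E ->
  exists2 p : R, p < 1 & forall z, p < cabs z -> cabs z < 1 -> (f z <= c)%E.
Proof.
move=> /ereal_inf_lt[_ [V /to_circleP[p p1 HV] <-] H]; exists p => // z h1 h2.
apply: (le_trans _ (ltW H)); apply: ereal_sup_ubound; exists z => //.
exact: HV.
Qed.

Lemma le_of_reals (x y : \bar R) : (forall c, y < c%:E -> x <= c%:E)%E -> (x <= y)%E.
Proof.
case: y => [y| |] H; last 1 first.
- by case: x H => [x| |] H //; [have h1 := H (x - 1)%R (ltNyr _); rewrite lee_fin in h1; exfalso; lra|have := H 0 (ltNyr _)].
- by apply/lee_addgt0Pr => e e0; apply: H; rewrite lte_fin ltrDl.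
- exact: leey.
Qed.

Lemma le_limsup_circle f g :
  (forall c (p : R) (e : R), p < 1 -> 0 < e ->
    (forall z, p < cabs z -> cabs z < 1 -> (g z <= c%:E)%E) ->
    exists2 p' : R, p' < 1 &
      forall z, p' < cabs z -> cabs z < 1 -> (f z <= (c + e)%:E)%E) ->
  (limf_esup f to_circle <= limf_esup g to_circle)%E.
Proof.
move=> H; apply: le_of_reals => c /limsup_circle_lt[p p1 Hg].
apply/lee_addgt0Pr => e e0; have [p' p'1 Hf] := H c p e p1 e0 Hg.
by apply: (limsup_circle_le p'1) => z h1 h2; rewrite -EFinD; exact: Hf.
Qed.

Lemma sqr_near1 w (x : R) : 0 < x -> 1 - x / 2 < cabs w -> cabs w < 1 ->
  0 < 1 - cabs w ^+ 2 /\ 1 - cabs w ^+ 2 < x.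
Proof. by have := cabs_ge0 w; move: (cabs w) => r r0 x0 h1 h2; split; nra. Qed.

Lemma cvg_seq_le (q : nat -> R) (l M : R) : q @ \oo --> l -> (forall n, q n <= M) -> l <= M.
Proof.
move=> ql qM; rewrite -(cvg_lim _ ql)//; apply: limr_le; last exact: nearW.
by apply/cvg_ex; exists l.
Qed.

Lemma cvg_seq_ge (q : nat -> R) (l M : R) : q @ \oo --> l -> (forall n, M <= q n) -> M <= l.
Proof.
move=> ql qM; rewrite -(cvg_lim _ ql)//; apply: limr_ge; last exact: nearW.
by apply/cvg_ex; exists l.
Qed.

Lemma exists_modulus (p : R) : p < 1 -> exists2 w : C, p < cabs w & cabs w < 1.
Proof.
move=> p1; pose x := (Num.max p 0 + 1) / 2.
have h0 : p <= Num.max p 0 by rewrite le_max lexx.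
have h1 : 0 <= Num.max p 0 by rewrite le_max lexx orbT.
have h2 : Num.max p 0 < 1 by rewrite gt_max p1 ltr01.
exists x%:C%C; rewrite cabs_real /x ger0_norm; lra.
Qed.

Variable psi : C -> C.
Hypothesis dpsi : analytic_on disc psi.
Hypothesis psid : forall z, disc z -> disc (psi z).

Let F w : \bar R := (nevanlinna psi w / (1 - cabs w)%:E)%E.
Let G a : \bar R := circle_integral (fun zeta => (pker a (boundary psi zeta))%:E).

Lemma F_le w c : cabs w < 1 ->
  (F w <= c%:E)%E = (nevanlinna psi w <= (c * (1 - cabs w))%:E)%E.
Proof.
move=> w1; have w0 : 0 < 1 - cabs w by rewrite subr_gt0.
by rewrite /F inver gt_eqF// lee_pdivrMr// EFinM.
Qed.

Lemma inv_den_le w v : disc w -> disc v ->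
  (cabs (1 - conjc w * v) ^+ 2)^-1 <= ((1 - cabs v) ^+ 2)^-1.
Proof.
move=> w1 v1; have v0 : 0 < 1 - cabs v by rewrite subr_gt0.
rewrite lef_pV2 ?posrE ?exprn_gt0// ?cabs_gt0 ?blaschke_den//.
rewrite lerXn2r ?nnegrE ?cabs_ge0 ?(ltW v0)//.
have := cabsB_ge 1 (conjc w * v); rewrite cabs1 cabsM cabs_conj.
by have := ler_wpM2r (cabs_ge0 v) (ltW w1); rewrite mul1r; lra.
Qed.

Lemma sker_le w v : disc w -> disc v -> sker w v <= ((1 - cabs v) ^+ 2)^-1.
Proof.
move=> w1 v1; apply: le_trans (inv_den_le w1 v1).
apply: ler_piMl; first by rewrite invr_ge0 sqr_ge0.
by rewrite gerBl sqr_ge0.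
Qed.

Lemma pker_le_near a v : disc a -> disc v ->
  pker a v <= (1 - cabs a ^+ 2) * ((1 - cabs v) ^+ 2)^-1.
Proof.
move=> a1 v1; apply: ler_wpM2l; last exact: inv_den_le.
by rewrite ltW// one_sub_sqr.
Qed.

Let D : R := ((1 - cabs (psi 0)) ^+ 2)^-1.

Let D_gt0 : 0 < D.
Proof. by rewrite invr_gt0 exprn_gt0// subr_gt0; exact: (psid (disc0 R)). Qed.

Lemma limsup_counting_le : (limf_esup (F : C^o -> \bar R) to_circle <=
  limf_esup (G : C^o -> \bar R) to_circle)%E.
Proof.
apply: le_limsup_circle => c p e p1 e0 HG.
have hp := psid (disc0 R).
have D0 := D_gt0.
have c0 : 0 <= c.
  have [w pw w1] := exists_modulus p1.
  have [I GI II] := circle_integral_lim dpsi psid w1.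
  have := HG w pw w1; rewrite /G GI lee_fin => /(le_trans _); apply.
  apply: (cvg_seq_ge II) => n.
  rewrite -(ravg_cst (0 : R)); apply: (ravg_le (@rcts_cst _ 0)
    (rcts_pker dpsi psid w1 (radii_ge0 R n) (radii_lt1 R n))) => t.
  exact: pker_ge0.
(* For 1 - |w|^2 < x both |w|^2 and |phi_w (psi 0)|^2 are at least 1/2, and the
   error terms add up to at most e. *)
pose x := Num.min (1 / 2) (Num.min ((2 * D)^-1) (e / (2 * D ^+ 2 + 2 * c))).
have K0 : 0 < 2 * D ^+ 2 + 2 * c by rewrite ltr_pwDl ?mulr_gt0 ?exprn_gt0// mulr_ge0.
have x0 : 0 < x by rewrite !lt_min !divr_gt0//= invr_gt0 mulr_gt0.
exists (Num.max p (Num.max (cabs (psi 0)) (1 - x / 2))).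
  by rewrite !gt_max p1 (hp : cabs (psi 0) < 1)/= gtrBl divr_gt0.
move=> w; rewrite !gt_max => /andP[pw /andP[psiw xw]] w1.
have [W1 Wx] := sqr_near1 x0 xw w1.
have w0 : w != 0 by rewrite -cabs_gt0 (le_lt_trans _ psiw)// cabs_ge0.
have p0w : psi 0 != w by apply: contraTneq psiw => ->; rewrite ltxx.
have [I GI II] := circle_integral_lim dpsi psid w1.
have I0 : 0 <= I.
  apply: (cvg_seq_ge II) => n.
  rewrite -(ravg_cst (0 : R)); apply: (ravg_le (@rcts_cst _ 0)
    (rcts_pker dpsi psid w1 (radii_ge0 R n) (radii_lt1 R n))) => t.
  exact: pker_ge0.
have Ic : I <= c by have := HG w pw w1; rewrite /G GI lee_fin.
rewrite F_le//; apply: (le_trans (counting_le dpsi psid w1 w0 p0w I0 II)).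
rewrite lee_fin mulrC; apply: ler_wpM2r; first by rewrite subr_ge0 ltW.
have s0 := sker_ge0 w hp; have sD := sker_le w1 hp; rewrite -/D in sD.
move: W1 Wx; rewrite !lt_min => W1 /andP[Wx1 /andP[Wx2 Wx3]].
rewrite -[X in _ < X]div1r ltr_pdivlMr ?mulr_gt0// in Wx2.
rewrite ltr_pdivlMr// in Wx3.
move: s0 sD W1 Wx1 Wx2 Wx3; move: (sker w _) (cabs w ^+ 2) => s W s0 sD W1 Wx1 Wx2 Wx3.
pose y := 1 - W; have Wy : W = 1 - y by rewrite /y; ring.
rewrite Wy (_ : 1 - (1 - y) = y); last by ring.
rewrite -/y in W1 Wx1 Wx2 Wx3.
have ys : y * s <= y * D by apply: ler_wpM2l => //; exact: ltW.
have h1 : (1 - y * s)^-1 - 1 <= 2 * (y * D).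
  have z0 : 0 < 1 - y * s by lra.
  rewrite -(ler_pM2r z0) mulrBl mulVf ?gt_eqF// mul1r.
  have yD : 0 <= y * D by rewrite mulr_ge0// ltW.
  have : 2 * (y * D) * (1 / 2) <= 2 * (y * D) * (1 - y * s) by apply: ler_wpM2l; lra.
  lra.
have h2 : s * ((1 - y * s)^-1 - 1) <= D * (2 * (y * D)).
  apply: (le_trans (ler_wpM2l s0 h1)); apply: ler_wpM2r => //.
  by rewrite !mulr_ge0// ltW.
have h3 : I / (1 - y) <= c + 2 * c * y.
  have y1 : 0 < 1 - y by lra.
  rewrite ler_pdivrMr//; apply: (le_trans Ic).
  have : 0 <= c * (y * (1 - 2 * y)) by rewrite !mulr_ge0 ?(ltW W1)//; lra.
  lra.
rewrite mulrDr in Wx3.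
move: h2 h3 Wx3; rewrite expr2; move: (s * _) (I / _) => *; lra.
Qed.

Lemma limsup_integral_le : (limf_esup (G : C^o -> \bar R) to_circle <=
  limf_esup (F : C^o -> \bar R) to_circle)%E.
Proof.
apply: le_limsup_circle => c p e p1 e0 HF.
have hp := psid (disc0 R).
have D0 := D_gt0.
have NL w : p < cabs w -> cabs w < 1 -> (nevanlinna psi w <= (c * (1 - cabs w))%:E)%E.
  by move=> pw w1; rewrite -F_le//; exact: HF.
have c0 : 0 <= c.
  have [w pw w1] := exists_modulus p1.
  have df : analytic_on disc (fun u => psi u - w) by apply: analyticB; [exact: dpsi|exact: analytic_cst].
  have fE u : disc u -> psi u - w = bnum [::] u * (psi u - w) by rewrite /bnum big_nil mul1r.
  have z0 z : z \in ([::] : seq C) -> 0 < cabs z < 1 by [].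
  have := le_trans (nevanlinna_ge z0 df fE) (NL w pw w1).
  by rewrite big_nil lee_fin pmulr_lge0// subr_gt0.
(* e1 is the share of the error allotted to each of three terms. *)
pose e1 := e / 3.
have e10 : 0 < e1 by rewrite divr_gt0.
pose r0 := Num.max (Num.max p 0) (1 - e1 / (c + 1)).
have c1 : 0 < c + 1 by rewrite ltr_wpDl.
have r00 : 0 <= r0 by rewrite /r0 !le_max lexx orbT.
have pr0 : p <= r0 by rewrite /r0 !le_max lexx.
have r01 : r0 < 1 by rewrite !gt_max p1 ltr01 gtrBl divr_gt0.
have r0e : (1 - r0) * (c + 1) <= e1.
  rewrite -ler_pdivlMr//; have : 1 - e1 / (c + 1) <= r0 by rewrite /r0 le_max lexx orbT.
  by move: (e1 / _) => *; lra.
pose q := Num.max (1 / 2) (1 - e1 / (2 * D)).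
have q0 : 0 < q by rewrite lt_max divr_gt0.
have q1 : q < 1 by rewrite gt_max gtrBl divr_gt0 ?mulr_gt0// andbT; lra.
have qe : (1 - q) * (2 * D) <= e1.
  rewrite -ler_pdivlMr ?mulr_gt0//; have : 1 - e1 / (2 * D) <= q by rewrite le_max lexx orbT.
  by move: (e1 / _) => *; lra.
have q2 : 0 < 1 - q ^+ 2 by rewrite subr_gt0 expr_lt1// ltW.
have r02 : 0 < 1 - r0 ^+ 2 by rewrite subr_gt0 expr_lt1.
have q3 : 0 < (1 - q) ^+ 2 by rewrite exprn_gt0// subr_gt0.
(* For 1 - |a|^2 < x, in this order: pker a (psi 0) is at most e1, q is less than
   |phi_a (psi 0)|, and the preimages of the circle |v| = q under phi_a have
   modulus greater than r0. *)
pose x := Num.min (e1 / D) (Num.min ((1 - q ^+ 2) / D) ((1 - r0 ^+ 2) * (1 - q) ^+ 2)).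
have x0 : 0 < x by rewrite !lt_min !divr_gt0//= mulr_gt0.
exists (1 - x / 2); first by rewrite gtrBl divr_gt0.
move=> a xa a1; have [A1] := sqr_near1 x0 xa a1.
rewrite !lt_min => /andP[Ax1 /andP[Ax2 Ax3]].
rewrite !ltr_pdivlMr// in Ax1 Ax2.
have sD := sker_le a1 hp; rewrite -/D in sD.
have s0 := sker_ge0 a hp.
have pD := pker_le_near a1 hp; rewrite -/D in pD.
have qg : q < cabs ((psi 0 - a) / (1 - conjc a * psi 0)).
  rewrite -(@ltr_pXn2r _ 2)// ?nnegrE ?cabs_ge0 ?(ltW q0)// cabsM cabsV exprMn exprVn.
  rewrite mobius_sqr//; last exact: ltW.
  have : (1 - cabs a ^+ 2) * sker a (psi 0) <= (1 - cabs a ^+ 2) * D.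
    by apply: ler_wpM2l => //; exact: ltW.
  by move: Ax2; move: (_ * sker _ _) (_ * D) => *; lra.
have hq s : r0 < cabs ((circ q s + a) / (1 + conjc a * circ q s)).
  have na1 : disc (- a) by rewrite discE cabsN.
  have cq : cabs (circ q s) = q by rewrite cabs_circ// ltW.
  have dq : disc (circ q s) by rewrite discE cq.
  rewrite -(@ltr_pXn2r _ 2)// ?nnegrE ?cabs_ge0// cabsM cabsV exprMn exprVn.
  have := @mobius_sqr _ (- a) (circ q s) na1 (ltW dq).
  rewrite opprK rmorphN mulNr opprK cabsN => ->.
  have := sker_le na1 dq; rewrite cq => sq.
  have h1 : (1 - cabs a ^+ 2) * sker (- a) (circ q s) <= (1 - cabs a ^+ 2) * ((1 - q) ^+ 2)^-1.
    by apply: ler_wpM2l => //; exact: ltW.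
  have h2 : (1 - cabs a ^+ 2) / (1 - q) ^+ 2 < 1 - r0 ^+ 2 by rewrite ltr_pdivrMr.
  by move: h1 h2; move: (_ * sker _ _) (_ / _) => *; lra.
have NL' w : r0 < cabs w -> cabs w < 1 -> (nevanlinna psi w <= (c * (1 - cabs w))%:E)%E.
  by move=> rw; apply: NL; exact: le_lt_trans rw.
have [I GI II] := circle_integral_lim dpsi psid a1.
rewrite /G GI lee_fin; apply: (cvg_seq_le II) => n.
apply: (le_trans (integral_le dpsi psid a1 q0 q1 r00 c0 (radii_ge0 R n) (radii_lt1 R n) qg hq NL')).
have t1 : 2 * (c / (1 + r0)) <= c + e1.
  rewrite mulrA ler_pdivrMr ?ltr_pwDl//.
  have m1 : 0 <= e1 * r0 by rewrite mulr_ge0// ltW.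
  lra.
have t2 : (1 - q ^+ 2) * sker a (psi 0) <= e1.
  apply: le_trans qe; rewrite [leRHS]mulrA; apply: ler_pM => //; first exact: ltW.
  have := sqr_ge0 (1 - q); lra.
have e3 : e = e1 + e1 + e1 by rewrite /e1; field.
by rewrite e3; move: t1 t2 pD Ax1; move: (pker _ _) (_ * sker _ _) (2 * _) (_ * D) => *; lra.
Qed.

End Limsup.

Theorem theorem2p2 (R : realType) (psi : R[i] -> R[i])
    (psi_analytic : analytic_on disc psi)
    (psi_disc : forall z : R[i], disc z -> disc (psi z)) :
  limf_esup (fun w : R[i]^o => (nevanlinna psi w / (1 - cabs w)%:E)%E) to_circle =
  limf_esup (fun a : R[i]^o => circle_integral (fun zeta : R[i] =>
      ((1 - cabs a ^+ 2) / cabs (1 - conjc a * boundary psi zeta) ^+ 2)%:E))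
    to_circle.
Proof.
apply/eqP; rewrite eq_le; apply/andP; split.
  exact: (limsup_counting_le psi_analytic psi_disc).
exact: (limsup_integral_le psi_analytic psi_disc).
Qed.
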